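(* Under Assumptions 1 and 2 (stated in the context), for the choice $$p_k=\frac{\bar F_I(b+n_{k-1}\mu)-\bar F_I(b+n_k\mu)}{\bar F_I(b)},\qquad k\ge1,$$ the family of unbiased estimators $(Z(b):b>0)$ achieves asymptotically vanishing relative error for the computation of $\mathbb{P}\{\tau_b<\infty\}$ as $b\nearrow\infty$; that is, $$\limsup_{b\to\infty}\frac{\mathrm{Var}^Q[Z(b)]}{\mathbb{P}\{\tau_b<\infty\}^2}=0 .$$
   Context: $X,X_1,X_2,\dots$ are i.i.d. real random variables with distribution function $F$, $\mathbb{E}X=0$, under a probability measure $\mathbb{P}$; $S_0=0$, $S_n=X_1+\dots+X_n$. Fix $\mu>0$ and an integer $r>1$. For $b>0$, $\tau_b:=\inf\{n\ge0: S_n-n\mu>b\}$. $n_0=0$, $n_k=r^k$ for $k\ge1$. Assumption 1: $\bar F(x):=\mathbb{P}\{X>x\}=x^{-\alpha}L(x)$ for some $\alpha>1$ and some slowly varying $L$ (i.e. $L(tx)/L(x)\to1$ as $x\to\infty$ for every $t>0$). Further, if $\mathrm{Var}[X]=\infty$, then $\limsup_{x\to\infty}\mathbb{P}\{X<-x\}/\mathbb{P}\{X>x\}<\infty$. Assumption 2: there is $t_0>0$ such that $L$ is continuously differentiable on $[t_0,\infty)$, and $L'(x)=o(L(x)/x)$ as $x\nearrow\infty$. $\bar F_I(x):=\int_x^\infty\bar F(u)\,du$; $q_k(b):=\sum_{i=n_{k-1}+1}^{n_k}\bar F(b+i\mu)$. Events: $A_k=\bigcup_{i=n_{k-1}+1}^{n_k}\{X_i>b+i\mu\}$,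 $B_k=\bigcap_{i=1}^{n_k}\{X_i<b+n_{k-1}\mu\}$; bars denote complements. Measure $\mathbb{P}_{k,1}$: choose $J\in\{n_{k-1}+1,\dots,n_k\}$ with $\Pr\{J=n\}=\bar F(b+n\mu)/q_k(b)$; then generate independently $X_n$, $n\le n_k$, from $F(\cdot\mid X_n\ge b+n\mu)$ if $n=J$ and from $F$ otherwise. Estimator: $$Z_{k,1}(b):=\frac{q_k(b)}{\#\{n_{k-1}<i\le n_k: X_i\ge b+i\mu\}}\mathbb{I}(n_{k-1}<\tau_b\le n_k,\ A_k).$$ Measure $\mathbb{P}_{k,2}$: let $\theta_k=\theta_k(b):=\frac{-\log(n_k\bar F(b+n_{k-1}\mu))}{b+n_{k-1}\mu}$ (positive for all $k$ once $b$ is large) and $\Lambda_k(\theta):=\log\int_{-\infty}^{b+n_{k-1}\mu}e^{\theta x}F(dx)$, $\theta\ge0$. Generate $X_1,\dots,X_{\tau_b\wedge n_k}$ independently from $F_k$, where $\frac{dF_k(x)}{dF(x)}=\exp(\theta_kx-\Lambda_k(\theta_k))\mathbf 1(x<b+n_{k-1}\mu)$; the remaining increments up to index $n_k$ have law $F$ independently. Estimator: $$Z_{k,2}(b):=\exp(-\theta_kS_{\tau_b}+\tau_b\Lambda_k(\theta_k))\,\mathbb{I}(n_{k-1}<\tau_b\le n_k,\ B_k).$$ Measure $\mathbb{P}_{k,3}$: choose $J$ uniformly from $\{1,\dots,n_k\}$; generate independently $X_n$, $n\le n_k$, from $F(\cdot\mid X_n\ge b+n_{k-1}\mu)$ if $n=J$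 and from $F$ otherwise. Estimator: $$Z_{k,3}(b):=\frac{n_k\bar F(b+n_{k-1}\mu)}{\#\{1\le i\le n_k: X_i\ge b+n_{k-1}\mu\}}\mathbb{I}(n_{k-1}<\tau_b\le n_k,\ \bar A_k\cap\bar B_k).$$ $Z_k(b):=Z_{k,1}(b)+Z_{k,2}(b)+Z_{k,3}(b)$, with the three summands generated independently under $\mathbb{P}_{k,1},\mathbb{P}_{k,2},\mathbb{P}_{k,3}$ respectively; it estimates $\mathbb{P}\{n_{k-1}<\tau_b\le n_k\}$. Overall estimator: given a probability mass function $(p_k:k\ge1)$ with all $p_k>0$ (possibly depending on $b$), draw $K$ with $\Pr\{K=k\}=p_k$; given $K=k$ generate $Z_{k,1}(b),Z_{k,2}(b),Z_{k,3}(b)$ independently under $\mathbb{P}_{k,1},\mathbb{P}_{k,2},\mathbb{P}_{k,3}$ respectively and form their sum $Z_k(b)$; set $Z(b):=Z_K(b)/p_K$, an estimator of $\mathbb{P}\{\tau_b<\infty\}$. $Q$ is the probability measure induced by this procedure, and $\mathrm{Var}^Q$ the corresponding variance.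
   Formalization: Unbiasedness of Z(b) is asserted for all sufficiently large b rather than every b>0: for small b, F may have atoms (P{X>x} in the weights versus conditioning on X≥x gives bias) or θ_k may be negative, outside the domain of Λ_k. *)

(* Defs.v *)
From HB Require Import structures.
From mathcomp Require Import all_boot all_order all_algebra.
From mathcomp Require Import all_classical all_reals all_analysis measurable_realfun.

Set Implicit Arguments.
Unset Strict Implicit.
Unset Printing Implicit Defensive.
Import Order.TTheory GRing.Theory Num.Theory.
Import numFieldNormedType.Exports.

Local Open Scope classical_set_scope.
Local Open Scope ring_scope.

Definition mutually_independent d (T : measurableType d) (R : realType)
    (P : probability T R) (X : nat -> {RV P >-> R}) : Prop :=
  forall (s : seq nat) (A : nat -> set R), uniq s ->
    (forall i, measurable (A i)) ->
    P (\bigcap_(i in [set` s]) (X i @^-1` A i)) =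
    (\prod_(i <- s) P (X i @^-1` A i))%E.

Definition slowly_varying (R : realType) (L : R -> R) : Prop :=
  forall t : R, 0 < t -> L (t * x) / L x @[x --> +oo] --> (1 : R).

(* The law obtained by drawing k with probability [w k], then from [nu k].
   When [w] is a probability mass function, [mnormalize] and the absolute value
   act as the identity: they only make the definition total. *)
Definition mixture d (T : measurableType d) (R : realType)
    (w : nat -> R) (nu : nat -> probability T R) : probability T R :=
  mnormalize (mseries (fun k => mscale (NngNum (normr_ge0 (w k))) (nu k)) 0%N)
             (nu 0%N).

Definition cond_law (R : realType) (F : probability R R) (D : set R)
    (mD : measurable D) : probability R R :=
  mnormalize (mrestr F mD) F.

Section tilting.
Context {R : realType} (F : probability R R) (c theta Lambda : R).

Definition tilted (A : set R) : \bar R :=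
  (\int[F]_(x in A) (expR (theta * x - Lambda) * \1_(`]-oo, c[%classic) x)%:E)%E.

Let tilted0 : tilted set0 = 0%E.
Proof. by rewrite /tilted integral_set0. Qed.

Let tilted_ge0 A : (0 <= tilted A)%E.
Proof. by apply: integral_ge0 => x _; rewrite lee_fin mulr_ge0// expR_ge0. Qed.

Let tilted_sigma_additive : semi_sigma_additive tilted.
Proof.
move=> A mA tA mUA; rewrite /tilted ge0_integral_bigcup//=.
- apply: is_cvg_ereal_nneg_natsum_cond => n _ _; exact: tilted_ge0.
- apply/measurable_EFinP/measurable_funM => //.
  apply: measurable_funTS; apply: measurableT_comp => //.
  by apply: measurable_funB => //; exact: measurable_funM.
Qed.

HB.instance Definition _ :=
  isMeasure.Build _ _ _ tilted tilted0 tilted_ge0 tilted_sigma_additive.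

(* [tilted] has mass 1 when [Lambda] is the logarithm of the finite integral of
   exp (theta x) over x < c, and [mnormalize] is then the identity. *)
Definition tilted_law : probability R R := mnormalize tilted F.

End tilting.

Section tuple_cons.
Context {R : realType} (n : nat).

Definition tuple_cons (x : R * n.-tuple R) : n.+1.-tuple R :=
  [tuple of x.1 :: x.2].

Let measurable_tuple_cons : measurable_fun setT tuple_cons.
Proof. exact: measurable_cons. Qed.

HB.instance Definition _ :=
  isMeasurableFun.Build _ _ _ _ tuple_cons measurable_tuple_cons.

End tuple_cons.

(* Joint law of independent X_1, ..., X_n with X_i of law [nu i]: the indices
   start at 1, so that X_i is the entry of rank i.-1 of the tuple. *)
Fixpoint indep_law (R : realType) (n : nat) (nu : nat -> probability R R) :
    probability (n.-tuple R) R :=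
  match n return probability (n.-tuple R) R with
  | 0%N => \d_([tuple])
  | m.+1 => distribution (nu 1%N \x indep_law m (nu \o S))%E (@tuple_cons R m)
  end.

(* Disjoint union of countably many measurable spaces. *)
Section strata.
Context {d : measure_display} (T : nat -> measurableType d).

Definition strata : Type := {k : nat & T k}.

HB.instance Definition _ := gen_eqMixin strata.
HB.instance Definition _ := gen_choiceMixin strata.
HB.instance Definition _ := isPointed.Build strata (existT _ 0%N (@point (T 0%N))).

Definition strata_measurable : set_system strata :=
  [set A | forall k, measurable (existT T k @^-1` A)].

Let strata_measurable0 : strata_measurable set0.
Proof. by move=> k; rewrite preimage_set0; exact: (@measurable0 _ (T k)). Qed.

Let strata_measurableC A : strata_measurable A -> strata_measurable (~` A).
Proof. by move=> mA k; rewrite preimage_setC; apply: measurableC; exact: mA. Qed.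

Let strata_measurable_bigcup (A : (set strata)^nat) :
  (forall i, strata_measurable (A i)) -> strata_measurable (\bigcup_i A i).
Proof.
move=> mA k; rewrite preimage_bigcup; apply: bigcup_measurable => i _.
exact: mA.
Qed.

HB.instance Definition _ := isMeasurable.Build d strata
  strata_measurable0 strata_measurableC strata_measurable_bigcup.

Definition in_stratum k (t : T k) : strata := existT T k t.

Let measurable_in_stratum k : measurable_fun setT (@in_stratum k).
Proof. by move=> _ A mA; rewrite setTI; exact: mA. Qed.

HB.instance Definition _ k :=
  isMeasurableFun.Build _ _ _ _ (@in_stratum k) (@measurable_in_stratum k).

End strata.

(* A trajectory is a function [x : nat -> R] with increments x 1, x 2, ...; the
   value x 0 plays no role. *)
Section trajectories.
Context {R : realType}.
Implicit Types (mu b : R) (x : nat -> R).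

Definition walk x n : R := \sum_(1 <= i < n.+1) x i.

(* [tau mu b x = None] stands for tau_b = +oo. *)
Definition tau mu b x : option nat :=
  if pselect (exists n, walk x n - n%:R * mu > b) is left e
  then Some (ex_minn e) else None.

Definition tuple_path n (t : n.-tuple R) : nat -> R :=
  fun i => if i is j.+1 then nth 0 t j else 0.

End trajectories.

Section tails.
Context {R : realType} (F : probability R R).

Definition tail (x : R) : R := fine (F `]x, +oo[%classic).

Definition integrated_tail (x : R) : R :=
  \int[lebesgue_measure]_(u in `[x, +oo[%classic) tail u.

End tails.

Section estimator.
Context {R : realType}.
Variables (F : probability R R) (mu : R) (r : nat) (b : R).

Definition nk (k : nat) : nat := if k is 0%N then 0%N else (r ^ k)%N.

Definition level (k : nat) : R := b + (nk k)%:R * mu.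

Definition block (k : nat) : seq nat := index_iota (nk k.-1).+1 (nk k).+1.

Definition qk (k : nat) : R := \sum_(i <- block k) tail F (b + i%:R * mu).

Definition tau_in_block (k : nat) (x : nat -> R) : bool :=
  if tau mu b x is Some t then t \in block k else false.

Definition event_A (k : nat) (x : nat -> R) : bool :=
  has (fun i => x i > b + i%:R * mu) (block k).

Definition event_B (k : nat) (x : nat -> R) : bool :=
  all (fun i => x i < level k.-1) (index_iota 1%N (nk k).+1).

Definition law_above (c : R) : probability R R :=
  cond_law F (measurable_itv `[c, +oo[).

Definition Pk1 (k : nat) : probability ((nk k).-tuple R) R :=
  mixture (fun n => if n \in block k then tail F (b + n%:R * mu) / qk k else 0)
    (fun n => indep_law (nk k)
      (fun i => if i == n then law_above (b + n%:R * mu) else F)).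

Definition Zk1 (k : nat) (x : nat -> R) : R :=
  qk k / (count (fun i => x i >= b + i%:R * mu) (block k))%:R *
  (tau_in_block k x && event_A k x)%:R.

Definition theta (k : nat) : R :=
  - ln ((nk k)%:R * tail F (level k.-1)) / level k.-1.

(* The integral excludes the end point [level k.-1], as does the density of
   [Fk], so that the latter has mass 1. *)
Definition Lambda (k : nat) (s : R) : R :=
  ln (\int[F]_(x in `]-oo, level k.-1[%classic) expR (s * x)).

Definition Fk (k : nat) : probability R R :=
  tilted_law F (level k.-1) (theta k) (Lambda k (theta k)).

(* A trajectory with i.i.d. increments from [Fk k] up to time tau_b and from
   [F] afterwards is obtained from two independent i.i.d. samples y, z by
   keeping y up to its own passage time and z thereafter. *)
Definition Pk2 (k : nat) :
    probability ((nk k).-tuple R * (nk k).-tuple R)%type R :=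
  (indep_law (nk k) (fun=> Fk k) \x indep_law (nk k) (fun=> F))%E.

Definition splice (y z : nat -> R) : nat -> R :=
  fun i => if tau mu b y is Some t then if (i <= t)%N then y i else z i
           else y i.

Definition Zk2 (k : nat) (x : nat -> R) : R :=
  let t := odflt 0%N (tau mu b x) in
  expR (- theta k * walk x t + t%:R * Lambda k (theta k)) *
  (tau_in_block k x && event_B k x)%:R.

Definition Pk3 (k : nat) : probability ((nk k).-tuple R) R :=
  mixture (fun n => if (1 <= n <= nk k)%N then (nk k)%:R^-1 else 0)
    (fun n => indep_law (nk k)
      (fun i => if i == n then law_above (level k.-1) else F)).

Definition Zk3 (k : nat) (x : nat -> R) : R :=
  (nk k)%:R * tail F (level k.-1) /
  (count (fun i => x i >= level k.-1) (index_iota 1%N (nk k).+1))%:R *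
  [&& tau_in_block k x, ~~ event_A k x & ~~ event_B k x]%:R.

Definition sample (k : nat) : measurableType _ :=
  ((nk k).-tuple R * ((nk k).-tuple R * (nk k).-tuple R) * (nk k).-tuple R)%type.

Definition Pk (k : nat) : probability (sample k) R :=
  (Pk1 k \x Pk2 k \x Pk3 k)%E.

Definition Zk (k : nat) (t : sample k) : R :=
  let: (t1, (t2, t2'), t3) := t in
  Zk1 k (tuple_path t1) +
  Zk2 k (splice (tuple_path t2) (tuple_path t2')) +
  Zk3 k (tuple_path t3).

Definition pk (k : nat) : R :=
  if k is 0%N then 0 else
  (integrated_tail F (level k.-1) - integrated_tail F (level k)) /
  integrated_tail F b.

(* The sample space records the stratum K and the three simulated samples. *)
Definition Q : probability (strata sample) R :=
  mixture pk (fun k => distribution (Pk k) (@in_stratum _ sample k)).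

Definition Z (s : strata sample) : R := Zk (projT2 s) / pk (projT1 s).

End estimator.

Arguments Z {R} F mu r b s.

(* Main.v *)
(* Z is unbiased because each Z_{k,i} is the likelihood ratio of the law of the
   increments with respect to its sampling law, restricted to A_k, to B_k or to
   the complement of A_k and B_k.  Write p_k for the probability of stratum k,
   G for the integrated tail and h = n_k tail(b + n_{k-1} mu).  Then
   Z_{k,1} <= q_k <= p_k G(b) / mu, while Z_{k,2} <= C h by a uniform Chernoff
   bound and Z_{k,3} <= h, where h is of order p_k G(b).  Hence
     E Z^2 <= (G(b) / mu) P(tau_b < oo) + C G(b) sum_k P(hit in block k, not A_k),
   and crossing in block k without a big jump in that block has probability
   o(h), uniformly in k, so that the last term is o(G(b)^2).  Since
   P(tau_b < oo) >= (1 - o(1)) G(b) / mu, the variance is o(P(tau_b < oo)^2).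

   The distribution enters only through the record [heavy_tail]: a moment of
   order p > 1, zero mean, and monotonicity of x^be tail(x) for large x.  Tails
   of the walk are controlled by exponential tilting in both directions. *)
From HB Require Import structures.
Require Import Defs.
From mathcomp Require Import all_boot all_order all_algebra.
From mathcomp Require Import all_classical all_reals all_analysis.
From mathcomp Require Import measurable_realfun ring lra.

Set Implicit Arguments.
Unset Strict Implicit.
Unset Printing Implicit Defensive.
Import Order.TTheory GRing.Theory Num.Theory.
Import numFieldNormedType.Exports.

Local Open Scope classical_set_scope.
Local Open Scope ring_scope.

(** * Laws of independent sequences and their densities *)

(** The analytic bounds concern one block only: a number N of increments and a level c with N <= C0
    c. Geometric blocks provide one C0 for all k, and every level is at least b, so a threshold in c
    is a threshold in b that is uniform in k. The obstacle is that only a moment of order p > 1 is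
    available, the variance being possibly infinite: h = N tail(c) is then only known to be O(c^(1 -
    p)), whereas a union bound over crossing times costs a factor N. Cutting the increments at eta c
    with a small eta turns the Chernoff bound into an arbitrarily high power of h, which absorbs N.
    To the left only the moment is known, so a low walk before the jump is merely shown to have
    small probability; this is enough because the probability of the jump stays as a factor. A jump
    that just misses its barrier lies in a window of relative width O(ep), which carries a small
    fraction of the tail because x^be tail(x) is nondecreasing. *)

Definition has_density d (T : measurableType d) (R : realType)
    (nu mu : {measure set T -> \bar R}) (g : T -> R) : Prop :=
  forall f : T -> \bar R, measurable_fun setT f -> (forall x, 0 <= f x)%E ->
  (\int[nu]_x f x = \int[mu]_x (f x * (g x)%:E))%E.

Section density.
Context d (T : measurableType d) (R : realType).
Variables (nu mu : {measure set T -> \bar R}) (g : T -> R).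
Hypothesis mg : measurable_fun setT g.
Hypothesis g0 : forall x, 0 <= g x.

Import HBNNSimple.

(** Simple functions and monotone convergence on both sides extend the identity from sets to
    nonnegative measurable integrands, the form in which every change of measure below is
    applied. *)
Lemma has_densityP :
  (forall A, measurable A -> (nu A = \int[mu]_(x in A) (g x)%:E)%E) ->
  has_density nu mu g.
Proof.
move=> nuE f mf f0.
have mgE : measurable_fun setT (EFin \o g) by exact/measurable_EFinP.
pose h := nnsfun_approx measurableT mf.
have fE x : f x = lim ((EFin \o h n) x @[n --> \oo]).
  by apply/esym/cvg_lim => //; exact: cvg_nnsfun_approx.
under eq_integral do rewrite fE.
rewrite monotone_convergence //; last 3 first.
- by move=> n; apply/measurable_EFinP.
- by move=> n x _ /=; rewrite lee_fin.
- by move=> x _ a b ab /=; rewrite lee_fin; exact/lefP/nd_nnsfun_approx.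
have -> : (\int[mu]_x (f x * (g x)%:E) =
    lim (\int[mu]_x ((EFin \o h n) x * (g x)%:E) @[n --> \oo]))%E.
  rewrite -monotone_convergence //; last 3 first.
  - by move=> n; apply: emeasurable_funM => //; exact/measurable_EFinP.
  - by move=> n x _ /=; rewrite mule_ge0 ?lee_fin.
  - move=> x _ a b ab /=; rewrite lee_wpmul2r ?lee_fin//.
    exact/lefP/nd_nnsfun_approx.
  apply: eq_integral => x _; apply/esym/cvg_lim => //.
  by apply: cvgeZr; [|exact: cvg_nnsfun_approx].
suff suf n : (\int[nu]_x (h n x)%:E = \int[mu]_x ((h n x)%:E * (g x)%:E))%E.
  by under eq_fun do rewrite suf.
under eq_integral do rewrite fimfunE -fsumEFin//.
rewrite ge0_integral_fsum//; last 2 first.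
- by move=> y; exact/measurable_EFinP/measurable_funM.
- by move=> y x _; rewrite nnfun_muleindic_ge0.
transitivity (\int[mu]_x
    (\sum_(y \in range (h n)) (y * \1_(h n @^-1` [set y]) x * g x)%:E))%E.
  rewrite ge0_integral_fsum//; last 2 first.
  - move=> y; apply/measurable_EFinP; do 2 apply: measurable_funM => //.
  - move=> y x _; rewrite EFinM mule_ge0 ?lee_fin//.
    by rewrite -lee_fin nnfun_muleindic_ge0.
  apply: eq_fsbigr => y /[!inE] -[t _ <-].
  rewrite integralZl_indic_nnsfun// integral_indic// setIT nuE//.
  under [RHS]eq_integral do rewrite -mulrA EFinM.
  rewrite ge0_integralZl//; last 3 first.
  - by apply/measurable_EFinP; exact: measurable_funM.
  - by move=> x _; rewrite lee_fin mulr_ge0.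
  - by rewrite lee_fin.
  congr (_ * _)%E; rewrite integral_mkcond.
  apply: eq_integral => x _; rewrite patchE indicE.
  by case: ifPn => _; rewrite ?mul1r ?mul0r.
apply: eq_integral => x _; under eq_fsbigr do rewrite EFinM.
rewrite -ge0_mule_fsuml; last by move=> y; exact: nnfun_muleindic_ge0.
by rewrite fsumEFin// -(fimfunE _ x).
Qed.

End density.

Section indep_law.
Context {R : realType}.
Implicit Types (nu : nat -> probability R R) (g : nat -> R -> R).

Lemma measurable_tuple_path n i :
  measurable_fun setT (fun t : n.-tuple R => tuple_path t i).
Proof.
case: i => [|i] //=.
have [lin|] := ltnP i n; last first.
  move=> ni; rewrite (_ : (fun t => _) = cst 0)//.
  by apply/funext => t; rewrite nth_default ?size_tuple.
rewrite (_ : (fun t => _) = @tnth n R ^~ (Ordinal lin)).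
  exact: measurable_tnth.
by apply/funext => t; rewrite (tnth_nth 0).
Qed.

Lemma ge0_integral_indep_lawS n nu (f : n.+1.-tuple R -> \bar R) :
  measurable_fun setT f -> (forall t, 0 <= f t)%E ->
  (\int[indep_law n.+1 nu]_t f t =
   \int[nu 1%N]_x \int[indep_law n (nu \o S)]_t f (tuple_cons (x, t)))%E.
Proof.
move=> mf f0; rewrite /= ge0_integral_distribution//.
rewrite fubini_tonelli1//; last by move=> x; exact: f0.
by apply: measurableT_comp => //; exact: measurable_funP.
Qed.

Lemma measurable_prod_path n (s : seq nat) (g : nat -> R -> R) :
  (forall i, measurable_fun setT (g i)) ->
  measurable_fun setT (fun t : n.-tuple R => \prod_(i <- s) g i (tuple_path t i)).
Proof.
move=> mg; apply: measurable_prod => i _.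
by apply: measurableT_comp => //; exact: measurable_tuple_path.
Qed.

Lemma integral_prod_indep_law n nu g :
  (forall i, measurable_fun setT (g i)) -> (forall i x, 0 <= g i x) ->
  (\int[indep_law n nu]_t (\prod_(1 <= i < n.+1) g i (tuple_path t i))%:E =
   \prod_(1 <= i < n.+1) \int[nu i]_x (g i x)%:E)%E.
Proof.
elim: n nu g => [|n ih] nu g mg g0.
  rewrite big_geq//= integral_dirac//; first by rewrite diracT mul1e big_geq.
  by apply/measurable_EFinP; exact: measurable_prod_path.
rewrite ge0_integral_indep_lawS; last 2 first.
- by apply/measurable_EFinP; exact: measurable_prod_path.
- by move=> t; rewrite lee_fin prodr_ge0.
rewrite [RHS]big_ltn// [in RHS]big_add1/=.
rewrite -(ih (nu \o S) (fun i => g i.+1))//.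
under eq_integral => x _.
  under eq_integral => t _.
    rewrite big_ltn// big_add1/=.
    rewrite (eq_big_nat _ _ (F2 := fun i => g i.+1 (tuple_path t i))); last first.
      by case.
    rewrite EFinM; over.
  rewrite ge0_integralZl//; last 3 first.
  - by apply/measurable_EFinP; exact: (measurable_prod_path _ (fun i => mg i.+1)).
  - by move=> t _; rewrite lee_fin prodr_ge0.
  - by rewrite lee_fin.
  over.
rewrite ge0_integralZr//.
- exact/measurable_EFinP.
- by move=> x _; rewrite lee_fin.
- by apply: integral_ge0 => t _; rewrite lee_fin prodr_ge0.
Qed.

(** Induction on [n] by Tonelli: the first coordinate is changed with [g 1], the others with the
    shifted sequence. The likelihood ratio of an independent sample is the product of the
    one-coordinate ratios. *)
Lemma has_density_indep_law n nu nu' g :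
  (forall i, measurable_fun setT (g i)) -> (forall i x, 0 <= g i x) ->
  (forall i, has_density (nu' i) (nu i) (g i)) ->
  has_density (indep_law n nu') (indep_law n nu)
    (fun t => \prod_(1 <= i < n.+1) g i (tuple_path t i)).
Proof.
elim: n nu nu' g => [|n ih] nu nu' g mg g0 dg f mf f0.
  rewrite /= !integral_dirac//; last first.
    apply: emeasurable_funM => //; apply/measurable_EFinP.
    exact: measurable_prod_path.
  by rewrite diracT !mul1e big_geq// mule1.
have mcons x : measurable_fun setT (fun t : n.-tuple R => tuple_cons (x, t)).
  apply: (measurableT_comp (f := @tuple_cons R n)) => //.
rewrite !ge0_integral_indep_lawS//; last 2 first.
- apply: emeasurable_funM => //; apply/measurable_EFinP.
  exact: measurable_prod_path.
- by move=> t; rewrite mule_ge0// lee_fin prodr_ge0.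
have mF : measurable_fun setT (fun x =>
    \int[indep_law n (nu \o S)]_t (f (tuple_cons (x, t)) *
      (\prod_(1 <= i < n.+1) g i.+1 (tuple_path t i))%:E))%E.
  apply: (measurable_fun_fubini_tonelli_F (m2 := indep_law n (nu \o S))
   (fun z => f (tuple_cons z) *
      (\prod_(1 <= i < n.+1) g i.+1 (tuple_path z.2 i))%:E)%E).
  - apply: emeasurable_funM; first by apply: measurableT_comp.
    apply: measurableT_comp => //.
    apply: (measurableT_comp (f := fun t : n.-tuple R =>
       \prod_(1 <= i < n.+1) g i.+1 (tuple_path t i))) => //.
    exact: (measurable_prod_path _ (fun i => mg i.+1)).
  - by move=> z; apply: mule_ge0 => //; rewrite lee_fin prodr_ge0.
under eq_integral => x _.
  rewrite (ih (nu \o S) (nu' \o S) (fun i => g i.+1)); last 5 first.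
  - by move=> i; exact: mg.
  - by move=> i y; exact: g0.
  - by move=> i; exact: dg.
  - by apply: measurableT_comp; [exact: mf|exact: mcons].
  - by move=> t; exact: f0.
  over.
rewrite dg//; last first.
  by move=> x; apply: integral_ge0 => t _; rewrite mule_ge0// lee_fin prodr_ge0.
apply: eq_integral => x _.
rewrite -ge0_integralZr//; last 3 first.
- apply: emeasurable_funM; first by apply: measurableT_comp.
  apply/measurable_EFinP; exact: (measurable_prod_path _ (fun i => mg i.+1)).
- by move=> t _; rewrite mule_ge0// lee_fin prodr_ge0.
- by rewrite lee_fin.
apply: eq_integral => t _.
rewrite [in RHS]big_ltn// [in RHS]big_add1/= EFinM.
rewrite [in RHS](eq_big_nat _ _ (F2 := fun i => g i.+1 (tuple_path t i))).
  by rewrite -muleA [(_ * (g 1%N x)%:E)%E]muleC.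
by case.
Qed.

End indep_law.

(** * Rectangles determine the joint law of an independent sample *)

Section rectangles.
Context {R : realType}.
Implicit Types (nu : nat -> probability R R) (A : nat -> set R).

Definition rectangle n A : set (n.-tuple R) :=
  [set t | forall i, (1 <= i < n.+1)%N -> A i (tuple_path t i)].
Arguments rectangle n A : clear implicits.

Lemma indic_rectangle n A (t : n.-tuple R) :
  \1_(rectangle n A) t = \prod_(1 <= i < n.+1) \1_(A i) (tuple_path t i) :> R.
Proof.
rewrite indicE; case: (boolP (t \in _)) => [/set_mem tA|/negP tA].
  rewrite big_nat_cond big1// => i /andP[/tA Ai _].
  by rewrite indicE mem_set.
have [i ilt nAi] : exists2 i, (1 <= i < n.+1)%N & ~ A i (tuple_path t i).
  apply: contrapT => h; apply: tA; rewrite inE => i ilt.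
  by apply: contrapT => nAi; apply: h; exists i.
rewrite (bigD1_seq i) ?mem_index_iota ?iota_uniq//=.
by rewrite indicE memNset// mul0r.
Qed.

Lemma measurable_path_preimage n i (B : set R) : measurable B ->
  measurable [set t : n.-tuple R | B (tuple_path t i)].
Proof.
by move=> mB; rewrite -[X in measurable X]setTI; exact: measurable_tuple_path.
Qed.

Lemma measurable_rectangle n A : (forall i, measurable (A i)) ->
  measurable (rectangle n A).
Proof.
move=> mA; rewrite (_ : rectangle n A = \bigcap_(i in [set i | (1 <= i < n.+1)%N])
  [set t | A i (tuple_path t i)]).
  by apply: bigcap_measurableType => i _; exact: measurable_path_preimage.
by apply/seteqP; split.
Qed.

Lemma indep_law_rectangle n nu A : (forall i, measurable (A i)) ->
  (indep_law n nu (rectangle n A) = \prod_(1 <= i < n.+1) nu i (A i))%E.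
Proof.
move=> mA; have mrect := @measurable_rectangle n _ mA.
transitivity (\int[indep_law n nu]_t (\1_(rectangle n A) t)%:E)%E.
  by rewrite integral_indic// setIT.
under eq_integral do rewrite indic_rectangle.
rewrite (integral_prod_indep_law n nu (g := fun i => \1_(A i)))//.
by apply: eq_bigr => i _; rewrite integral_indic// setIT.
Qed.

(** Rectangles form a pi-system that generates the product sigma-algebra and contains the whole
    space. *)
Lemma eq_on_rectangles n (m1 m2 : probability (n.-tuple R) R) :
  (forall A, (forall i, measurable (A i)) ->
    m1 (rectangle n A) = m2 (rectangle n A)) ->
  forall B, measurable B -> m1 B = m2 B.
Proof.
move=> m12; pose G : set (set (n.-tuple R)) :=
  [set rectangle n A | A in [set A | forall i, measurable (A i)]].
have rectT : setT = rectangle n (fun=> setT) by apply/seteqP; split.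
apply: (measure_unique G (fun=> setT)).
- apply/seteqP; split; last first.
    apply: smallest_sub; first exact: sigma_algebra_measurable.
    by move=> _ [A mA <-]; exact: measurable_rectangle.
  apply: smallest_sub; first exact: smallest_sigma_algebra.
  move=> B; rewrite -bigcup_seq/= => -[i _ [C mC]].
  rewrite setTI => <-.
  apply: sub_sigma_algebra.
  (* A cylinder over one coordinate is the rectangle with all other sides full; entry [i] of the
     tuple is coordinate [i.+1]. *)
  exists (fun j => if j == i.+1 then C else setT) => [j|]; first by case: ifP.
  apply/seteqP; split => t /=.
    move/(_ i.+1); rewrite eqxx (tnth_nth 0); apply.
    by rewrite /= ltnS; exact: ltn_ord.
  rewrite (tnth_nth 0) => Ct j _; case: ifP => // /eqP ->//.
- move=> _ _ [A mA <-] [B mB <-].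
  exists (fun i => A i `&` B i) => [i|]; first exact: measurableI.
  apply/seteqP; split => t /=.
    by move=> h; split => i /h[].
  by move=> [hA hB] i ilt; split; [exact: hA|exact: hB].
- by move=> _; exists (fun=> setT).
- by rewrite bigcup_const//; exists 0%N.
- by move=> _ [A mA <-]; exact: m12.
- by move=> k; apply: le_lt_trans (ltry 1); exact: probability_le1.
Qed.

(** Carries probabilities from the abstract space of the [X i] to the explicit product law, whose
    coordinates can be integrated one by one. *)
Lemma distribution_indep n d (T : measurableType d) (P : probability T R)
    (X : nat -> {RV P >-> R}) (F : probability R R)
    (X_indep : mutually_independent X)
    (X_law : forall i (A : set R), measurable A -> distribution P (X i) A = F A)
    (B : set (n.-tuple R)) : measurable B ->
  P [set w | B [tuple X i.+1 w | i < n]] = indep_law n (fun=> F) B.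
Proof.
move=> mB; pose Y w : n.-tuple R := [tuple X i.+1 w | i < n].
have mY : measurable_fun setT Y.
  apply/measurable_fun_tnthP => i.
  by rewrite (_ : _ \o _ = X i.+1)//; apply/funext => w /=; rewrite tnth_mktuple.
pose Ym : {mfun T >-> n.-tuple R} := HB.pack Y (isMeasurableFun.Build _ _ _ _ _ mY).
have YE i w : (1 <= i < n.+1)%N -> tuple_path (Y w) i = X i w.
  case: i => // i; rewrite ltnS /= => lin.
  have := tnth_mktuple (fun i => X i.+1 w) (Ordinal (lin : (i < n)%N)).
  by rewrite (tnth_nth 0).
apply: (@eq_on_rectangles n (distribution P Ym) (indep_law n (fun=> F))) => // A mA.
rewrite indep_law_rectangle// -(eq_bigr _ (fun i _ => X_law i _ (mA i))).
rewrite -X_indep ?iota_uniq//; congr (P _).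
apply/seteqP; split => w /=.
  by move=> h i /=; rewrite mem_index_iota => ilt; have := h _ ilt; rewrite YE.
by move=> h i ilt; rewrite YE//; apply: h; rewrite /= mem_index_iota.
Qed.

End rectangles.
Arguments rectangle {R} n A.

(** * Deterministic splicing of two samples, and mixtures of laws *)

Section mixtures.
Context {R : realType}.

Section mixed_sample.
Variables (n : nat) (m : nat -> bool) (nu nu' : nat -> probability R R).

(** The mask [m] is deterministic: once the passage time is fixed at [t], splicing two samples at
    that time is this map with the mask [i <= t]. *)
Definition mix (yz : n.-tuple R * n.-tuple R) : n.-tuple R :=
  [tuple if m i.+1 then tnth yz.1 i else tnth yz.2 i | i < n].

Lemma tuple_path_mix yz i : tuple_path (mix yz) i =
  if m i then tuple_path yz.1 i else tuple_path yz.2 i.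
Proof.
case: i => [|i]; first by rewrite /=; case: ifP.
rewrite /tuple_path; have [lin|ni] := ltnP i n.
  have E (t : n.-tuple R) : t`_i = tnth t (Ordinal lin) by rewrite (tnth_nth 0).
  by rewrite !E /mix tnth_mktuple.
by rewrite !nth_default ?size_tuple//; case: ifP.
Qed.

Lemma measurable_mix : measurable_fun setT mix.
Proof.
apply/measurable_fun_tnthP => i.
rewrite (_ : _ \o _ = fun yz => if m i.+1 then tnth yz.1 i else tnth yz.2 i).
  by case: (m i.+1); apply: (measurableT_comp (f := @tnth n R ^~ i)) => //;
    exact: measurable_tnth.
by apply/funext => yz /=; rewrite tnth_mktuple.
Qed.

HB.instance Definition _ := isMeasurableFun.Build _ _ _ _ mix measurable_mix.

(** The preimage of a rectangle is a product of two rectangles, each with full sides where the mask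
    discards its coordinate. *)
Lemma distribution_mix B : measurable B ->
  distribution (indep_law n nu \x indep_law n nu')%E mix B =
  indep_law n (fun i => if m i then nu i else nu' i) B.
Proof.
apply: eq_on_rectangles => A mA; rewrite indep_law_rectangle//.
transitivity ((indep_law n nu \x indep_law n nu')%E
   (mix @^-1` rectangle n A)); first by [].
rewrite (_ : mix @^-1` rectangle n A =
   rectangle n (fun i => if m i then A i else setT) `*`
   rectangle n (fun i => if m i then setT else A i)); last first.
  apply/seteqP; split => -[y z]; rewrite /rectangle /=.
    move=> h; split => i ilt; have := h i ilt; rewrite tuple_path_mix;
      by case: ifP.
  move=> [h1 h2] i ilt; have := h1 i ilt; have := h2 i ilt.
  by rewrite tuple_path_mix; case: ifP.
rewrite product_measure1E/=; last 2 first.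
- by apply: measurable_rectangle => i; case: ifP.
- by apply: measurable_rectangle => i; case: ifP.
rewrite !indep_law_rectangle; last 2 first.
- by move=> i; case: ifP.
- by move=> i; case: ifP.
rewrite -big_split/=; apply: eq_bigr => i _; case: ifP => _.
- by rewrite [X in (_ * X)%E]probability_setT mule1.
- by rewrite [X in (X * _)%E]probability_setT mul1e.
Qed.

Lemma integral_mix (f : n.-tuple R -> \bar R) :
  measurable_fun setT f -> (forall t, 0 <= f t)%E ->
  (\int[indep_law n nu \x indep_law n nu']_yz f (mix yz) =
   \int[indep_law n (fun i => if m i then nu i else nu' i)]_t f t)%E.
Proof.
move=> mf f0.
transitivity
  (\int[distribution (indep_law n nu \x indep_law n nu')%E mix]_t f t)%E.
  by rewrite ge0_integral_distribution.
apply: eq_measure_integral => B mB _; exact: distribution_mix.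
Qed.

End mixed_sample.

(** For nonnegative weights of sum 1 the series of measures has mass 1, so that normalization is the
    identity and integration is term by term. *)
Lemma mixtureE d (T : measurableType d) (w : nat -> R)
    (nu : nat -> probability T R) :
  (forall n, 0 <= w n) -> (\sum_(n <oo) (w n)%:E = 1)%E ->
  forall f : T -> \bar R, measurable_fun setT f -> (forall x, 0 <= f x)%E ->
  (\int[mixture w nu]_x f x = \sum_(n <oo) (w n)%:E * \int[nu n]_x f x)%E.
Proof.
move=> w0 w1 f mf f0.
pose ms : {measure set T -> \bar R} := mseries (fun k => mscale (NngNum (normr_ge0 (w k))) (nu k)) 0%N.
have ms1 : ms setT = 1%E.
  rewrite -w1; apply: eq_eseriesr => k _.
  transitivity (`|w k|%:E * nu k setT)%E; first by [].
  by rewrite probability_setT mule1 ger0_norm.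
transitivity (\int[ms]_x f x)%E.
  apply: eq_measure_integral => A mA _.
  transitivity (mnormalize ms (nu 0%N) A); first by [].
  by rewrite /mnormalize ms1 onee_eq0/= invr1 mule1.
rewrite ge0_integral_measure_series//; apply: eq_eseriesr => k _.
by rewrite ge0_integral_mscale//= ger0_norm.
Qed.

Lemma eseries_finite (u : nat -> \bar R) N :
  (forall n, (N <= n)%N -> u n = 0%E) ->
  (\sum_(n <oo) u n = \sum_(0 <= n < N) u n)%E.
Proof.
move=> u0; apply: lim_near_cst => //; near=> n.
rewrite (big_cat_nat _ _ (n := N))//=; last by near: n; exact: nbhs_infty_ge.
rewrite [X in (_ + X)%E]big1_seq ?adde0// => i.
by rewrite mem_index_iota => /and3P[_ /u0].
Unshelve. all: by end_near. Qed.

End mixtures.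

Section cond_law.
Context {R : realType} (F : probability R R).

Lemma has_density_cond_law (D : set R) (mD : measurable D) :
  (0 < F D)%E ->
  has_density (cond_law F mD) F (fun x => \1_D x / fine (F D)).
Proof.
move=> D0.
have Dfin : F D \is a fin_num by exact: fin_num_measure.
have FD0 : 0 < fine (F D) by rewrite -lte_fin fineK.
apply: has_densityP.
- by apply: measurable_funM => //; exact: measurable_indic.
- by move=> x; rewrite divr_ge0// ltW.
move=> A mA; rewrite /cond_law /= /mnormalize /= /mrestr setTI gt_eqF//=.
rewrite lt_eqF/=; last by rewrite -ge0_fin_numE.
under eq_integral do rewrite EFinM.
rewrite ge0_integralZr//; last 2 first.
- by apply/measurable_EFinP; apply: measurable_funTS; exact: measurable_indic.
- by rewrite lee_fin invr_ge0 ltW.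
by rewrite integral_indic// setIC.
Qed.

End cond_law.

(** * First passage times *)

Section first_passage.
Context {R : realType}.
Implicit Types (mu b : R) (x y z : nat -> R).

(** The right-hand side involves only the first [t] increments; measurability of the passage time
    and its stopping-time property both follow from it. *)
Lemma tau_Some mu b x t :
  (tau mu b x == Some t) =
  (b < walk x t - t%:R * mu) &&
  all (fun j => walk x j - j%:R * mu <= b) (iota 0 t).
Proof.
rewrite /tau; case: pselect => [e|ne]; last first.
  apply/esym/negP => /andP[bt _]; apply: ne; by exists t.
case: ex_minnP => m bm minm; apply/eqP/andP => [[<-]|[bt tmin]].
  split=> //; apply/allP => j; rewrite mem_iota/= add0n => jm.
  by rewrite leNgt; apply/negP => /minm; rewrite leqNgt jm.
congr Some; apply/eqP; rewrite eqn_leq minm//= leqNgt; apply/negP => mt.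
by move/allP/(_ m): tmin; rewrite mem_iota mt leNgt bm => /(_ isT).
Qed.

Lemma tau_gt mu b x t : tau mu b x = Some t -> b < walk x t - t%:R * mu.
Proof. by move/eqP; rewrite tau_Some => /andP[]. Qed.

Lemma tau_before mu b x t j : tau mu b x = Some t -> (j < t)%N ->
  walk x j - j%:R * mu <= b.
Proof.
move/eqP; rewrite tau_Some => /andP[_ /allP h] jt.
by apply: h; rewrite mem_iota.
Qed.

Lemma tau_exists mu b x n : b < walk x n - n%:R * mu ->
  exists2 t, tau mu b x = Some t & (t <= n)%N.
Proof.
rewrite /tau => bn; case: pselect => [e|]; last by case; exists n.
by case: ex_minnP => m bm minm; exists m => //; exact: minm.
Qed.

Lemma eq_walk x y t n : (forall i, (i <= t)%N -> (0 < i)%N -> x i = y i) ->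
  (n <= t)%N -> walk x n = walk y n.
Proof.
move=> xy nt; apply: eq_big_nat => i /andP[i0 ilt].
by apply: xy => //; apply: leq_trans nt.
Qed.

(** The stopping-time property, which lets the increments after [t] be replaced without affecting
    passage at [t]. *)
Lemma eq_tau mu b x y t : (forall i, (i <= t)%N -> (0 < i)%N -> x i = y i) ->
  (tau mu b x == Some t) = (tau mu b y == Some t).
Proof.
move=> xy; rewrite !tau_Some (eq_walk xy (leqnn t)); congr (_ && _).
apply: eq_in_all => j; rewrite mem_iota add0n => /andP[_ jt].
by rewrite (eq_walk xy (ltnW jt)).
Qed.

End first_passage.

(** * Measurability of the walk, the events and the estimators *)

Section measurability.
Context {R : realType} d (T : measurableType d) (x : T -> nat -> R).
Hypothesis mx : forall i, measurable_fun setT (x ^~ i).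
Variables (F : probability R R) (mu b : R) (r k : nat).

Lemma measurable_walk n : measurable_fun setT (fun t => walk (x t) n).
Proof. by apply: measurable_sum => i; exact: mx. Qed.

Lemma measurable_all (s : seq nat) (p : nat -> T -> bool) :
  (forall i, measurable_fun setT (p i)) ->
  measurable_fun setT (fun t => all (p ^~ t) s).
Proof.
move=> mp; elim: s => [|i s ih] /=; first exact: measurable_cst.
exact: measurable_and.
Qed.

Lemma measurable_has (s : seq nat) (p : nat -> T -> bool) :
  (forall i, measurable_fun setT (p i)) ->
  measurable_fun setT (fun t => has (p ^~ t) s).
Proof.
move=> mp; elim: s => [|i s ih] /=; first exact: measurable_cst.
exact: measurable_or.
Qed.

Lemma measurable_indicator (p : T -> bool) : measurable_fun setT p ->
  measurable_fun setT (fun t => (p t)%:R : R).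
Proof.
move=> mp; rewrite (_ : (fun t => _) = fun t => if p t then 1 else 0).
  by apply: measurable_fun_ifT.
by apply/funext => t; case: (p t).
Qed.

Lemma measurable_tau_Some t :
  measurable_fun setT (fun w => tau mu b (x w) == Some t).
Proof.
rewrite (_ : (fun w => _) = fun w => (b < walk (x w) t - t%:R * mu) &&
  all (fun j => walk (x w) j - j%:R * mu <= b) (iota 0 t)); last first.
  by apply/funext => w; rewrite tau_Some.
apply: measurable_and.
  apply: measurable_fun_ltr => //; apply: measurable_funB => //.
  exact: measurable_walk.
apply: measurable_all => j; apply: measurable_fun_ler => //.
by apply: measurable_funB => //; exact: measurable_walk.
Qed.

Lemma tau_in_blockE w : tau_in_block mu r b k w =
  has (fun t => tau mu b w == Some t) (block r k).
Proof.
rewrite /tau_in_block; case: tau => [t|]; last by elim: (block r k).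
by apply/idP/hasP => [tb|[s sb /eqP[->]//]]; exists t.
Qed.

Lemma measurable_tau_in_block :
  measurable_fun setT (fun w => tau_in_block mu r b k (x w)).
Proof.
under eq_fun do rewrite tau_in_blockE.
by apply: measurable_has; exact: measurable_tau_Some.
Qed.

Lemma measurable_event_A :
  measurable_fun setT (fun w => event_A mu r b k (x w)).
Proof. by apply: measurable_has => i; exact: measurable_fun_ltr. Qed.

Lemma measurable_event_B :
  measurable_fun setT (fun w => event_B mu r b k (x w)).
Proof. by apply: measurable_all => i; exact: measurable_fun_ltr. Qed.

(** The reciprocal is written as the power -1 of a sum of indicators, a measurable function; both
    sides are 0 when the count is 0. *)
Lemma measurable_count_inv (s : seq nat) (p : nat -> T -> bool) :
  (forall i, measurable_fun setT (p i)) ->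
  measurable_fun setT (fun t => (count (p ^~ t) s)%:R^-1 : R).
Proof.
move=> mp; rewrite (_ : (fun t => _) =
  fun t => (\sum_(i <- s) (p i t)%:R : R) `^ (-1)).
  apply: (measurableT_comp (f := fun u : R => u `^ (-1))) => //.
  by apply: measurable_sum => i; exact: measurable_indicator.
apply/funext => t; rewrite powR_inv1 ?sumr_ge0// -natr_sum; congr (_%:R^-1).
by rewrite -sum1_count big_mkcond/=; apply: eq_bigr => i _; case: (p i t).
Qed.

Lemma measurable_Zk1 : measurable_fun setT (fun w => Zk1 F mu r b k (x w)).
Proof.
apply: measurable_funM; last first.
  apply: measurable_indicator; apply: measurable_and.
    exact: measurable_tau_in_block.
  exact: measurable_event_A.
apply: measurable_funM => //; apply: measurable_count_inv => i.
exact: measurable_fun_ler.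
Qed.

Lemma measurable_Zk3 : measurable_fun setT (fun w => Zk3 F mu r b k (x w)).
Proof.
apply: measurable_funM; last first.
  apply: measurable_indicator; apply: measurable_and.
    exact: measurable_tau_in_block.
  apply: measurable_and; apply: measurable_neg.
    exact: measurable_event_A.
  exact: measurable_event_B.
apply: measurable_funM => //; apply: measurable_count_inv => i.
exact: measurable_fun_ler.
Qed.

End measurability.

(** * Unbiasedness of the estimators *)

Section jump_mixture.
Context {R : realType} (F : probability R R).
Variables (n : nat) (s : seq nat) (a tl : nat -> R).
Hypothesis s_uniq : uniq s.
Hypothesis s_range : forall i, i \in s -> (1 <= i < n.+1)%N.
Hypothesis s_neq0 : s != [::].
Hypothesis tl_gt0 : forall i, i \in s -> 0 < tl i.
Hypothesis tlE : forall i, i \in s -> (F `[a i, +oo[%classic = (tl i)%:E)%E.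

Let q : R := \sum_(i <- s) tl i.

Let q_gt0 : 0 < q.
Proof.
rewrite /q; case: s s_neq0 tl_gt0 => // i s' _ tl0.
rewrite big_cons ltr_pwDl ?tl0 ?mem_head//.
rewrite big_seq sumr_ge0// => j js; apply/ltW/tl0.
by rewrite inE js orbT.
Qed.

Lemma has_density_one_jump m : m \in s ->
  has_density (indep_law n (fun i => if i == m then law_above F (a m) else F))
    (indep_law n (fun=> F)) (fun t => (a m <= tuple_path t m)%R%:R / tl m).
Proof.
move=> ms f mf f0.
pose g (i : nat) (x : R) := if i == m then \1_(`[a m, +oo[%classic) x / tl m else 1.
rewrite (@has_density_indep_law _ n (fun=> F) _ g)//.
- apply: eq_integral => t _; congr (_ * _%:E)%E.
  rewrite (bigD1_seq m) ?mem_index_iota ?iota_uniq ?s_range//=.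
  rewrite big1 ?mulr1 => [|i /negbTE im]; last by rewrite /g im.
  by rewrite /g eqxx indicE mem_setE in_itv/= andbT.
- move=> i; rewrite /g; case: (i == m) => //.
  by apply: measurable_funM => //; exact: measurable_indic.
- move=> i x; rewrite /g; case: (i == m) => //.
  by rewrite divr_ge0// ltW// tl_gt0.
- move=> i h mh h0; rewrite /g; case: (i == m); last first.
    by apply: eq_integral => x _; rewrite mule1.
  rewrite (has_density_cond_law (measurable_itv `[a m, +oo[)) ?tlE ?lte_fin ?tl_gt0//.
Qed.

(** Component [i] has density [1(a i <= x i) / tl i] and weight [tl i / q]: the factor [tl i]
    cancels and the sum counts the large increments. This is why both jump estimators divide by such
    a count; their sampling laws differ only in [s], [a] and [tl]. *)
Lemma has_density_jump_mixture (w : nat -> R) :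
  (forall i, w i = if i \in s then tl i / q else 0) ->
  has_density (mixture w
      (fun m => indep_law n (fun i => if i == m then law_above F (a m) else F)))
    (indep_law n (fun=> F))
    (fun t => (count (fun i => a i <= tuple_path t i) s)%:R / q).
Proof.
move=> wE.
have sumE (u : nat -> \bar R) :
    (\sum_(i <oo) (if i \in s then u i else 0) = \sum_(i <- s) u i)%E.
  rewrite (eseries_finite (N := n.+1)); last first.
    move=> i ni; case: ifP => // /s_range /andP[_].
    by rewrite ltnNge ni.
  rewrite -big_mkcond/= -big_filter; apply: perm_big; apply: uniq_perm => //.
    by rewrite filter_uniq// iota_uniq.
  move=> i; rewrite mem_filter mem_index_iota /=; case: (boolP (i \in s)) => //=.
  by move=> /s_range/andP[].
have w0 i : 0 <= w i.
  by rewrite wE; case: ifP => // /tl_gt0 t0; rewrite divr_ge0// ltW.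
have w1 : (\sum_(i <oo) (w i)%:E = 1)%E.
  under eq_eseriesr do rewrite wE (fun_if EFin).
  by rewrite sumE sumEFin -mulr_suml mulfV// gt_eqF.
move=> f mf f0; rewrite mixtureE//.
rewrite (eq_eseriesr (g := fun i => if i \in s then
   (\int[indep_law n (fun=> F)]_t
     (f t * ((a i <= tuple_path t i)%R%:R / q)%:E) : \bar R) else 0))%E; last first.
  move=> i _; rewrite wE; case: ifP => is_; last by rewrite mul0e.
  rewrite has_density_one_jump// -ge0_integralZl//.
  - apply: eq_integral => t _; rewrite muleCA -EFinM.
    congr (_ * _%:E)%E; set c := (_ <= _)%R%:R.
    have ti0 : tl i != 0 by rewrite gt_eqF// tl_gt0.
    have q0 : q != 0 by rewrite gt_eqF.
    by field; apply/andP; split.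
  - apply: emeasurable_funM => //; apply/measurable_EFinP.
    apply: measurable_funM => //; apply: measurable_indicator.
    by apply: measurable_fun_ler => //; exact: measurable_tuple_path.
  - by move=> t _; rewrite mule_ge0// lee_fin divr_ge0// ltW// tl_gt0.
  - by rewrite lee_fin divr_ge0 ?ltW ?tl_gt0.
rewrite sumE -ge0_integral_sum//.
- apply: eq_integral => t _; rewrite -ge0_sume_distrr//; last first.
    by move=> i _; rewrite lee_fin divr_ge0// ltW.
  congr (_ * _)%E; rewrite sumEFin -mulr_suml; congr (_ / _)%:E.
  rewrite -sum1_count natr_sum [RHS]big_mkcond/=.
  by apply: eq_bigr => i _; case: ifP.
- move=> i; apply: emeasurable_funM => //; apply/measurable_EFinP.
  apply: measurable_funM => //; apply: measurable_indicator.
  by apply: measurable_fun_ler => //; exact: measurable_tuple_path.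
- by move=> i t _; rewrite mule_ge0// lee_fin divr_ge0// ltW.
Qed.

End jump_mixture.

Section unbiased_terms.
Context {R : realType} (F : probability R R) (mu b : R) (r k : nat).
Hypotheses (mu_gt0 : 0 < mu) (r_gt1 : (1 < r)%N) (k_gt0 : (0 < k)%N).
Hypothesis tailE : forall c, b <= c -> F `[c, +oo[%classic = (tail F c)%:E.
Hypothesis tail_gt0 : forall c, 0 < tail F c.

Lemma integral_bool d (T : measurableType d) (m : {measure set T -> \bar R})
    (p : T -> bool) : measurable_fun setT p ->
  (\int[m]_x ((p x)%:R : R)%:E = m [set x | p x])%E.
Proof.
move=> mp; have mS : measurable [set x | p x].
  by rewrite -[X in measurable X]setTI; exact: (mp measurableT [set true]).
transitivity (\int[m]_x (\1_[set x | p x] x : R)%:E)%E.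
  by apply: eq_integral => x _; rewrite indicE mem_setE.
by rewrite integral_indic// setIT.
Qed.

Lemma nk_ltn j : (nk r j < nk r j.+1)%N.
Proof.
case: j => [|j] /=; first by rewrite expn1; apply: ltn_trans r_gt1.
by rewrite ltn_exp2l.
Qed.

Lemma mem_block i : i \in block r k = (nk r k.-1 < i <= nk r k)%N.
Proof. by rewrite mem_index_iota ltnS. Qed.

Lemma block_range i : i \in block r k -> (1 <= i < (nk r k).+1)%N.
Proof. by rewrite mem_block ltnS => /andP[i0 ->]; rewrite (leq_ltn_trans _ i0). Qed.

Lemma block_neq0 : block r k != [::].
Proof.
rewrite -size_eq0 size_iota subn_eq0 -ltnNge ltnS -{2}(prednK k_gt0).
exact: nk_ltn.
Qed.

Lemma qk_gt0 : 0 < qk F mu r b k.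
Proof.
rewrite /qk; case: (block r k) block_neq0 => // i s _.
by rewrite big_cons ltr_pwDl// sumr_ge0// => j _; exact: ltW.
Qed.

Let muN := indep_law (nk r k) (fun=> F).

Let path_measurable i :
  measurable_fun setT (fun t : (nk r k).-tuple R => tuple_path t i).
Proof. exact: measurable_tuple_path. Qed.

(** Multiplying [Zk1] by the density [count / qk] leaves the indicator, since on [event_A] the count
    is positive: a strict exceedance is in particular a weak one. *)
Lemma integral_Zk1 :
  (\int[Pk1 F mu r b k]_t (Zk1 F mu r b k (tuple_path t))%:E =
   muN [set t | tau_in_block mu r b k (tuple_path t) &&
                event_A mu r b k (tuple_path t)])%E.
Proof.
rewrite -integral_bool; last first.
  apply: measurable_and; [exact: measurable_tau_in_block|].
  exact: measurable_event_A.
rewrite (has_density_jump_mixture (F := F) (s := block r k)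
  (a := fun i => b + i%:R * mu) (tl := fun i => tail F (b + i%:R * mu)))//; last 6 first.
- exact: iota_uniq.
- exact: block_range.
- exact: block_neq0.
- by move=> i _; rewrite tailE// lerDl mulr_ge0 ?ler0n// ltW.
- by apply/measurable_EFinP; exact: measurable_Zk1.
- move=> t; rewrite lee_fin /Zk1 mulr_ge0// divr_ge0//.
  exact/ltW/qk_gt0.
apply: eq_integral => t _; rewrite -EFinM; congr (_%:E).
rewrite /Zk1 -/(qk F mu r b k); case: (tau_in_block _ _ _ _ _) => /=; last first.
  by rewrite mulr0 mul0r.
case: (boolP (event_A _ _ _ _ _)) => [hA|_] /=; last by rewrite mulr0 mul0r.
have c0 : (count (fun i => b + i%:R * mu <= tuple_path t i) (block r k))%:R != 0 :> R.
  rewrite pnatr_eq0 -lt0n -has_count.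
  by apply: sub_has hA => i; exact: ltW.
have q0 : qk F mu r b k != 0 by rewrite gt_eqF// qk_gt0.
by rewrite mulr1; field; apply/andP; split.
Qed.

Lemma level_ge : b <= level mu r b k.-1.
Proof. by rewrite lerDl mulr_ge0 ?ler0n// ltW. Qed.

Lemma nk_gt0 : (0 < nk r k)%N.
Proof. by have := nk_ltn k.-1; rewrite prednK//; exact: leq_ltn_trans. Qed.

(** Uniform weights are the case of equal tail masses. The count cancels as for [Zk1]: outside
    [event_B] some increment reaches the level, so it is positive. *)
Lemma integral_Zk3 :
  (\int[Pk3 F mu r b k]_t (Zk3 F mu r b k (tuple_path t))%:E =
   muN [set t | [&& tau_in_block mu r b k (tuple_path t),
                ~~ event_A mu r b k (tuple_path t) &
                ~~ event_B mu r b k (tuple_path t)]])%E.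
Proof.
set c := level mu r b k.-1; set N := nk r k.
have N0 : N%:R != 0 :> R by rewrite pnatr_eq0 -lt0n nk_gt0.
have sumN : \sum_(i <- index_iota 1 N.+1) tail F c = N%:R * tail F c.
  by rewrite sumr_const_nat subn1 mulr_natl.
rewrite -integral_bool; last first.
  apply: measurable_and; first exact: measurable_tau_in_block.
  apply: measurable_and; apply: measurable_neg.
    exact: measurable_event_A.
  exact: measurable_event_B.
rewrite (has_density_jump_mixture (F := F) (s := index_iota 1 N.+1)
  (a := fun=> c) (tl := fun=> tail F c))//; last 7 first.
- exact: iota_uniq.
- by move=> i; rewrite mem_index_iota.
- by rewrite -size_eq0 size_iota subn1 -lt0n nk_gt0.
- by move=> i _; rewrite tailE// level_ge.
- move=> i; rewrite sumN mem_index_iota ltnS; case: ifP => // _.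
  by rewrite invfM mulrCA mulfV ?mulr1// gt_eqF.
- by apply/measurable_EFinP; exact: measurable_Zk3.
- by move=> t; rewrite lee_fin /Zk3 !mulr_ge0// ltW.
apply: eq_integral => t _; rewrite -EFinM sumN; congr (_%:E).
rewrite /Zk3 -/c -/N; case: (tau_in_block _ _ _ _ _) => /=; last first.
  by rewrite mulr0 mul0r.
case: (event_A _ _ _ _ _) => /=; first by rewrite mulr0 mul0r.
case: (boolP (event_B _ _ _ _ _)) => [_|hB] /=; first by rewrite mulr0 mul0r.
have c0 : (count (fun i => c <= tuple_path t i) (index_iota 1 N.+1))%:R != 0 :> R.
  rewrite pnatr_eq0 -lt0n -has_count.
  move: hB; rewrite /event_B -has_predC => hB.
  by apply: sub_has hB => i /=; rewrite leNgt.
have t0 : tail F c != 0 by rewrite gt_eqF.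
by rewrite mulr1; field; apply/and3P; split.
Qed.

End unbiased_terms.

Section tilted_term.
Context {R : realType} (F : probability R R) (mu b : R) (r k : nat).

Let c := level mu r b k.-1.
Let th := theta F mu r b k.
Let La := Lambda F mu r b k th.

Hypothesis mgf_gt0 : (0 < \int[F]_(x in `]-oo, c[) (expR (th * x))%:E)%E.
Hypothesis mgf_fin : (\int[F]_(x in `]-oo, c[) (expR (th * x))%:E < +oo)%E.

Let g (x : R) : R := expR (th * x - La) * (x < c)%R%:R.

Let measurable_g : measurable_fun setT g.
Proof.
apply: measurable_funM.
  apply: measurableT_comp => //.
  by apply: measurable_funB => //; exact: measurable_funM.
by apply: measurable_indicator; exact: measurable_fun_ltr.
Qed.

Let g_ge0 x : 0 <= g x.
Proof. by rewrite mulr_ge0// expR_ge0. Qed.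

(** Positivity and finiteness of the truncated exponential moment make [Lambda] its true logarithm
    rather than a default value of [fine] or [ln]; hence [tilted] has mass 1. *)
Lemma has_density_Fk : has_density (Fk F mu r b k) F g.
Proof.
apply: has_densityP => // A mA.
pose m : {measure set R -> \bar R} := tilted F c th La.
have tiltedE (B : set R) : m B = (\int[F]_(x in B) (g x)%:E)%E.
  apply: eq_integral => x _; by rewrite /g indicE mem_setE in_itv.
have tilted1 : m setT = 1%E.
  rewrite tiltedE.
  transitivity (\int[F]_(x in `]-oo, c[) (expR (- La) * expR (th * x))%:E)%E.
    rewrite [RHS]integral_mkcond; apply: eq_integral => x _.
    rewrite patchE mem_setE in_itv/= /g; case: ifP => _; last by rewrite mulr0.
    by rewrite mulr1 addrC expRD.
  under eq_integral do rewrite EFinM.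
  rewrite ge0_integralZl//; last first.
    apply/measurable_EFinP; apply: measurable_funTS.
    by apply: measurableT_comp => //; exact: measurable_funM.
  have Ifin : (\int[F]_(x in `]-oo, c[) (expR (th * x))%:E)%E \is a fin_num.
    by rewrite ge0_fin_numE// ltW.
  rewrite -(fineK Ifin) -EFinM; congr (_%:E).
  rewrite expRN /La /Lambda /Rintegral lnK; last first.
    by rewrite posrE -lte_fin fineK.
  by rewrite mulVf// gt_eqF// -lte_fin fineK.
transitivity (mnormalize m F A); first by [].
by rewrite /mnormalize tilted1 onee_eq0/= invr1 mule1 tiltedE.
Qed.

Hypotheses (r_gt1 : (1 < r)%N) (k_gt0 : (0 < k)%N).
Local Notation N := (nk r k).
Let muN := indep_law N (fun=> F).

(** The part of [Zk2] carried by passage at time [t]. *)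
Let W (t : nat) (x : nat -> R) : R :=
  expR (- th * walk x t + t%:R * La) *
  ((tau mu b x == Some t) && event_B mu r b k x)%:R.

Let measurable_W t : measurable_fun setT (fun u : N.-tuple R => W t (tuple_path u)).
Proof.
apply: measurable_funM.
  apply: measurableT_comp => //; apply: measurable_funD => //.
  apply: measurable_funM => //; apply: measurable_walk => i.
  exact: measurable_tuple_path.
apply: measurable_indicator; apply: measurable_and.
  by apply: measurable_tau_Some => i; exact: measurable_tuple_path.
by apply: measurable_event_B => i; exact: measurable_tuple_path.
Qed.

Let W_ge0 t x : 0 <= W t x.
Proof. by rewrite mulr_ge0// expR_ge0. Qed.

(** If the first sample passes at time [t], splicing is mixing with the mask [i <= t]. Mixing with
    the mask [i <= s] does not change whether passage occurs at [s], so at most one term of the sum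
    is nonzero. *)
Lemma Zk2_splice (yz : N.-tuple R * N.-tuple R) :
  Zk2 F mu r b k (splice mu b (tuple_path yz.1) (tuple_path yz.2)) =
  \sum_(t <- block r k) W t (tuple_path (mix (fun i => i <= t)%N yz)).
Proof.
case: yz => y z /=.
have mixE t : (fun i => if (i <= t)%N then tuple_path y i else tuple_path z i) =
    tuple_path (mix (fun i => i <= t)%N (y, z)).
  by apply/funext => i; rewrite tuple_path_mix.
have tau_mix t : (tau mu b (tuple_path (mix (fun i => i <= t)%N (y, z))) == Some t)
    = (tau mu b (tuple_path y) == Some t).
  by apply: eq_tau => i it _; rewrite tuple_path_mix it.
rewrite /splice; case E : (tau mu b (tuple_path y)) => [t|]; last first.
  rewrite /Zk2 /tau_in_block E /= mulr0 big1// => t _.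
  by rewrite /W tau_mix E/= mulr0.
rewrite mixE; have tauE := tau_mix t; rewrite E eqxx in tauE.
case: (boolP (t \in block r k)) => tb.
  rewrite (bigD1_seq t) ?iota_uniq//= big1 ?addr0; last first.
    move=> s st; rewrite /W tau_mix E.
    by rewrite [_ == _](_ : _ = false) ?mulr0//; apply/negP => /eqP[] /eqP;
      rewrite eq_sym (negbTE st).
  by rewrite /Zk2 /W /tau_in_block tauE (eqP tauE)/= tb.
rewrite /Zk2 /tau_in_block (eqP tauE) (negbTE tb) mulr0 big1_seq// => s /= sb.
rewrite /W tau_mix E [_ == _](_ : _ = false) ?mulr0//.
by apply/negP => /eqP[] ts; rewrite ts sb in tb.
Qed.

Lemma measurable_Zk2_splice : measurable_fun setT (fun yz : N.-tuple R * N.-tuple R =>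
  Zk2 F mu r b k (splice mu b (tuple_path yz.1) (tuple_path yz.2))).
Proof.
under eq_fun do rewrite Zk2_splice.
apply: measurable_sum => t.
apply: (measurableT_comp (f := fun u : N.-tuple R => W t (tuple_path u))) => //.
Qed.

(** For fixed [t] the mixed sample has independent coordinates, tilted up to [t] and of law [F]
    beyond. Its density is the product of [g] over the first [t] coordinates, which [W t] inverts
    because [event_B] makes every truncation indicator equal to 1. *)
Lemma integral_Zk2 :
  (\int[Pk2 F mu r b k]_yz
     (Zk2 F mu r b k (splice mu b (tuple_path yz.1) (tuple_path yz.2)))%:E =
   muN [set t | tau_in_block mu r b k (tuple_path t) &&
                event_B mu r b k (tuple_path t)])%E.
Proof.
rewrite -integral_bool; last first.
  apply: measurable_and.
    by apply: measurable_tau_in_block => i; exact: measurable_tuple_path.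
  by apply: measurable_event_B => i; exact: measurable_tuple_path.
rewrite [LHS](eq_integral (fun yz => \sum_(t <- block r k)
    (W t (tuple_path (mix (fun i => i <= t)%N yz)))%:E)%E); last first.
  by move=> yz _; rewrite Zk2_splice sumEFin.
rewrite ge0_integral_sum//; last 2 first.
- move=> t; apply/measurable_EFinP.
  by apply: (measurableT_comp (f := fun u : N.-tuple R => W t (tuple_path u))).
- by move=> t yz _; rewrite lee_fin.
pose I t (u : N.-tuple R) : R :=
  ((tau mu b (tuple_path u) == Some t) && event_B mu r b k (tuple_path u))%:R.
have sumI u : (\sum_(t <- block r k) (I t u)%:E =
    ((tau_in_block mu r b k (tuple_path u) &&
      event_B mu r b k (tuple_path u))%:R : R)%:E)%E.
  rewrite /I /tau_in_block; case: event_B; last first.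
    by rewrite andbF big1// => t _; rewrite andbF.
  rewrite andbT; case: tau => [s|]; last by rewrite big1.
  case: (boolP (s \in block r k)) => sb.
    rewrite (bigD1_seq s) ?iota_uniq//= eqxx big1 ?adde0// => t ts.
    rewrite andbT [_ == _](_ : _ = false)//.
    by apply/negP => /eqP[] /eqP; rewrite eq_sym (negbTE ts).
  rewrite big1_seq// => t /= tb; rewrite andbT [_ == _](_ : _ = false)//.
  by apply/negP => /eqP[] st; rewrite st tb in sb.
under [RHS]eq_integral do rewrite -sumI.
rewrite ge0_integral_sum//; last 2 first.
- move=> t; apply/measurable_EFinP; apply: measurable_indicator.
  apply: measurable_and.
    by apply: measurable_tau_Some => i; exact: measurable_tuple_path.
  by apply: measurable_event_B => i; exact: measurable_tuple_path.
- by move=> t u _; rewrite lee_fin.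
apply: eq_big_seq => t tb.
rewrite (integral_mix (fun i => i <= t)%N _ _
  (f := fun u : N.-tuple R => (W t (tuple_path u))%:E))//; last 2 first.
- exact/measurable_EFinP.
- by move=> u; rewrite lee_fin.
rewrite (@has_density_indep_law _ N (fun=> F) _
  (fun i x => if (i <= t)%N then g x else 1)); last 5 first.
- by move=> i; case: (i <= t)%N.
- by move=> i x; case: (i <= t)%N.
- move=> i; case: (i <= t)%N; first exact: has_density_Fk.
  by move=> h mh h0; apply: eq_integral => x _; rewrite mule1.
- exact/measurable_EFinP.
- by move=> u; rewrite lee_fin.
apply: eq_integral => u _; rewrite -EFinM /W /I; congr (_%:E).
case: (tau _ _ _ == _) => /=; last by rewrite mulr0 mul0r.
case: (boolP (event_B _ _ _ _ _)) => [hB|_] /=; last by rewrite mulr0 mul0r.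
have tN : (t <= N)%N by move: tb; rewrite mem_block => /andP[].
rewrite mulr1 (big_cat_nat _ _ (n := t.+1))//=.
rewrite [X in _ * (_ * X)]big1_seq ?mulr1; last first.
  by move=> i /=; rewrite mem_index_iota => /andP[ti _]; rewrite leqNgt ti.
rewrite (eq_big_nat _ _ (F2 := fun i => expR (th * tuple_path u i - La))); last first.
  move=> i /andP[i0 it]; rewrite -ltnS it.
  have : tuple_path u i < c.
    move/allP : hB; apply; rewrite mem_index_iota i0 ltnS.
    exact: leq_trans tN.
  by rewrite /g => ->; rewrite mulr1.
rewrite -expR_sum -expRD -[RHS]expR0; congr expR.
rewrite big_split/= sumrN sumr_const_nat subn1/= -mulr_sumr -/(walk _ _).
by rewrite mulr_natl mulNr addrACA addNr subrr addr0.
Qed.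

End tilted_term.

Lemma measurable_pred d (T : measurableType d) (p : T -> bool) :
  measurable_fun setT p -> measurable [set x | p x].
Proof.
by move=> mp; rewrite -[X in measurable X]setTI; exact: (mp measurableT [set true]).
Qed.

Section product_marginals.
Context {R : realType} d1 d2 (T1 : measurableType d1) (T2 : measurableType d2).
Variables (m1 : probability T1 R) (m2 : probability T2 R).

Lemma integral_prod_fst (f : T1 -> \bar R) : measurable_fun setT f ->
  (forall x, 0 <= f x)%E ->
  (\int[m1 \x m2]_z f z.1 = \int[m1]_x f x)%E.
Proof.
move=> mf f0; rewrite (fubini_tonelli1 (fun z => f z.1))//.
- apply: eq_integral => x _.
  rewrite /fubini_F /= integral_cst//.
  by rewrite [X in (_ * X)%E](_ : _ = 1%E) ?mule1//; exact: probability_setT.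
- exact: measurableT_comp.
Qed.

Lemma integral_prod_snd (f : T2 -> \bar R) : measurable_fun setT f ->
  (forall x, 0 <= f x)%E ->
  (\int[m1 \x m2]_z f z.2 = \int[m2]_y f y)%E.
Proof.
move=> mf f0; rewrite (fubini_tonelli2 (fun z => f z.2))//.
- apply: eq_integral => y _.
  rewrite /fubini_G /= integral_cst//.
  by rewrite [X in (_ * X)%E](_ : _ = 1%E) ?mule1//; exact: probability_setT.
- exact: measurableT_comp.
Qed.

End product_marginals.

Section stratified.
Context {R : realType} (F : probability R R) (mu b : R) (r : nat).
Hypotheses (mu_gt0 : 0 < mu) (r_gt1 : (1 < r)%N).
Hypothesis tailE : forall c, b <= c -> F `[c, +oo[%classic = (tail F c)%:E.
Hypothesis tail_gt0 : forall c, 0 < tail F c.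
Hypothesis mgf_gt0 : forall k, (0 < k)%N ->
  (0 < \int[F]_(x in `]-oo, level mu r b k.-1[)
         (expR (theta F mu r b k * x))%:E)%E.
Hypothesis mgf_fin : forall k, (0 < k)%N ->
  (\int[F]_(x in `]-oo, level mu r b k.-1[)
         (expR (theta F mu r b k * x))%:E < +oo)%E.
Hypothesis pk_gt0 : forall k, (0 < k)%N -> 0 < pk F mu r b k.
Hypothesis pk_sum : (\sum_(k <oo) (pk F mu r b k)%:E = 1)%E.

Local Notation muN k := (indep_law (nk r k) (fun=> F)).

Definition hit_block k : \bar R :=
  muN k [set t | tau_in_block mu r b k (tuple_path t)].

Definition hit_noA k : \bar R :=
  muN k [set t | tau_in_block mu r b k (tuple_path t) &&
                 ~~ event_A mu r b k (tuple_path t)].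

(** The two summands are grouped because their means add up to [hit_noA], the asymptotically small
    part of the hitting probability. *)
Definition Zk23 k (t : @sample R r k) : R :=
  Zk2 F mu r b k (splice mu b (tuple_path t.1.2.1) (tuple_path t.1.2.2)) +
  Zk3 F mu r b k (tuple_path t.2).

Lemma ZkE k (t : @sample R r k) :
  Zk F mu b t = Zk1 F mu r b k (tuple_path t.1.1) + Zk23 t.
Proof. by case: t => -[t1 [t2 t2']] t3; rewrite /Zk /Zk23 /= addrA. Qed.

Lemma Zk1_ge0 k x : 0 <= Zk1 F mu r b k x.
Proof. by rewrite !mulr_ge0// sumr_ge0// => i _; exact: ltW. Qed.

Lemma Zk2_ge0 k x : 0 <= Zk2 F mu r b k x.
Proof. by rewrite mulr_ge0// expR_ge0. Qed.

Lemma Zk3_ge0 k x : 0 <= Zk3 F mu r b k x.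
Proof. by rewrite !mulr_ge0// ltW. Qed.

Lemma Zk23_ge0 k (t : @sample R r k) : 0 <= Zk23 t.
Proof. by rewrite addr_ge0 ?Zk2_ge0 ?Zk3_ge0. Qed.

Lemma Zk_ge0 k (t : @sample R r k) : 0 <= Zk F mu b t.
Proof. by rewrite ZkE addr_ge0 ?Zk1_ge0 ?Zk23_ge0. Qed.

Let mZ1 k : measurable_fun setT
  (fun t : (nk r k).-tuple R => Zk1 F mu r b k (tuple_path t)).
Proof. by apply: measurable_Zk1 => i; exact: measurable_tuple_path. Qed.

Let mZ3 k : measurable_fun setT
  (fun t : (nk r k).-tuple R => Zk3 F mu r b k (tuple_path t)).
Proof. by apply: measurable_Zk3 => i; exact: measurable_tuple_path. Qed.

Let mZ1' k : measurable_fun setT (fun t : @sample R r k =>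
  Zk1 F mu r b k (tuple_path t.1.1)).
Proof.
have m1 : measurable_fun setT (fun t : @sample R r k => t.1.1).
  apply: (measurableT_comp (f := fst) (g := fst)); exact: measurable_fst.
exact: (measurableT_comp (@mZ1 k) m1).
Qed.

Let mZ2' k : measurable_fun setT (fun t : @sample R r k =>
  Zk2 F mu r b k (splice mu b (tuple_path t.1.2.1) (tuple_path t.1.2.2))).
Proof.
have m1 : measurable_fun setT (fun t : @sample R r k => t.1.2).
  apply: (measurableT_comp (f := snd) (g := fst)).
    exact: measurable_snd.
  exact: measurable_fst.
exact: (measurableT_comp (@measurable_Zk2_splice _ F mu b r k) m1).
Qed.

Let mZ3' k : measurable_fun setT (fun t : @sample R r k =>
  Zk3 F mu r b k (tuple_path t.2)).
Proof. exact: (measurableT_comp (@mZ3 k) measurable_snd). Qed.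

Lemma measurable_Zk23 k : measurable_fun setT (@Zk23 k).
Proof. exact: measurable_funD. Qed.

Lemma measurable_Zk k : measurable_fun setT (fun t : @sample R r k => Zk F mu b t).
Proof.
under eq_fun do rewrite ZkE; apply: measurable_funD => //.
exact: measurable_Zk23.
Qed.

(** [event_B] excludes [event_A], because [b + i mu] is at least [level k.-1] for [i] in the block.
    So [Zk2] and [Zk3] account for the two parts of the complement of [event_A]. *)
Lemma integral_Zk23 k : (0 < k)%N ->
  (\int[Pk F mu r b k]_t (Zk23 t)%:E = hit_noA k)%E.
Proof.
move=> k0; under eq_integral do rewrite EFinD.
rewrite ge0_integralD//; last 4 first.
- by move=> t _; rewrite lee_fin Zk2_ge0.
- exact/measurable_EFinP.
- by move=> t _; rewrite lee_fin Zk3_ge0.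
- exact/measurable_EFinP.
have -> : (\int[Pk F mu r b k]_t (Zk3 F mu r b k (tuple_path t.2))%:E =
    \int[Pk3 F mu r b k]_t (Zk3 F mu r b k (tuple_path t))%:E)%E.
  rewrite (integral_prod_snd _ _ (f := fun t => (Zk3 F mu r b k (tuple_path t))%:E))//.
  - by apply/measurable_EFinP; exact: mZ3.
  - by move=> t; rewrite lee_fin; exact: Zk3_ge0.
have -> : (\int[Pk F mu r b k]_t
    (Zk2 F mu r b k (splice mu b (tuple_path t.1.2.1) (tuple_path t.1.2.2)))%:E =
    \int[Pk2 F mu r b k]_yz
     (Zk2 F mu r b k (splice mu b (tuple_path yz.1) (tuple_path yz.2)))%:E)%E.
  have m2 : measurable_fun setT (fun yz : (nk r k).-tuple R * (nk r k).-tuple R =>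
     (Zk2 F mu r b k (splice mu b (tuple_path yz.1) (tuple_path yz.2)))%:E).
    by apply/measurable_EFinP; exact: measurable_Zk2_splice.
  rewrite (integral_prod_fst _ _ (f := fun u : (nk r k).-tuple R *
     ((nk r k).-tuple R * (nk r k).-tuple R) =>
     (Zk2 F mu r b k (splice mu b (tuple_path u.2.1) (tuple_path u.2.2)))%:E))//.
  - rewrite (integral_prod_snd _ _ (f := fun yz =>
     (Zk2 F mu r b k (splice mu b (tuple_path yz.1) (tuple_path yz.2)))%:E))//.
    by move=> yz; rewrite lee_fin; exact: Zk2_ge0.
  - exact: (measurableT_comp m2 measurable_snd).
  - by move=> yz; rewrite lee_fin Zk2_ge0.
rewrite integral_Zk2//; [|exact: mgf_gt0|exact: mgf_fin].
rewrite integral_Zk3// -measureU//.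
- congr (_ _); apply/seteqP; split => t /=; case: tau_in_block => //=.
  + case=> [hB|/andP[]//].
    apply/negP => /hasP[i ib xi]; move/allP: hB => /(_ i).
    rewrite mem_index_iota block_range// => /(_ isT).
    apply/negP; rewrite -leNgt ltW//; apply: le_lt_trans xi.
    rewrite lerD2l ler_wpM2r ?ler_nat ?ltW//.
    by move: ib; rewrite mem_block => /andP[/ltnW].
  + by case.
  + move=> hA; case: (boolP (event_B mu r b k (tuple_path t))) => hB.
      by left.
    by right; rewrite hA.
- apply: measurable_pred; apply: measurable_and.
    by apply: measurable_tau_in_block => i; exact: measurable_tuple_path.
  by apply: measurable_event_B => i; exact: measurable_tuple_path.
- apply: measurable_pred; apply: measurable_and.
    by apply: measurable_tau_in_block => i; exact: measurable_tuple_path.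
  apply: measurable_and; apply: measurable_neg.
    by apply: measurable_event_A => i; exact: measurable_tuple_path.
  by apply: measurable_event_B => i; exact: measurable_tuple_path.
- by rewrite -subset0 => t /= [/andP[_ hB] /and3P[_ _]]; rewrite hB.
Qed.

Lemma integral_Zk k : (0 < k)%N ->
  (\int[Pk F mu r b k]_t (Zk F mu b t)%:E = hit_block k)%E.
Proof.
move=> k0; under eq_integral do rewrite ZkE EFinD.
rewrite ge0_integralD//; last 4 first.
- by move=> t _; rewrite lee_fin Zk1_ge0.
- exact/measurable_EFinP.
- by move=> t _; rewrite lee_fin Zk23_ge0.
- by apply/measurable_EFinP; exact: measurable_Zk23.
rewrite integral_Zk23//.
have -> : (\int[Pk F mu r b k]_t (Zk1 F mu r b k (tuple_path t.1.1))%:E =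
    \int[Pk1 F mu r b k]_t (Zk1 F mu r b k (tuple_path t))%:E)%E.
  have m1 : measurable_fun setT (fun t : (nk r k).-tuple R =>
    (Zk1 F mu r b k (tuple_path t))%:E).
    by apply/measurable_EFinP; exact: mZ1.
  rewrite (integral_prod_fst _ _ (f := fun u : (nk r k).-tuple R *
     ((nk r k).-tuple R * (nk r k).-tuple R) =>
     (Zk1 F mu r b k (tuple_path u.1))%:E))//.
  - rewrite (integral_prod_fst _ _ (f := fun t =>
     (Zk1 F mu r b k (tuple_path t))%:E))//.
    by move=> t; rewrite lee_fin; exact: Zk1_ge0.
  - exact: (measurableT_comp m1 measurable_fst).
  - by move=> t; rewrite lee_fin Zk1_ge0.
rewrite integral_Zk1// -measureU//.
- congr (_ _); apply/seteqP; split => t /=; case: tau_in_block => //=.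
  + by case.
  + by move=> _; case: event_A; [left|right].
- apply: measurable_pred; apply: measurable_and.
    by apply: measurable_tau_in_block => i; exact: measurable_tuple_path.
  by apply: measurable_event_A => i; exact: measurable_tuple_path.
- apply: measurable_pred; apply: measurable_and.
    by apply: measurable_tau_in_block => i; exact: measurable_tuple_path.
  apply: measurable_neg.
  by apply: measurable_event_A => i; exact: measurable_tuple_path.
- by rewrite -subset0 => t /= [/andP[_ hA] /andP[_]]; rewrite hA.
Qed.

Lemma integral_Q (G : strata (@sample R r) -> \bar R) :
  measurable_fun setT G -> (forall s, 0 <= G s)%E ->
  (\int[Q F mu r b]_s G s =
   \sum_(k <oo) (pk F mu r b k)%:E *
     \int[Pk F mu r b k]_t G (in_stratum t))%E.
Proof.
move=> mG G0; rewrite mixtureE//; last first.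
  by case=> [|k]//; exact/ltW/pk_gt0.
apply: eq_eseriesr => k _; congr (_ * _)%E.
by rewrite ge0_integral_distribution.
Qed.

Lemma measurable_Z_stratum k : measurable_fun setT
  (fun t : @sample R r k => Z F mu r b (in_stratum t)).
Proof.
suff : measurable_fun setT
    (fun t : @sample R r k => Zk F mu b t / pk F mu r b k) by [].
by apply: measurable_funM => //; exact: measurable_Zk.
Qed.

Lemma measurable_Z : measurable_fun setT (Z F mu r b).
Proof.
move=> _ B mB; rewrite setTI.
suff : strata_measurable (Z F mu r b @^-1` B) by [].
by move=> k; have := @measurable_Z_stratum k measurableT B mB; rewrite setTI.
Qed.

Lemma Z_ge0 s : 0 <= Z F mu r b s.
Proof.
case: s => k t; rewrite /Z/= ZkE; apply: mulr_ge0.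
  by apply: addr_ge0; [exact: Zk1_ge0|exact: Zk23_ge0].
by rewrite invr_ge0; case: k t => // k _; exact/ltW/pk_gt0.
Qed.

Lemma tau_in_block0 x : tau_in_block mu r b 0 x = false.
Proof. by rewrite /tau_in_block; case: tau. Qed.

Lemma hit_block0 : hit_block 0 = 0%E.
Proof.
rewrite /hit_block [X in muN 0%N X](_ : _ = set0) ?measure0//.
by rewrite -subset0 => t /=; rewrite tau_in_block0.
Qed.

(** The weight [pk] cancels in every stratum [k > 0]; stratum 0 has weight 0 and an empty block. *)
Lemma expectation_Z : ('E_(Q F mu r b)[Z F mu r b] = \sum_(k <oo) hit_block k)%E.
Proof.
rewrite unlock integral_Q; last 2 first.
- by apply/measurable_EFinP; exact: measurable_Z.
- by move=> s; rewrite lee_fin Z_ge0.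
apply: eq_eseriesr => -[|k] _; first by rewrite mul0e hit_block0.
rewrite -integral_Zk//.
rewrite -ge0_integralZl//; last 3 first.
- by apply/measurable_EFinP; exact: measurable_Z_stratum.
- by move=> t _; rewrite lee_fin; exact: (Z_ge0 (in_stratum t)).
- by rewrite lee_fin; exact/ltW/pk_gt0.
have p0 := lt0r_neq0 (pk_gt0 (ltn0Sn k)).
apply: eq_integral => t _; rewrite -EFinM; congr (_%:E).
by rewrite mulrC; exact: divfK.
Qed.

(* In stratum k, Z = u + v with u = Zk1 / pk <= m and v = Zk23 / pk <= D, so that
   Z ^ 2 <= m Z + (m + D) v, where v has mean [hit_noA k] / pk. *)
Lemma second_moment_Z (m D : R) : 0 <= m -> 0 <= D ->
  (forall k, (0 < k)%N -> forall x, Zk1 F mu r b k x <= pk F mu r b k * m) ->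
  (forall k, (0 < k)%N -> forall t : @sample R r k, Zk23 t <= pk F mu r b k * D) ->
  (\int[Q F mu r b]_s ((Z F mu r b s) ^+ 2)%:E <=
   m%:E * (\sum_(k <oo) hit_block k) + (m + D)%:E * (\sum_(k <oo) hit_noA k))%E.
Proof.
move=> m0 D0 Z1m Z23D.
rewrite integral_Q; last 2 first.
- by apply/measurable_EFinP; apply: measurable_funX; exact: measurable_Z.
- by move=> s; rewrite lee_fin sqr_ge0.
rewrite -!nneseriesZl//; [|by move=> k _; exact: measure_ge0..].
rewrite -nneseriesD//; last 2 first.
- by move=> k _ _; rewrite mule_ge0 ?lee_fin.
- by move=> k _ _; rewrite mule_ge0 ?lee_fin ?addr_ge0.
apply: lee_nneseries.
  move=> k _ _; rewrite mule_ge0//.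
    by rewrite lee_fin; case: k => // k; exact/ltW/pk_gt0.
  by apply: integral_ge0 => t _; rewrite lee_fin sqr_ge0.
case=> [|k] _.
  by rewrite mul0e adde_ge0// mule_ge0 ?lee_fin ?addr_ge0.
have p0 := pk_gt0 (ltn0Sn k).
rewrite -integral_Zk// -integral_Zk23// -!ge0_integralZl//.
- rewrite -ge0_integralD//; last 4 first.
  - by move=> t _; rewrite mule_ge0 ?lee_fin ?Zk_ge0.
  - apply/measurable_EFinP; apply: measurable_funM => //.
    exact: measurable_Zk.
  - by move=> t _; apply: mule_ge0; rewrite lee_fin; [exact: addr_ge0|exact: Zk23_ge0].
  - apply/measurable_EFinP; apply: measurable_funM => //.
    exact: measurable_Zk23.
  apply: ge0_le_integral => //.
  - by move=> t _; rewrite lee_fin mulr_ge0 ?sqr_ge0// ltW.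
  - apply/measurable_EFinP; apply: measurable_funM => //.
    by apply: measurable_funX; exact: measurable_Z_stratum.
  - apply/measurable_EFinP; apply: measurable_funD; apply: measurable_funM => //.
      exact: measurable_Zk.
    exact: measurable_Zk23.
  - move=> t _; rewrite -!EFinM -EFinD lee_fin.
    set p := pk _ _ _ _ _ in p0 *.
    rewrite (_ : Z F mu r b (in_stratum t) = Zk F mu b t / p)//.
    rewrite expr_div_n mulrCA.
    have p_neq0 : p != 0 by rewrite gt_eqF.
    rewrite (_ : p / p ^+ 2 = p^-1); last by field.
    rewrite ler_pdivrMr// ZkE.
    (* With u and v for the values of [Zk1] and [Zk23]: u^2 <= p m u, 2 u v <= 2 p m v and v^2 <= p
       D v. *)
    have := Z1m _ (ltn0Sn k) (tuple_path t.1.1); have := Z23D _ (ltn0Sn k) t.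
    have := Zk23_ge0 t; have := Zk1_ge0 k.+1 (tuple_path t.1.1).
    rewrite -/p; nra.
- by apply/measurable_EFinP; exact: measurable_Zk23.
- by move=> t _; rewrite lee_fin Zk23_ge0.
- by rewrite lee_fin addr_ge0.
- by apply/measurable_EFinP; exact: measurable_Zk.
- by move=> t _; rewrite lee_fin Zk_ge0.
- apply/measurable_EFinP; apply: measurable_funX.
  exact: measurable_Z_stratum.
- by move=> t _; rewrite lee_fin sqr_ge0.
- by rewrite lee_fin ltW.
Qed.

End stratified.

(** * The hitting probability as a sum over blocks *)

Section hitting_probability.
Context {R : realType} d (T : measurableType d) (P : probability T R).
Variables (X : nat -> {RV P >-> R}) (F : probability R R) (mu b : R) (r : nat).
Hypothesis X_indep : mutually_independent X.
Hypothesis X_law : forall i (A : set R), measurable A ->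
  distribution P (X i) A = F A.
Hypotheses (b_ge0 : 0 <= b) (r_gt1 : (1 < r)%N).

Lemma leq_nk i j : (i <= j)%N -> (nk r i <= nk r j)%N.
Proof.
by apply: (homo_leq (leqnn) leq_trans) => k; exact/ltnW/nk_ltn.
Qed.

Lemma block_exists t : (0 < t)%N -> exists2 k, (0 < k)%N & t \in block r k.
Proof.
move=> t0; have ex : exists k, (t <= nk r k)%N.
  by exists t; case: t t0 => // t _; rewrite /nk ltnW// ltn_expl.
case: (ex_minnP ex) => k tk mink; exists k.
  by case: k tk {mink} => //; rewrite leqNgt t0.
rewrite mem_block tk andbT ltnNge; apply/negP => /mink.
case: k tk {mink} => [|k] /=; last by rewrite ltnn.
by rewrite leqNgt t0.
Qed.

Lemma block_inj t i j : t \in block r i -> t \in block r j -> i = j.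
Proof.
suff h i' j' : t \in block r i' -> t \in block r j' -> (i' <= j')%N.
  by move=> ti tj; apply/eqP; rewrite eqn_leq !h.
rewrite !mem_block => /andP[it _] /andP[_ tj]; rewrite leqNgt; apply/negP => ji.
suff : (nk r j' <= nk r i'.-1)%N by rewrite leqNgt (leq_trans it).
by apply: leq_nk; case: i' ji {it}.
Qed.

Lemma eq_tau_in_block x y k :
  (forall i, (0 < i <= nk r k)%N -> x i = y i) ->
  tau_in_block mu r b k x = tau_in_block mu r b k y.
Proof.
move=> xy; rewrite !tau_in_blockE; apply: eq_in_has => t.
rewrite mem_block => /andP[_ tk].
by apply: eq_tau => i it i0; apply: xy; rewrite i0 (leq_trans it).
Qed.

Lemma tuple_path_tnth n (t : n.-tuple R) i (ik : (i < n)%N) :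
  tuple_path t i.+1 = tnth t (Ordinal ik).
Proof. by rewrite (tnth_nth 0). Qed.

Lemma hit_blockE k :
  P [set w | tau_in_block mu r b k (X ^~ w)] = hit_block F mu b r k.
Proof.
rewrite /hit_block -(distribution_indep X_indep X_law); last first.
  apply: measurable_pred; apply: measurable_tau_in_block => i.
  exact: measurable_tuple_path.
congr (P _); apply/seteqP; split => w /=;
  (rewrite (@eq_tau_in_block _ (X ^~ w)) //) => i /andP[i0 ik];
  by case: i i0 ik => // i _ ik; rewrite (tuple_path_tnth _ ik) tnth_mktuple.
Qed.

(** The blocks partition the positive integers, and [b >= 0] rules out passage at time 0. *)
Lemma hit_series : P [set w | tau mu b (X ^~ w) != None] =
  (\sum_(k <oo) hit_block F mu b r k)%E.
Proof.
rewrite (_ : [set w | _] = \bigcup_k [set w | tau_in_block mu r b k (X ^~ w)]).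
  rewrite measure_bigcup//.
  - transitivity (\sum_(k <oo) P [set w | tau_in_block mu r b k (X ^~ w)])%E.
      by apply: eq_eseriesl => k; rewrite in_setT.
    by apply: eq_eseriesr => k _; rewrite hit_blockE.
  - move=> k _; apply: measurable_pred; apply: measurable_tau_in_block => i.
    exact: measurable_funP.
  - move=> i j _ _ [w [/=]]; rewrite /tau_in_block; case: tau => // t.
    exact: block_inj.
apply/seteqP; split => w /=; last first.
  by case=> k _ /=; rewrite /tau_in_block; case: tau.
case E : tau => [t|//] _.
have t0 : (0 < t)%N.
  rewrite lt0n; apply/eqP => t0; have := tau_gt E.
  by rewrite t0 mul0r subr0 /walk big_geq// ltNge b_ge0.
by have [k _ tk] := block_exists t0; exists k; rewrite //= /tau_in_block E.
Qed.

End hitting_probability.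

(** * Exponential moments of heavy tails *)

Section exponential_inequalities.
Context {R : realType}.

(** Squaring [1 - v / 2 <= expR (- (v / 2))] reduces the claim to
    [1 <= (1 + v + 2 v^2) (1 - v / 2)^2], where the right side exceeds 1 by exactly
    [v^2 (1 - v) (5 / 4 - v / 2)]. *)
Lemma expR_le_quad (v : R) : 0 <= v <= 1 -> expR v <= 1 + v + 2 * v ^+ 2.
Proof.
move=> /andP[v0 v1].
have e2 : 1 - v / 2 <= expR (- (v / 2)) by exact: expR_ge1Dx.
have E : expR v * expR (- (v / 2)) ^+ 2 = 1.
  rewrite -expRM_natl -expRD -[RHS]expR0; congr expR.
  by rewrite -mulr_natl; field.
have := expR_gt0 v; set w := expR v in E *; set z := expR (- (v / 2)) in e2 E.
move=> w0.
have h : w * (1 - v / 2) ^+ 2 <= 1.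
  rewrite -[leRHS]E ler_pM2l//; apply: lerXn2r; rewrite ?nnegrE ?expR_ge0//.
  by lra.
have q : 1 <= (1 + v + 2 * v ^+ 2) * (1 - v / 2) ^+ 2.
  have : 0 <= v ^+ 2 * ((1 - v) * (5 / 4 - v / 2)).
    by rewrite mulr_ge0 ?sqr_ge0// mulr_ge0; lra.
  by lra.
have d0 : 0 < (1 - v / 2) ^+ 2 by rewrite exprn_gt0//; lra.
by rewrite -(ler_pM2r d0); apply: le_trans h q.
Qed.

(** Replaces the second-order Taylor bound when only a moment of order [p] is at hand. The linear
    term is kept exactly, so that it integrates to zero against a centred law. For [v <= -1],
    [|v| <= |v|^p] is enough. *)
Lemma expR_le_powR (p v : R) : 1 <= p <= 2 -> v <= 1 ->
  expR v <= 1 + v + 2 * `|v| `^ p.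
Proof.
move=> /andP[p1 p2] v1; have [v0|v0] := leP 0 v.
  apply: le_trans (expR_le_quad _) _; first by rewrite v0.
  rewrite lerD2l ler_pM2l// ger0_norm//.
  have [->|vn0] := eqVneq v 0.
    by rewrite expr0n /= powR_ge0.
  rewrite -powR_mulrn//; apply: ger_powR => //.
  by rewrite v1 lt_def vn0 v0.
have ev : expR v <= 1 by rewrite -expR0 ler_expR ltW.
have [vN1|vN1] := leP v (-1).
  have : `|v| <= `|v| `^ p by apply: le1r_powR; rewrite // ltr0_norm//; lra.
  by rewrite ltr0_norm//; lra.
(* Multiplying [1 - v <= expR (- v)] by [expR v (1 + v)] gives the bound
   [expR v <= 1 + v + v ^ 2] for negative [v]. *)
have e1 : 1 - v <= expR (- v) by exact: expR_ge1Dx.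
have E : expR v * expR (- v) = 1 by rewrite -expRD subrr expR0.
have w0 := expR_gt0 v.
have h : expR v * (1 - v) <= 1 by rewrite -[leRHS]E ler_pM2l.
have q : expR v <= 1 + v + v ^+ 2.
  have d0 : 0 < 1 - v by lra.
  rewrite -(ler_pM2r d0); apply: le_trans h _.
  rewrite (_ : _ * _ = 1 - v ^+ 3); last by ring.
  have : 0 <= (- v) ^+ 3 by rewrite exprn_ge0//; lra.
  by rewrite !exprS expr0; lra.
apply: le_trans q _; rewrite lerD2l.
have : v ^+ 2 <= `|v| `^ p.
  rewrite -real_normK ?num_real// -powR_mulrn ?normr_ge0//.
  by apply: ger_powR => //; rewrite ltr0_norm//; apply/andP; split; lra.
by have := sqr_ge0 v; lra.
Qed.

(** The ratio [expR v / v^m] increases for [v >= m]. For [1 <= v < m] it is at most [expR m], which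
    the hypothesis on [u] places below [expR u / u^m]. *)
Lemma expR_le_pow (m : nat) (u v : R) : 1 <= v <= u ->
  expR m%:R * u ^+ m <= expR u -> expR v * u ^+ m <= expR u * v ^+ m.
Proof.
move=> /andP[v1 vu] hu; have v0 : 0 < v by lra.
have u0 : 0 < u by lra.
have [mv|vm] := leP m%:R v.
  have h : u / v <= expR ((u - v) / v).
    apply: le_trans (expR_ge1Dx _); rewrite le_eqVlt; apply/orP; left.
    by apply/eqP; field; rewrite gt_eqF.
  have h2 : (u / v) ^+ m <= expR (u - v).
    apply: (@le_trans _ _ (expR ((u - v) / v) ^+ m)).
      by apply: lerXn2r => //; rewrite nnegrE ?expR_ge0// divr_ge0// ltW.
    rewrite -expRM_natl ler_expR mulrCA ler_piMr ?subr_ge0//.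
    by rewrite ler_pdivrMr// mul1r.
  move: h2; rewrite expr_div_n ler_pdivrMr ?exprn_gt0// => h2.
  apply: le_trans (_ : expR v * (expR (u - v) * v ^+ m) <= _).
    by rewrite ler_pM2l ?expR_gt0.
  by rewrite mulrA -expRD addrC subrK.
apply: (@le_trans _ _ (expR u * 1)).
  rewrite mulr1; apply: le_trans hu.
  by rewrite ler_pM2r ?exprn_gt0// ler_expR ltW.
by rewrite ler_pM2l ?expR_gt0// exprn_ege1.
Qed.

Lemma expR_dominates_pow (m : nat) :
  exists2 u0 : R, 1 <= u0 & forall u, u0 <= u -> expR m%:R * u ^+ m <= expR u.
Proof.
pose D : R := (m.+1)`!%:R * expR m%:R.
exists (1 + D) => [|u uD].
  by rewrite lerDl mulr_ge0// expR_ge0.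
have D0 : 0 <= D by rewrite mulr_ge0 ?expR_ge0.
have u0 : 0 <= u by lra.
have := expR_ge1Dxn m u0; apply: le_trans.
apply: le_trans (_ : u ^+ m.+1 / (m.+1)`!%:R <= _); last by lra.
rewrite ler_pdivlMr ?ltr0n ?fact_gt0// exprS mulrAC.
by rewrite ler_wpM2r ?exprn_ge0// mulrC -/D; lra.
Qed.

End exponential_inequalities.

(** * Exponential moments of truncated increments *)

Section truncated_exponential_moments.
Context {R : realType} (F : probability R R).
Variables (p M : R).
Hypothesis p12 : 1 <= p <= 2.
Hypothesis F_moment : (\int[F]_x (`|x| `^ p)%:E <= M%:E)%E.
Hypothesis F_int : F.-integrable setT EFin.
Hypothesis F_mean : (\int[F]_x x%:E = 0)%E.

Let measurable_abs_pow : measurable_fun setT (fun x : R => `|x| `^ p).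
Proof.
by apply: (measurableT_comp (f := fun x : R => x `^ p)).
Qed.

Let measurable_abs_powE : measurable_fun setT (fun x : R => (`|x| `^ p)%:E).
Proof. exact/measurable_EFinP. Qed.

Let abs_powE_ge0 x : [set: R] x -> (0 <= (`|x| `^ p)%:E)%E.
Proof. by rewrite lee_fin powR_ge0. Qed.

Let measurable_exp_trunc (s : R) (q : R -> bool) : measurable_fun setT q ->
  measurable_fun setT (fun x : R => expR (s * x) * (q x)%:R).
Proof.
move=> mq; apply: measurable_funM; last exact: measurable_indicator.
by apply: measurableT_comp => //; exact: measurable_funM.
Qed.

(** Pointwise the integrand is at most [1 + 2 |s x|^p + s x], also where it is cut to 0, and the
    linear term has mean zero. The sign of [s] is free: it will be negative for lower deviations. *)
Lemma exp_moment_le1 (s : R) :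
  (\int[F]_x (expR (s * x) * (s * x <= 1)%R%:R)%:E <=
   (1 + 2 * (`|s| `^ p * M))%:E)%E.
Proof.
pose g (x : R) : R := 1 + 2 * (`|s| `^ p) * `|x| `^ p.
have g0 x : 0 <= g x by rewrite addr_ge0// !mulr_ge0// powR_ge0.
have mg : measurable_fun setT g.
  by apply: measurable_funD => //; exact: measurable_funM.
have ig : (\int[F]_x (g x)%:E <= (1 + 2 * (`|s| `^ p * M))%:E)%E.
  under eq_integral do rewrite EFinD EFinM.
  have c0 : 0 <= 2 * `|s| `^ p by rewrite mulr_ge0// powR_ge0.
  have h0 x : [set: R] x -> (0 <= (2 * `|s| `^ p)%:E * (`|x| `^ p)%:E)%E.
    by rewrite mule_ge0// lee_fin ?powR_ge0.
  have mh : measurable_fun setT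
      (fun x : R => (2 * `|s| `^ p)%:E * (`|x| `^ p)%:E)%E.
    by apply: emeasurable_funM => //; exact/measurable_EFinP.
  rewrite ge0_integralD//.
  rewrite integral_cst// [X in (_ * X)%E](_ : _ = 1%E); last exact: probability_setT.
  rewrite mul1e EFinD leeD2l// ge0_integralZl//.
  by rewrite mulrA [leRHS]EFinM lee_wpmul2l.
have int_g : F.-integrable setT (EFin \o g).
  apply/integrableP; split; first exact/measurable_EFinP.
  apply: le_lt_trans (ltry (1 + 2 * (`|s| `^ p * M))).
  by under eq_integral do rewrite /= ger0_norm//.
have int_s : F.-integrable setT (fun x => (s%:E * x%:E)%E) by exact: integrableZl.
have pt x : expR (s * x) * (s * x <= 1)%R%:R <= g x + s * x.
  have := g0 x; rewrite /g; have := expR_le_powR p12 (v := s * x).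
  rewrite normrM powRM// mulrA; case: leP => [_ /(_ isT)|s1 _]; rewrite ?mulr1 ?mulr0; lra.
apply: le_trans (_ : \int[F]_x ((g x)%:E + s%:E * x%:E) <= _)%E.
  have f0 x : [set: R] x -> (0 <= (expR (s * x) * (s * x <= 1)%R%:R)%:E)%E.
    by rewrite lee_fin mulr_ge0// expR_ge0.
  have mf : measurable_fun setT (fun x => (expR (s * x) * (s * x <= 1)%R%:R)%:E).
    apply/measurable_EFinP; apply: measurable_exp_trunc.
    by apply: measurable_fun_ler => //; exact: measurable_funM.
  have mgs : measurable_fun setT (fun x => (g x)%:E + s%:E * x%:E)%E.
    apply: emeasurable_funD; first exact/measurable_EFinP.
    by apply: emeasurable_funM => //; exact/measurable_EFinP.
  apply: ge0_le_integral => //.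
  by move=> x _; rewrite -EFinM -EFinD lee_fin.
by rewrite integralD// integralZl// F_mean mule0 adde0.
Qed.

Lemma markov_moment (x : R) : 0 < x ->
  (F [set y | (x <= `|y|)%R] <= (M / x `^ p)%:E)%E.
Proof.
move=> x0; have xp0 : 0 < x `^ p by exact: powR_gt0.
pose S : set R := [set y | x <= `|y|]; rewrite -/S.
have mS : measurable S.
  by apply: measurable_pred; apply: measurable_fun_ler.
have FS : (\int[F]_y (\1_S y : R)%:E = F S)%E by rewrite integral_indic// setIT.
rewrite -FS EFinM lee_pdivlMr// muleC.
have mi : measurable_fun setT (fun y => (\1_S y : R)%:E).
  by apply/measurable_EFinP; exact: measurable_indic.
have xE : (0 <= (x `^ p)%:E)%E by rewrite lee_fin ltW.
rewrite -ge0_integralZl//.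
have i0 y : [set: R] y -> (0 <= (x `^ p)%:E * (\1_S y : R)%:E)%E.
  by rewrite mule_ge0// lee_fin.
have mi' : measurable_fun setT
    (fun y => (x `^ p)%:E * (\1_S y : R)%:E)%E.
  exact: emeasurable_funM.
apply: le_trans F_moment; apply: ge0_le_integral => //.
  move=> y _; rewrite -EFinM lee_fin indicE.
  have -> : (y \in S) = (x <= `|y|) by apply/idP/idP; rewrite inE.
  case: (leP x _) => xy /=; rewrite ?mulr1 ?mulr0 ?powR_ge0//.
  apply: ge0_ler_powR; rewrite ?nnegrE// ?normr_ge0 ?ltW//.
  by case/andP: p12 => /(lt_le_trans ltr01).
Qed.

Lemma tail_moment (x : R) : 0 < x -> tail F x <= M / x `^ p.
Proof.
move=> x0; rewrite /tail -lee_fin fineK ?fin_num_measure//.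
apply: le_trans (markov_moment x0); apply: le_measure; rewrite ?inE//.
  by apply: measurable_pred; apply: measurable_fun_ler.
move=> y /=; rewrite in_itv/= andbT => /ltW xy.
by rewrite (le_trans xy)// ler_norm.
Qed.

Variables (be : nat) (x1 : R).
Hypothesis x1_gt0 : 0 < x1.
Hypothesis tail_gt0 : forall x, 0 < tail F x.
Hypothesis tailE : forall c, x1 <= c -> F `[c, +oo[%classic = (tail F c)%:E.
Hypothesis potter : forall x y, x1 <= x -> x <= y ->
  x ^+ be * tail F x <= y ^+ be * tail F y.

Lemma potter_scale (a x : R) : 0 < a <= 1 -> x1 <= a * x ->
  tail F (a * x) <= a ^- be * tail F x.
Proof.
move=> /andP[a0 a1] ax1.
have x0 : 0 < x by rewrite -(pmulr_rgt0 _ a0); exact: lt_le_trans ax1.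
have := potter ax1 (ler_piMl (ltW x0) a1).
rewrite exprMn -mulrA mulrCA ler_pM2l ?exprn_gt0// => h.
by rewrite ler_pdivlMl ?exprn_gt0.
Qed.

(** A one-sided Karamata bound by halving [y]: the piece on [[y / 2, y)] and, by induction, the part
    below [y / 2] are each at most [y^(be + 1) tail(y / 2)], and [tail(y / 2) <= 2^be tail(y)]. The
    exponent exceeds [be] by one, which lets the constant [2^(be + 1)] reproduce itself. *)
Lemma karamata (y : R) : x1 <= y ->
  (\int[F]_x (x ^+ be.+1 * ((x1 <= x) && (x < y))%R%:R)%:E <=
   (2 ^+ be.+1 * (y ^+ be.+1 * tail F y))%:E)%E.
Proof.
pose G y := (\int[F]_x (x ^+ be.+1 * ((x1 <= x) && (x < y))%R%:R)%:E)%E.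
rewrite -/(G y) => x1y.
have mf (a c : R) : measurable_fun setT
    (fun x : R => (x ^+ be.+1 * ((a <= x) && (x < c))%R%:R)%:E).
  apply/measurable_EFinP; apply: measurable_funM => //.
  apply: measurable_indicator; apply: measurable_and.
    exact: measurable_fun_ler.
  exact: measurable_fun_ltr.
have f0 (a c : R) : x1 <= a -> forall x : R, [set: R] x ->
    (0 <= (x ^+ be.+1 * ((a <= x) && (x < c))%R%:R)%:E)%E.
  move=> x1a x _; rewrite lee_fin; case: (leP a x) => /= ax; last by rewrite mulr0.
  by rewrite mulr_ge0 ?ler0n// exprn_ge0// (le_trans (ltW x1_gt0)) ?(le_trans x1a).
have piece a c : x1 <= a -> a <= c ->
    (\int[F]_x (x ^+ be.+1 * ((a <= x) && (x < c))%R%:R)%:E <=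
     (c ^+ be.+1 * tail F a)%:E)%E.
  move=> x1a ac; have a0 : 0 < a by exact: lt_le_trans x1a.
  pose S : set R := `[a, +oo[%classic.
  have mS : measurable S by exact: measurable_itv.
  have FS : (\int[F]_y (\1_S y : R)%:E = F S)%E by rewrite integral_indic// setIT.
  rewrite EFinM -tailE// -/S -FS.
  have c0 : (0 <= (c ^+ be.+1)%:E)%E.
    by rewrite lee_fin exprn_ge0// (le_trans _ ac)// ltW.
  have mi : measurable_fun setT (fun y => (\1_S y : R)%:E).
    by apply/measurable_EFinP; exact: measurable_indic.
  rewrite -ge0_integralZl//.
  have mi' : measurable_fun setT (fun y => (c ^+ be.+1)%:E * (\1_S y : R)%:E)%E.
    exact: emeasurable_funM.
  apply: ge0_le_integral => //; first exact: f0.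
  move=> x _; rewrite -EFinM lee_fin indicE mem_setE in_itv/= andbT.
    case: (leP a x) => ax /=; last by rewrite !mulr0.
    case: (ltP x c) => xc /=; rewrite !(mulr0, mulr1) ?exprn_ge0//.
      by apply: lerXn2r; rewrite ?nnegrE; lra.
    by lra.
have [n ny] : exists n, y <= 2 ^+ n * x1.
  have y0 : 0 < y by exact: lt_le_trans x1y.
  exists (Num.bound (y / x1)); rewrite -ler_pdivrMr//.
  have /ltW/le_trans := @archi_boundP R (y / x1) (ltW (divr_gt0 y0 x1_gt0)).
  by apply; rewrite -natrX ler_nat ltnW// ltn_expl.
elim: n y x1y ny => [|n ih] y x1y ny.
  rewrite expr0 mul1r in ny; have -> : y = x1 by apply/le_anti/andP.
  rewrite /G integral0_eq ?lee_fin//.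
    by rewrite !mulr_ge0 ?exprn_ge0 ?(ltW (tail_gt0 _)) ?(ltW x1_gt0).
  by move=> x _; rewrite leNgt; case: (ltP x x1) => _ /=; rewrite mulr0.
have y0 : 0 < y by exact: lt_le_trans x1y.
have Y0 : 0 < y ^+ be.+1 * tail F y by rewrite mulr_gt0 ?exprn_gt0.
have twobe : 2 ^+ be.+1 = 2 * 2 ^+ be :> R by rewrite exprS.
(* When [y / 2 < x1] a single piece covers [[x1, y)], and the ratio [x1 / y] is above 1/2. *)
have [hy|hy] := leP x1 (2^-1 * y); last first.
  apply: le_trans (piece _ _ (lexx _) x1y) _; rewrite lee_fin.
  rewrite mulrCA ler_pM2l ?exprn_gt0//.
  have a01 : 0 < x1 / y <= 1 by rewrite divr_gt0//= ler_pdivrMr// mul1r.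
  have := potter_scale (a := x1 / y) (x := y) a01.
  rewrite divfK ?gt_eqF// => /(_ (lexx _)) /le_trans; apply.
  rewrite ler_pM2r//.
  apply: (@le_trans _ _ (2 ^+ be)); last by rewrite ler_eXn2l// ltr1n.
  rewrite -exprVn; apply: lerXn2r; rewrite ?nnegrE ?invr_ge0//.
    by rewrite ltW//; case/andP: a01.
  by rewrite invf_div ler_pdivrMr//; lra.
have split : (G y <= G (2^-1 * y)%R +
    \int[F]_x (x ^+ be.+1 * ((2^-1 * y <= x) && (x < y))%R%:R)%:E)%E.
  have f1 := f0 x1 y (lexx _); have f2 := f0 x1 (2^-1 * y) (lexx _).
  have f3 := f0 (2^-1 * y) y hy.
  rewrite /G -ge0_integralD//.
    apply: ge0_le_integral => //; first exact: emeasurable_funD.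
    move=> x _; rewrite -EFinD lee_fin -mulrDr.
      case: (leP x1 x) => x1x /=.
        rewrite ler_wpM2l ?exprn_ge0 ?(le_trans (ltW x1_gt0))//.
        by case: (ltP x (2^-1 * y)) => /=; case: (ltP x y) => /=; lra.
      rewrite [2^-1 * y <= x]leNgt (lt_le_trans x1x hy) /=.
      by rewrite addr0.
apply: le_trans split _.
have yy : 2^-1 * y <= y by lra.
have p1 := piece _ _ hy yy.
have ps : tail F (2^-1 * y) <= 2 ^+ be * tail F y.
  have := @potter_scale 2^-1 y; rewrite exprVn invrK; apply => //.
  by apply/andP; split; lra.
have ihy : (G (2^-1 * y)%R <=
    (2 ^+ be.+1 * ((2^-1 * y) ^+ be.+1 * tail F (2^-1 * y)))%:E)%E.
  by apply: ih => //; rewrite exprS in ny; lra.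
apply: le_trans (leeD ihy p1) _; rewrite -EFinD lee_fin.
rewrite exprMn -!mulrA mulrA -exprMn mulfV ?expr1n ?mul1r ?gt_eqF//.
have : y ^+ be.+1 * tail F (2^-1 * y) <= y ^+ be.+1 * (2 ^+ be * tail F y).
  by rewrite ler_pM2l ?exprn_gt0.
by rewrite twobe; lra.
Qed.

End truncated_exponential_moments.

(** In the application [be] is an integer above [alpha]. The bound [p <= 2] is required by
    [expR_le_powR]. [ht_tailE] excludes atoms beyond [x1]: the sampling laws condition on closed
    half-lines, whereas [tail] is the mass of an open one. *)
Record heavy_tail (R : realType) (F : probability R R) (p M : R) (be : nat)
    (x1 : R) : Prop := HeavyTail {
  ht_p : 1 < p <= 2;
  ht_moment : (\int[F]_x (`|x| `^ p)%:E <= M%:E)%E;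
  ht_int : F.-integrable setT EFin;
  ht_mean : (\int[F]_x x%:E = 0)%E;
  ht_x1 : 0 < x1;
  ht_tail : forall x, 0 < tail F x;
  ht_tailE : forall c, x1 <= c -> F `[c, +oo[%classic = (tail F c)%:E;
  ht_potter : forall x y, x1 <= x -> x <= y ->
    x ^+ be * tail F x <= y ^+ be * tail F y }.

(** * A Chernoff bound uniform in the number of increments *)

Section chernoff.
Context {R : realType} (F : probability R R) (p M : R) (be : nat) (x1 : R).
Hypothesis H : heavy_tail F p M be x1.

Let p12 : 1 <= p <= 2.
Proof. by have /andP[/ltW-> ->] := ht_p H. Qed.

Let x1_gt0 : 0 < x1 := ht_x1 H.

Lemma tail_noninc (x y : R) : x <= y -> tail F y <= tail F x.
Proof.
move=> xy; rewrite /tail fine_le ?fin_num_measure// le_measure ?inE//.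
by apply: subset_itvr; rewrite bnd_simp.
Qed.

Lemma moment_ge0 : 0 <= M.
Proof.
rewrite -lee_fin; apply: le_trans (ht_moment H).
by apply: integral_ge0 => x _; rewrite lee_fin powR_ge0.
Qed.

(** Split at [th * x = 1]. Below, the moment bound applies. Above, [expR (th x) <= expR (th y) (x /
    y)^(be + 1)] by comparison with a power, and [karamata] turns the truncated moment of order
    [be + 1] into a multiple of [tail F y]. *)
Lemma exp_moment_trunc (th y : R) : 0 < th -> th * x1 <= 1 -> 1 <= th * y ->
  expR be.+1%:R * (th * y) ^+ be.+1 <= expR (th * y) ->
  (\int[F]_x (expR (th * x) * (x < y)%R%:R)%:E <=
   (1 + 2 * (th `^ p * M) + expR (th * y) * 2 ^+ be.+1 * tail F y)%:E)%E.
Proof.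
move=> th0 thx1 thy big.
have y0 : 0 < y by rewrite -(pmulr_rgt0 _ th0); exact: lt_le_trans thy.
have x1y : x1 <= y by rewrite -(ler_pM2l th0); exact: le_trans thy.
pose f1 x := (expR (th * x) * (th * x <= 1)%R%:R)%:E.
pose f2 x := (x ^+ be.+1 * ((x1 <= x) && (x < y))%R%:R)%:E.
pose c := expR (th * y) / y ^+ be.+1.
have c0 : 0 <= c by rewrite divr_ge0 ?expR_ge0// exprn_ge0// ltW.
have cE : (0 <= c%:E)%E by rewrite lee_fin.
have f10 x : [set: R] x -> (0 <= f1 x)%E by rewrite lee_fin mulr_ge0// expR_ge0.
have f20 x : [set: R] x -> (0 <= f2 x)%E.
  move=> _; rewrite lee_fin; case: (leP x1 x) => /= ax; last by rewrite mulr0.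
  by rewrite mulr_ge0 ?ler0n// exprn_ge0// (le_trans (ltW x1_gt0)).
have cf20 x : [set: R] x -> (0 <= c%:E * f2 x)%E.
  by move=> xT; rewrite mule_ge0// f20.
have mexp : measurable_fun setT (fun x : R => expR (th * x)).
  by apply: measurableT_comp => //; exact: measurable_funM.
have mf1 : measurable_fun setT f1.
  apply/measurable_EFinP; apply: measurable_funM => //.
  by apply: measurable_indicator; apply: measurable_fun_ler => //;
    exact: measurable_funM.
have mf2 : measurable_fun setT f2.
  apply/measurable_EFinP; apply: measurable_funM => //.
  apply: measurable_indicator; apply: measurable_and.
    exact: measurable_fun_ler.
  exact: measurable_fun_ltr.
have mcf2 : measurable_fun setT (fun x => c%:E * f2 x)%E by exact: emeasurable_funM.
apply: le_trans (_ : \int[F]_x (f1 x + c%:E * f2 x) <= _)%E.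
  have g0 x : [set: R] x -> (0 <= (expR (th * x) * (x < y)%R%:R)%:E)%E.
    by rewrite lee_fin mulr_ge0// expR_ge0.
  have mg : measurable_fun setT (fun x => (expR (th * x) * (x < y)%R%:R)%:E).
    apply/measurable_EFinP; apply: measurable_funM => //.
    by apply: measurable_indicator; exact: measurable_fun_ltr.
  have mh : measurable_fun setT (fun x => f1 x + c%:E * f2 x)%E.
    exact: emeasurable_funD.
  apply: ge0_le_integral => //.
  move=> x _; have := cf20 x I; rewrite /f1 /f2 -EFinM -EFinD !lee_fin.
  case: (leP (th * x) 1) => /= thx c2.
    rewrite mulr1; apply: le_trans (_ : expR (th * x) <= _); last by lra.
    by rewrite ler_piMr ?expR_ge0//; case: (x < y).
  rewrite mulr0 add0r; move: c2.
  have x1x : x1 <= x.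
    by rewrite -(ler_pM2l th0); apply: le_trans thx1 _; exact: ltW.
  rewrite x1x /=; case: (ltP x y) => xy /=; rewrite ?mulr0 ?mulr1// => _.
  have := @expR_le_pow R be.+1 (th * y) (th * x).
  rewrite (ltW thx) ler_pM2l// (ltW xy) => /(_ isT big).
  rewrite !exprMn mulrCA [expR _ * (_ * x ^+ _)]mulrCA ler_pM2l ?exprn_gt0//.
  by rewrite /c mulrAC ler_pdivlMr ?exprn_gt0.
rewrite ge0_integralD// ge0_integralZl//.
rewrite EFinD leeD//.
  by have := exp_moment_le1 p12 (ht_moment H) (ht_int H) (ht_mean H) th;
     rewrite ger0_norm// ltW.
apply: le_trans (_ : c%:E * (2 ^+ be.+1 * (y ^+ be.+1 * tail F y))%:E <= _)%E.
  rewrite lee_wpmul2l//; apply: karamata => //.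
  - exact: ht_tail H.
  - exact: ht_tailE H.
  - exact: ht_potter H.
rewrite -EFinM lee_fin /c le_eqVlt; apply/orP; left; apply/eqP.
by field; rewrite expf_neq0// gt_eqF.
Qed.

Lemma powR_large (q K : R) : 0 < q -> \forall c \near +oo, K <= c `^ q.
Proof.
move=> q0; near=> c.
have [K0|K0] := leP K 0; first by apply: le_trans K0 _; exact: powR_ge0.
have -> : K = (K `^ q^-1) `^ q by rewrite -powRrM mulVf ?gt_eqF// powRr1// ltW.
apply: ge0_ler_powR; rewrite ?nnegrE ?powR_ge0 ?(ltW q0)//.
Unshelve. all: by end_near. Qed.

Variable C0 : R.
Hypothesis C0_gt0 : 0 < C0.

Let mass_le (c : R) (N : nat) : 0 < c -> N%:R <= C0 * c ->
  N%:R * tail F c <= C0 * M / c `^ (p - 1).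
Proof.
move=> c0 Nc.
apply: le_trans (_ : (C0 * c) * (M / c `^ p) <= _).
  apply: ler_pM => //; first exact/ltW/(ht_tail H).
  exact: tail_moment p12 (ht_moment H) _ c0.
rewrite le_eqVlt; apply/orP; left; apply/eqP.
have c1 : c `^ p = c * c `^ (p - 1).
  by rewrite mulr_powRB1 ?(ltW c0)//; case/andP: p12 => /(lt_le_trans ltr01).
rewrite c1; field.
by rewrite !gt_eqF// powR_gt0.
Qed.

Lemma mass_small (dl : R) : 0 < dl -> \forall c \near +oo,
  forall N : nat, N%:R <= C0 * c -> N%:R * tail F c <= dl.
Proof.
move=> dl0; near=> c => N Nc.
have c0 : 0 < c by [].
apply: le_trans (mass_le c0 Nc) _.
rewrite ler_pdivrMr ?powR_gt0// [leRHS]mulrC -ler_pdivrMr//.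
near: c; apply: powR_large; rewrite subr_gt0.
by case/andP: (ht_p H).
Unshelve. all: by end_near. Qed.

(** A union bound over times costs a factor [N]; [J] powers of the mass [N tail(c)], which is
    [O(c^(1 - p))], pay for it as soon as [(p - 1) J >= 2]. *)
Lemma mass_pow_small : exists J : nat, forall dl : R, 0 < dl ->
  \forall c \near +oo,
  forall N : nat, N%:R <= C0 * c -> N%:R * (N%:R * tail F c) ^+ J <= dl.
Proof.
have p0 : 0 < p - 1 by rewrite subr_gt0; case/andP: (ht_p H).
pose J := Num.bound (2 / (p - 1)).
have J2 : 2 <= (p - 1) * J%:R.
  have /ltW := archi_boundP (ltW (divr_gt0 (ltr0Sn R 1) p0)).
  by rewrite -/J ler_pdivrMr// mulrC.
exists J => dl dl0; near=> c => N Nc.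
have c1 : 1 <= c by near: c; apply: nbhs_pinfty_ge; rewrite num_real.
have c0 : 0 < c by exact: lt_le_trans c1.
have CM0 : 0 <= C0 * M by rewrite mulr_ge0 ?moment_ge0// ltW.
apply: le_trans (_ : (C0 * c) * (C0 * M / c `^ (p - 1)) ^+ J <= _).
  apply: ler_pM => //; first by rewrite exprn_ge0// mulr_ge0// ltW// (ht_tail H).
  apply: lerXn2r; rewrite ?nnegrE; last exact: mass_le.
    by rewrite mulr_ge0// ltW// (ht_tail H).
  by rewrite divr_ge0// powR_ge0.
rewrite expr_div_n -(powR_mulrn J (powR_ge0 c _)) -powRrM.
set K := (C0 * M) ^+ J.
have K0 : 0 <= K by rewrite exprn_ge0.
have cJ : c ^+ 2 <= c `^ ((p - 1) * J%:R).
  by rewrite -powR_mulrn ?(ltW c0)//; exact: ler_powR.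
apply: le_trans (_ : (C0 * c) * (K / c ^+ 2) <= _).
  rewrite ler_pM2l ?mulr_gt0// ler_wpM2l// lef_pV2// posrE ?exprn_gt0//.
  by rewrite powR_gt0.
rewrite (_ : _ * _ = C0 * K / c); last by field; rewrite gt_eqF.
rewrite ler_pdivrMr// [leRHS]mulrC -ler_pdivrMr//.
Unshelve. all: by end_near. Qed.

(** Chosen so that [expR (tilt eta c N * (eta * c))] is the inverse of the mass [N tail(c)]. With
    [eta = 1] and the data of a block it is [theta]; smaller values go with increments cut at
    [eta * c]. *)
Definition tilt (eta c : R) (N : nat) : R := - ln (N%:R * tail F c) / (eta * c).

(** Both error terms of [exp_moment_trunc] are [O(1 / N)], the order that stays bounded when [N]
    factors are multiplied. For the tail term, the choice of the tilt gives [expR (th y) tail(y) N =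
    tail(eta c) / tail(c) <= eta^-be]. The moment term needs [th^p = O(1 / c)]: [- ln h] grows at
    most like [ln c], hence like [c^s], and [s = (p - 1) / p] is the exponent that yields this
    order. *)
Lemma chernoff_uniform (eta : R) : 0 < eta <= 1 -> exists2 C : R, 0 <= C &
  \forall c \near +oo, forall N : nat, (0 < N)%N -> N%:R <= C0 * c ->
  [/\ 0 < tilt eta c N, N%:R * tail F c < 1 &
   (\int[F]_x (expR (tilt eta c N * x) * (x < eta * c)%R%:R)%:E <=
      (1 + C / N%:R)%:E)%E].
Proof.
move=> /andP[eta0 eta1].
have p1 : 1 < p by case/andP: (ht_p H).
have p0 : 0 < p by exact: lt_trans p1.
pose s := (p - 1) / p.
have s0 : 0 < s by rewrite divr_gt0// subr_gt0.
pose kap := x1 ^+ be * tail F x1.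
have kap0 : 0 < kap by rewrite mulr_gt0 ?exprn_gt0 ?(ht_tail H).
pose A := be%:R / s + `|ln kap|.
have A0 : 0 <= A by rewrite addr_ge0 ?normr_ge0// divr_ge0 ?ler0n// ltW.
exists (2 * (C0 * (A / eta) `^ p * M) + 2 ^+ be.+1 * eta ^- be).
  rewrite addr_ge0 ?mulr_ge0 ?powR_ge0 ?invr_ge0 ?exprn_ge0 ?(ltW C0_gt0) ?(ltW eta0)//.
  exact: moment_ge0.
have [u0 u01 hu0] := expR_dominates_pow be.+1 (R := R).
have near_small := mass_small (expR_gt0 (- u0)).
(* Given [- ln h <= A c^s], this threshold implies [tilt eta c N * x1 <= 1], because
   [p^-1 + s = 1]. *)
have near_x1 : \forall c \near +oo, (A * x1 / eta) <= c `^ p^-1.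
  by apply: powR_large; rewrite invr_gt0.
near=> c.
have small : forall N : nat, N%:R <= C0 * c -> N%:R * tail F c <= expR (- u0).
  by near: c.
move=> N N0 Nc.
have c1 : 1 <= c by near: c; apply: nbhs_pinfty_ge; rewrite num_real.
have c0 : 0 < c by exact: lt_le_trans c1.
have x1c : x1 <= eta * c.
  by rewrite mulrC -ler_pdivrMr.
have N1 : 1 <= N%:R :> R by rewrite ler1n.
have NR0 : 0 < N%:R :> R by exact: lt_le_trans N1.
set h := N%:R * tail F c.
have t0 : 0 < tail F c := ht_tail H c.
have h0 : 0 < h by rewrite mulr_gt0.
have hsmall : h <= expR (- u0) by exact: small.
pose u := - ln h.
have uu0 : u0 <= u by rewrite lerNr -ler_expR lnK.
have u_gt0 : 0 < u by apply: lt_le_trans uu0; exact: lt_le_trans u01.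
have eu : expR u = h^-1 by rewrite expRN lnK.
have uA : u <= A * c `^ s.
  (* Monotonicity of [x^be tail(x)] bounds the tail below by a power of [c], hence [- ln h] above by
     a logarithm. *)
  have hk : kap / c ^+ be <= h.
    apply: (@le_trans _ _ (tail F c)); last by rewrite ler_peMl// ltW.
    rewrite ler_pdivrMr ?exprn_gt0// mulrC.
    apply: ht_potter H _ _ (lexx _) _.
    by apply: le_trans x1c _; rewrite ler_piMl// ltW.
  have cs1 : 1 <= c `^ s by rewrite -(powRr0 c); apply: ler_powR => //; exact: ltW.
  have lc : ln c <= c `^ s / s.
    rewrite ler_pdivlMr// mulrC -ln_powR ltW// ln_sublinear//.
    exact: lt_le_trans cs1.
  have : ln (kap / c ^+ be) <= ln h.
    by rewrite ler_ln ?posrE ?divr_gt0 ?exprn_gt0.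
  rewrite ln_div ?posrE ?exprn_gt0// lnXn// -mulr_natl => lk.
  have l1 : be%:R * ln c <= be%:R / s * c `^ s.
    by rewrite -mulrA ler_wpM2l// mulrC.
  have l2 : - ln kap <= `|ln kap| * c `^ s.
    apply: (@le_trans _ _ `|ln kap|); first by rewrite -normrN ler_norm.
    by rewrite ler_peMr.
  rewrite /u /A mulrDl; lra.
pose y := eta * c.
have y0 : 0 < y by rewrite mulr_gt0.
have thE : tilt eta c N = u / y by [].
have thy : tilt eta c N * y = u by rewrite thE divfK// gt_eqF.
have th0 : 0 < tilt eta c N by rewrite thE divr_gt0.
split=> //.
  apply: le_lt_trans hsmall _; rewrite -expR0 ltr_expR; lra.
have ccs : c `^ p^-1 * c `^ s = c.
  rewrite -powRD; last by rewrite (gt_eqF c0) implybT.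
  have -> : p^-1 + s = 1 by rewrite /s; field; rewrite gt_eqF.
  by rewrite powRr1// ltW.
have thx1 : tilt eta c N * x1 <= 1.
  rewrite thE mulrAC ler_pdivrMr// mul1r.
  apply: le_trans (_ : A * c `^ s * x1 <= _).
    by rewrite ler_pM2r.
  rewrite /y -[X in _ <= _ * X]ccs mulrA mulrAC ler_pM2r ?powR_gt0//.
  rewrite -ler_pdivrMl// mulrC.
  by near: c.
have thy1 : 1 <= tilt eta c N * y by rewrite thy; exact: le_trans uu0.
have big : expR be.+1%:R * (tilt eta c N * y) ^+ be.+1 <= expR (tilt eta c N * y).
  by rewrite thy; exact: hu0.
apply: le_trans (exp_moment_trunc th0 thx1 thy1 big) _.
have key : tilt eta c N `^ p * N%:R <= C0 * (A / eta) `^ p.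
  have -> : tilt eta c N `^ p = u `^ p / (eta `^ p * c `^ p).
    by rewrite thE powRM ?invr_ge0 ?(ltW y0) ?(ltW u_gt0)// -powR_inv1 ?(ltW y0)//
      powRAC powR_inv1 ?powR_ge0// /y powRM// ltW.
  have up : u `^ p <= A `^ p * c `^ (p - 1).
    have -> : c `^ (p - 1) = (c `^ s) `^ p.
      by rewrite -powRrM /s divfK// gt_eqF.
    rewrite -powRM ?powR_ge0//.
    by apply: ge0_ler_powR; rewrite ?nnegrE ?mulr_ge0 ?powR_ge0 // ltW.
  have -> : (A / eta) `^ p = A `^ p / eta `^ p.
    by rewrite powRM ?invr_ge0 ?(ltW eta0)// -powR_inv1 ?(ltW eta0)// powRAC
      powR_inv1 ?powR_ge0.
  have cp : c `^ p = c * c `^ (p - 1) by rewrite mulr_powRB1// ltW.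
  have e0 : 0 < eta `^ p by rewrite powR_gt0.
  have cp0 : 0 < c `^ (p - 1) by rewrite powR_gt0.
  rewrite cp (_ : _ * N%:R = (N%:R * u `^ p) / (eta `^ p * (c * c `^ (p - 1)))); last first.
    by rewrite mulrAC mulrC [u `^ p * _]mulrC mulrC.
  rewrite ler_pdivrMr ?mulr_gt0//.
  rewrite (_ : C0 * _ * _ = (C0 * c) * (A `^ p * c `^ (p - 1))); last first.
    by field; rewrite gt_eqF.
  by apply: ler_pM => //; rewrite ?powR_ge0.
have key2 : expR u * tail F y * N%:R <= eta ^- be.
  have -> : expR u * tail F y * N%:R = tail F y / tail F c.
    by rewrite eu /h; field; rewrite !gt_eqF.
  rewrite ler_pdivrMr//; apply: (potter_scale x1_gt0 (ht_potter H)) => //.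
  by rewrite eta0.
rewrite lee_fin thy -addrA lerD2l [leRHS]mulrDl; apply: lerD.
  rewrite ler_pdivlMr//.
  rewrite (_ : 2 * (_ * M) * N%:R = (tilt eta c N `^ p * N%:R) * (2 * M)); last by ring.
  rewrite (_ : 2 * (_ * M) = (C0 * (A / eta) `^ p) * (2 * M)); last by ring.
  by rewrite ler_wpM2r// mulr_ge0// moment_ge0.
rewrite ler_pdivlMr//.
rewrite (_ : expR u * 2 ^+ be.+1 * _ * _ = 2 ^+ be.+1 * (expR u * tail F y * N%:R)); last by ring.
by rewrite ler_pM2l// exprn_gt0.
Unshelve. all: by end_near. Qed.

End chernoff.

(** * Deviations of the walk and crossings without a big jump *)

Section outer_bounds.
Context {R : realType} d (T : measurableType d) (m : {measure set T -> \bar R}).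
Implicit Types (E V : set T) (u v : R).

(* [m E <= u], without having to prove that [E] is measurable. *)
Definition pr_le E u := exists V, [/\ measurable V, E `<=` V & (m V <= u%:E)%E].

Lemma pr_leW E E' u u' : E `<=` E' -> u' <= u -> pr_le E' u' -> pr_le E u.
Proof.
move=> EE uu [V [mV EV Vu]]; exists V; split=> //.
  exact: subset_trans EV.
by apply: le_trans Vu _; rewrite lee_fin.
Qed.

Lemma pr_leU E E' u u' : pr_le E u -> pr_le E' u' -> pr_le (E `|` E') (u + u').
Proof.
move=> [V [mV EV Vu]] [V' [mV' EV' Vu']]; exists (V `|` V'); split.
- exact: measurableU.
- exact: setUSS.
- by rewrite EFinD; apply: le_trans (leeD Vu Vu'); exact: measureU2.
Qed.

Lemma pr_le_seq (s : seq nat) (E : nat -> set T) (u : nat -> R) :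
  (forall i, i \in s -> pr_le (E i) (u i)) ->
  pr_le [set t | exists2 i, i \in s & E i t] (\sum_(i <- s) u i).
Proof.
elim: s => [|j s ih] h.
  exists set0; split => //; first by move=> t /= [].
  by rewrite measure0 big_nil.
rewrite big_cons; have hj := h j (mem_head _ _).
have hs : pr_le [set t | exists2 i, i \in s & E i t] (\sum_(i <- s) u i).
  by apply: ih => i is_; apply: h; rewrite inE is_ orbT.
apply: pr_leW (pr_leU hj hs) => // t /= [i].
rewrite inE => /orP[/eqP->|is_]; first by left.
by right; exists i.
Qed.

Lemma pr_leP E u : measurable E -> pr_le E u -> (m E <= u%:E)%E.
Proof.
by move=> mE [V [mV EV Vu]]; apply: le_trans Vu; apply: le_measure; rewrite ?inE.
Qed.

End outer_bounds.

(** * Markov bounds for products over an i.i.d. sample *)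

Section product_bounds.
Context {R : realType} (F : probability R R) (N : nat).
Local Notation muN := (indep_law N (fun=> F)).

Definition prD (D : R -> bool) : R := fine (F [set x | D x]).

Lemma prDE (D : R -> bool) : measurable_fun setT D ->
  (\int[F]_x ((D x)%:R : R)%:E = (prD D)%:E)%E.
Proof.
move=> mD; rewrite integral_bool// /prD fineK// fin_num_measure//.
exact: measurable_pred.
Qed.

Lemma prD_ge0 D : 0 <= prD D.
Proof. exact: fine_ge0. Qed.

(** Markov's inequality for a product of functions of single coordinates, whose mean factors. *)
Lemma pr_le_prod (E : set (N.-tuple R)) (g : nat -> R -> R) (a : nat -> R) (K : R) :
  (forall i, measurable_fun setT (g i)) -> (forall i x, 0 <= g i x) ->
  (forall i, (\int[F]_x (g i x)%:E <= (a i)%:E)%E) -> 0 <= K ->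
  (forall t, E t -> 1 <= K * \prod_(1 <= i < N.+1) g i (tuple_path t i)) ->
  pr_le muN E (K * \prod_(1 <= i < N.+1) a i).
Proof.
move=> mg g0 ga K0 EK.
pose f (t : N.-tuple R) := K * \prod_(1 <= i < N.+1) g i (tuple_path t i).
have mf : measurable_fun setT f.
  by apply: measurable_funM => //; exact: measurable_prod_path.
have f0 t : 0 <= f t by rewrite mulr_ge0// prodr_ge0.
pose V := [set t | 1 <= f t].
have mV : measurable V.
  by apply: measurable_pred; apply: measurable_fun_ler.
exists V; split => //.
apply: (@le_trans _ _ (\int[muN]_t (f t)%:E)%E).
  apply: (@le_trans _ _ (\int[muN]_t ((1 <= f t)%R%:R : R)%:E)%E).
    by rewrite integral_bool//; apply: measurable_fun_ler.
  apply: ge0_le_integral => //.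
  - by apply/measurable_EFinP; apply: measurable_indicator; apply: measurable_fun_ler.
  - exact/measurable_EFinP.
  - move=> t _; rewrite lee_fin; case: (leP 1 (f t)) => //= _; exact: f0.
under eq_integral do rewrite /f EFinM.
rewrite ge0_integralZl//; last 2 first.
- by apply/measurable_EFinP; exact: measurable_prod_path.
- by move=> t _; rewrite lee_fin prodr_ge0.
rewrite integral_prod_indep_law// EFinM lee_wpmul2l ?lee_fin//.
have ge0I i : (0 <= \int[F]_x (g i x)%:E)%E.
  by apply: integral_ge0 => x _; rewrite lee_fin.
elim: (index_iota _ _) => [|i s ih]; first by rewrite !big_nil.
rewrite !big_cons EFinM; apply: lee_pmul => //.
by elim: s {ih} => [|j s ih]; rewrite ?big_nil ?big_cons ?lee_fin// mule_ge0.
Qed.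

Lemma prod_one_special (j : nat) (a q : R) :
  \prod_(1 <= i < N.+1) (if i == j then a else q) =
  (if (1 <= j < N.+1)%N then a * q ^+ N.-1 else q ^+ N).
Proof.
case: ifP => jN.
  rewrite (bigD1_seq j) ?mem_index_iota ?iota_uniq//= eqxx; congr (_ * _).
  rewrite (eq_bigr (fun=> q)); last by move=> i /negbTE ->.
  rewrite big_const_seq -/(_ ^+ _) iter_mulr_1; congr (_ ^+ _).
  have := count_predC (pred1 j) (index_iota 1 N.+1).
  rewrite count_uniq_mem ?iota_uniq// mem_index_iota jN size_iota subn1/= => cN.
  by rewrite -[in RHS]cN add1n.
rewrite (eq_big_nat _ _ (F2 := fun=> q)); last first.
  by move=> i iN; case: eqP => // ij; rewrite ij jN in iN.
by rewrite prodr_const_nat subn1.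
Qed.

(** Coordinate [j] only records membership in [D], so its probability stays as a factor; the others
    carry the weights [f i]. An index outside 1 to [N], such as 0, means that no coordinate is
    singled out. *)
Lemma pr_le_tilted (j : nat) (E : set (N.-tuple R)) (D : R -> bool)
    (f : nat -> R -> R) (K q : R) :
  measurable_fun setT D ->
  (forall i, measurable_fun setT (f i)) -> (forall i x, 0 <= f i x) ->
  (forall i, (\int[F]_x (f i x)%:E <= q%:E)%E) -> 1 <= q -> 0 <= K ->
  (forall t, E t -> ((1 <= j < N.+1)%N -> D (tuple_path t j)) /\
    1 <= K * \prod_(1 <= i < N.+1 | i != j) f i (tuple_path t i)) ->
  pr_le muN E (K * (if (1 <= j < N.+1)%N then prD D else 1) * q ^+ N).
Proof.
move=> mD mf f0 fq q1 K0 EK.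
pose g i (x : R) : R := if i == j then (D x)%:R else f i x.
apply: pr_leW (@pr_le_prod E g (fun i => if i == j then prD D else q) K _ _ _ K0 _).
- by [].
- rewrite prod_one_special -mulrA; case: ifP => jN.
    rewrite ler_wpM2l// ler_wpM2l ?prD_ge0//.
    by apply: ler_weXn2l => //; exact: leq_pred.
  by rewrite mul1r.
- by move=> i; rewrite /g; case: (i == j) => //; exact: measurable_indicator.
- by move=> i x; rewrite /g; case: (i == j).
- by move=> i; rewrite /g; case: (i == j) => //; rewrite prDE.
- move=> t /EK[Dj le1]; apply: le_trans le1 _; rewrite ler_wpM2l//.
  rewrite [leLHS]big_mkcond/= !big_nat; apply: ler_prod => i iN.
  rewrite /g; case: eqP => [ij|_] /=; last by rewrite f0 lexx.
  by rewrite ler01 ij Dj ?lexx// -ij.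
Qed.

Lemma pr_le_pair (i j : nat) (D D' : R -> bool) :
  measurable_fun setT D -> measurable_fun setT D' ->
  (1 <= i < N.+1)%N -> (1 <= j < N.+1)%N -> i != j ->
  pr_le muN [set t | D (tuple_path t i) && D' (tuple_path t j)] (prD D * prD D').
Proof.
move=> mD mD' iN jN ij.
pose g k (x : R) : R := if k == i then (D x)%:R else if k == j then (D' x)%:R else 1.
pose a k := if k == i then prD D else if k == j then prD D' else 1.
have prod2 (u : nat -> R) : (forall k, k != i -> k != j -> u k = 1) ->
    \prod_(1 <= k < N.+1) u k = u i * u j.
  move=> u1; rewrite (bigD1_seq i) ?mem_index_iota ?iota_uniq//=; congr (_ * _).
  rewrite -big_filter (bigD1_seq j) ?mem_filter ?mem_index_iota ?filter_uniq ?iota_uniq//=; last first.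
    by rewrite jN eq_sym ij.
  rewrite big_filter_cond big1 ?mulr1// => k /andP[ki kj]; exact: u1.
have ga : a i * a j = prD D * prD D'.
  by rewrite /a !eqxx eq_sym (negbTE ij).
rewrite -ga -[_ * _]mul1r -(prod2 a); last first.
  by move=> k ki kj; rewrite /a (negbTE ki) (negbTE kj).
apply: (@pr_le_prod _ g) => //.
- by move=> k; rewrite /g; case: (k == i); [exact: measurable_indicator|
    case: (k == j) => //; exact: measurable_indicator].
- by move=> k x; rewrite /g; case: (k == i) => //; case: (k == j).
- move=> k; rewrite /g /a; case: (k == i); first by rewrite prDE.
  case: (k == j); first by rewrite prDE.
  by rewrite integral_cst// [X in (_ * X)%E](_ : _ = 1%E) ?mule1//; exact: probability_setT.
- move=> t /= /andP[Di Dj]; rewrite mul1r (prod2 (fun k => g k (tuple_path t k))).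
    by rewrite /g !eqxx eq_sym (negbTE ij) Di Dj mulr1.
  by move=> k ki kj; rewrite /g (negbTE ki) (negbTE kj).
Qed.

Lemma pr_le_coord (j : nat) (D : R -> bool) :
  measurable_fun setT D -> (1 <= j < N.+1)%N ->
  pr_le muN [set t | D (tuple_path t j)] (prD D).
Proof.
move=> mD jN.
have -> : prD D = 1 * (if (1 <= j < N.+1)%N then prD D else 1) * 1 ^+ N.
  by rewrite jN expr1n mulr1 mul1r.
apply: (@pr_le_tilted j _ D (fun _ _ => 1)) => //.
- move=> i.
  by rewrite integral_cst// [X in (_ * X)%E](_ : _ = 1%E) ?mule1//; exact: probability_setT.
- by move=> t Dt; split=> //; rewrite big1// mulr1.
Qed.

End product_bounds.

Lemma powR_div (R : realType) (a c p : R) : 0 <= a -> 0 <= c ->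
  (a / c) `^ p = a `^ p / c `^ p.
Proof.
move=> a0 c0; rewrite powRM ?invr_ge0//; congr (_ * _).
by rewrite -(powR_inv1 c0) powRAC powR_inv1 ?powR_ge0.
Qed.

(** * Upper and lower deviations of the walk *)

Section deviations.
Context {R : realType} (F : probability R R) (p M : R) (be : nat) (x1 : R).
Hypothesis H : heavy_tail F p M be x1.
Variable C0 : R.
Hypothesis C0_gt0 : 0 < C0.
Local Notation muN N := (indep_law N (fun=> F)).

Lemma expr_le_expR (N : nat) (C : R) : 0 <= C -> (0 < N)%N ->
  (1 + C / N%:R) ^+ N <= expR C.
Proof.
move=> CN N0; have N0' : N%:R != 0 :> R by rewrite pnatr_eq0 -lt0n.
apply: (@le_trans _ _ (expR (C / N%:R) ^+ N)).
  apply: lerXn2r; rewrite ?nnegrE ?expR_ge0//; last exact: expR_ge1Dx.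
  by rewrite addr_ge0// divr_ge0// ler0n.
by rewrite -expRM_natl mulrC divfK.
Qed.

Let measurable_expM (s : R) : measurable_fun setT (fun x : R => expR (s * x)).
Proof. by apply: measurableT_comp => //; exact: measurable_funM. Qed.

(** Tilting of increments cut at [eta * c]: the factor [expR (- (th * (lam * c)))] is the power
    [lam / eta] of the mass [N tail(c)], and the exponential moments [1 + C / N] multiply to at most
    [expR C]. A small [eta] yields any power. The weights are 1 beyond time [n], so one constant
    serves all [n <= N]. *)
Lemma upper_deviation (eta : R) : 0 < eta <= 1 -> exists2 C : R, 0 < C &
  \forall c \near +oo, forall N : nat, (0 < N)%N -> N%:R <= C0 * c ->
  forall (j n : nat) (lam : R) (D : R -> bool), (n <= N)%N ->
  measurable_fun setT D ->
  pr_le (muN N)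
    [set t | [/\ (1 <= j < N.+1)%N -> D (tuple_path t j),
      (forall i, (1 <= i < N.+1)%N -> i != j -> tuple_path t i < eta * c) &
      lam * c < \sum_(1 <= i < n.+1 | i != j) tuple_path t i]]
    (C * (if (1 <= j < N.+1)%N then prD F D else 1) *
     expR (lam / eta * ln (N%:R * tail F c))).
Proof.
move=> eta01; have [C C_ge0 hC] := chernoff_uniform H C0_gt0 eta01.
have eta0 : 0 < eta by case/andP: eta01.
exists (expR C); first exact: expR_gt0.
near=> c.
have c0 : 0 < c by [].
have hCc : forall N : nat, (0 < N)%N -> N%:R <= C0 * c ->
  [/\ 0 < tilt F eta c N, N%:R * tail F c < 1 &
   (\int[F]_x (expR (tilt F eta c N * x) * (x < eta * c)%R%:R)%:E <=
      (1 + C / N%:R)%:E)%E] by near: c.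
move=> N N0 Nc j n lam D nN mD; have [th0 h1 mgf] := hCc N N0 Nc.
set th := tilt F eta c N in th0 mgf.
pose f (i : nat) (x : R) : R :=
  if (i <= n)%N then expR (th * x) * (x < eta * c)%R%:R else 1.
set K := expR (lam / eta * ln (N%:R * tail F c)).
have KE : K = expR (- (th * (lam * c))).
  congr expR; rewrite /th /tilt; field.
  by rewrite !gt_eqF.
have q1 : 1 <= 1 + C / N%:R by rewrite lerDl divr_ge0// ler0n.
set E := (X in pr_le _ X).
apply: pr_leW (@pr_le_tilted _ F N j E D f K (1 + C / N%:R) mD _ _ _ q1 (expR_ge0 _) _).
- by [].
- set G := (if _ then _ else _).
  have G0 : 0 <= G by rewrite /G; case: ifP => // _; exact: prD_ge0.
  rewrite (_ : expR C * G * K = K * G * expR C); last by ring.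
  by rewrite ler_wpM2l ?expr_le_expR// mulr_ge0// expR_ge0.
- move=> i; rewrite /f; case: (i <= n)%N => //.
  apply: measurable_funM => //.
  by apply: measurable_indicator; exact: measurable_fun_ltr.
- by move=> i x; rewrite /f; case: (i <= n)%N => //; rewrite mulr_ge0// expR_ge0.
- move=> i; rewrite /f; case: (i <= n)%N => //.
  rewrite integral_cst// [X in (_ * X)%E](_ : _ = 1%E) ?mule1; last exact: probability_setT.
  by rewrite lee_fin.
- move=> t [Dj small big]; split=> //.
  have -> : \prod_(1 <= i < N.+1 | i != j) f i (tuple_path t i) =
      \prod_(1 <= i < n.+1 | i != j) expR (th * tuple_path t i).
    rewrite (big_cat_nat _ _ (n := n.+1))//= [X in _ * X]big1_seq ?mulr1; last first.
      move=> i /andP[_]; rewrite mem_index_iota /f => /andP[ni _].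
      by rewrite leqNgt ni.
    rewrite big_nat_cond [RHS]big_nat_cond; apply: eq_bigr => i /andP[/andP[i0 ni] ij].
    rewrite /f -ltnS ni small ?mulr1//.
    by rewrite i0 ltnS; move: ni; rewrite ltnS => /leq_trans; apply.
  rewrite -expR_sum -mulr_sumr KE -expRD -[leLHS]expR0 ler_expR -mulrN -mulrDr.
  by rewrite mulr_ge0 ?(ltW th0)// addrC subr_ge0 ltW.
Unshelve. all: by end_near. Qed.

(** Either some earlier increment is below [- (c / A)], which the moment and a union bound make
    unlikely, or all of them satisfy [s x <= 1] with [s = - (A / c)] and tilting by [s] applies.
    Increment [j] is independent of the earlier ones, whence the factor [prD F D]. *)
Lemma lower_deviation (ep dl : R) : 0 < ep -> 0 < dl ->
  \forall c \near +oo, forall N : nat, N%:R <= C0 * c ->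
  forall (j : nat) (D : R -> bool), (1 <= j < N.+1)%N -> measurable_fun setT D ->
  pr_le (muN N)
    [set t | D (tuple_path t j) && (walk (tuple_path t) j.-1 < - (ep * c))]
    (dl * prD F D).
Proof.
move=> ep0 dl0.
(* With this [A], [expR (- (A * ep))] times the bound [expR 1] on the tilted moments is at most
   [dl / 2]. *)
pose A := (1 + `|ln (dl / 2)|) / ep.
have A0 : 0 < A by rewrite divr_gt0// ltr_pwDl.
have p1 : 1 < p by case/andP: (ht_p H).
have p0 : 0 < p by exact: lt_trans p1.
have M0 : 0 <= M := moment_ge0 H.
(* The first bound serves the union over large negative increments; the second keeps the exponent
   [C] of the tilted moments at most 1. *)
pose dl' := Num.min (dl / 2) 2^-1.
have dl'0 : 0 < dl' by rewrite lt_min divr_gt0//= invr_gt0.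
near=> c => N Nc j D jN mD.
have c0 : 0 < c by [].
have N0 : (0 < N)%N by case/andP: jN => j1; rewrite ltnS; exact: leq_trans.
have wsmall : N%:R * (M * (A / c) `^ p) <= dl'.
  have -> : (A / c) `^ p = A `^ p / c `^ p.
    by rewrite powR_div// ltW.
  have cp : c `^ p = c * c `^ (p - 1) by rewrite mulr_powRB1// ltW.
  apply: (@le_trans _ _ ((C0 * c) * (M * (A `^ p / c `^ p)))).
    by rewrite ler_wpM2r// mulr_ge0// divr_ge0// powR_ge0.
  rewrite cp (_ : _ * _ = C0 * M * A `^ p / c `^ (p - 1)); last first.
    by field; rewrite !gt_eqF ?powR_gt0.
  rewrite ler_pdivrMr ?powR_gt0// [leRHS]mulrC -ler_pdivrMr//.
  near: c; apply: powR_large; by rewrite subr_gt0.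
have wd : N%:R * (M * (A / c) `^ p) <= dl / 2.
  by apply: le_trans wsmall _; rewrite ge_min lexx.
have w2 : N%:R * (M * (A / c) `^ p) <= 2^-1.
  by apply: le_trans wsmall _; rewrite ge_min lexx orbT.
pose D' (x : R) := x < - (c / A).
have mD' : measurable_fun setT D' by exact: measurable_fun_ltr.
have Ac0 : 0 < c / A by rewrite divr_gt0.
have prD' : prD F D' <= M * (A / c) `^ p.
  rewrite -lee_fin /prD fineK ?fin_num_measure//; last exact: measurable_pred.
  have -> : M * (A / c) `^ p = M / (c / A) `^ p.
    rewrite (powR_div p (ltW A0) (ltW c0)) (powR_div p (ltW c0) (ltW A0)).
    by rewrite invf_div.
  have p12 : 1 <= p <= 2 by have /andP[/ltW-> ->] := ht_p H.
  apply: le_trans (markov_moment p12 (ht_moment H) Ac0).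
  apply: le_measure; rewrite ?inE//.
  - exact: measurable_pred.
  - by apply: measurable_pred; apply: measurable_fun_ler.
  - move=> x /=; rewrite /D' => xc; rewrite ltr0_norm; last by lra.
    by lra.
pose E1 := [set t : N.-tuple R | exists2 i, i \in index_iota 1 j &
  D (tuple_path t j) && D' (tuple_path t i)].
have h1 : pr_le (muN N) E1 (dl / 2 * prD F D).
  apply: pr_leW (pr_le_seq (s := index_iota 1 j)
    (E := fun i => [set t | D (tuple_path t j) && D' (tuple_path t i)])
    (u := fun=> prD F D * prD F D') _) => //.
  - rewrite sumr_const_nat -[leLHS]mulr_natl mulrCA [leRHS]mulrC.
    rewrite ler_wpM2l ?prD_ge0//; apply: le_trans wd.
    apply: ler_pM => //; rewrite ?prD_ge0// ler_nat.
    by case/andP: jN => _; rewrite ltnS; apply: leq_trans; exact: leq_subr.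
  - move=> i; rewrite mem_index_iota => /andP[i1 ij]; apply: pr_le_pair => //.
      by rewrite i1 (ltn_trans ij)//; case/andP: jN.
    by rewrite gt_eqF// ltEnat.
pose s := - (A / c).
pose E2 := [set t : N.-tuple R | [/\ D (tuple_path t j),
  (forall i, (1 <= i < j)%N -> - (c / A) <= tuple_path t i) &
  walk (tuple_path t) j.-1 < - (ep * c)]].
pose f (i : nat) (x : R) : R :=
  if (i < j)%N then expR (s * x) * (s * x <= 1)%R%:R else 1.
pose C := N%:R * (2 * (`|s| `^ p * M)).
have C_ge0 : 0 <= C by rewrite !mulr_ge0// powR_ge0.
have C1 : C <= 1.
  have -> : C = 2 * (N%:R * (M * (A / c) `^ p)).
    rewrite /C /s normrN ger0_norm; first by ring.
    by rewrite divr_ge0// ltW.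
  by lra.
have h2 : pr_le (muN N) E2 (dl / 2 * prD F D).
  have q1 : 1 <= 1 + C / N%:R by rewrite lerDl divr_ge0// ler0n.
  apply: pr_leW (@pr_le_tilted _ F N j E2 D f (expR (- (A * ep))) (1 + C / N%:R) mD _ _ _ q1 (expR_ge0 _) _) => //.
  - rewrite jN mulrAC ler_wpM2r ?prD_ge0//.
    apply: (@le_trans _ _ (expR (- (A * ep)) * expR 1)).
      rewrite ler_pM2l ?expR_gt0//; apply: le_trans (expr_le_expR C_ge0 N0) _.
      by rewrite ler_expR.
    rewrite -expRD /A divfK ?gt_eqF// opprD addrAC addNr add0r.
    have d2 : 0 < dl / 2 by rewrite divr_gt0.
    rewrite -[leRHS](lnK d2) ler_expR lerNl -normrN.
    exact: ler_norm.
  - move=> i; rewrite /f; case: (i < j)%N => //.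
    apply: measurable_funM => //.
    by apply: measurable_indicator; apply: measurable_fun_ler => //; exact: measurable_funM.
  - by move=> i x; rewrite /f; case: (i < j)%N => //; rewrite mulr_ge0// expR_ge0.
  - move=> i; rewrite /f; case: (i < j)%N.
      have p12 : 1 <= p <= 2 by have /andP[/ltW-> ->] := ht_p H.
      apply: le_trans (exp_moment_le1 p12 (ht_moment H) (ht_int H) (ht_mean H) s) _.
      rewrite lee_fin lerD2l (_ : C / N%:R = 2 * (`|s| `^ p * M))//.
      by rewrite /C mulrC mulKf// pnatr_eq0 -lt0n.
    rewrite integral_cst// [X in (_ * X)%E](_ : _ = 1%E) ?mule1; last exact: probability_setT.
    by rewrite lee_fin.
  - move=> t [Dj small dev]; split=> //.
    have -> : \prod_(1 <= i < N.+1 | i != j) f i (tuple_path t i) =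
        \prod_(1 <= i < j) expR (s * tuple_path t i).
      have jN' : (j <= N.+1)%N by case/andP: jN => _ /ltnW.
      have j1 : (1 <= j)%N by case/andP: jN.
      rewrite (big_cat_nat _ _ (n := j))//= [X in _ * X]big1_seq ?mulr1; last first.
        move=> i /andP[_]; rewrite mem_index_iota /f => /andP[ni _].
        by rewrite ltnNge ni.
      rewrite big_nat_cond [RHS]big_nat_cond; apply: eq_big => i.
        rewrite andbT; apply/andP/idP => [[]//|ij]; split=> //.
        by case/andP: ij => _; apply: contraTneq => ->; rewrite ltnn.
      move=> /andP[/andP[i0 ni] ij].
      have sm : s * tuple_path t i <= 1.
        have := small i; rewrite i0 ni => /(_ isT) le1.
        have := ler_wpM2l (ltW (divr_gt0 A0 c0)) le1.
        have -> : A / c * - (c / A) = - 1 by field; rewrite !gt_eqF.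
        by rewrite /s mulNr; lra.
      by rewrite /f ni sm mulr1.
    rewrite -expR_sum -mulr_sumr -expRD -[leLHS]expR0 ler_expR.
    move: dev; rewrite /walk prednK; last by case/andP: jN.
    set W := \sum_(1 <= i < j) _ => dev.
    have : (A / c) * W <= (A / c) * - (ep * c).
      by rewrite ler_pM2l ?divr_gt0// ltW.
    have -> : A / c * - (ep * c) = - (A * ep) by field; rewrite gt_eqF.
    by rewrite /s mulNr; lra.
apply: pr_leW (pr_leU h1 h2).
- move=> t /= /andP[Dj dev].
  have [/hasP[i ij xi]|/hasPn small] := boolP (has (fun i => D' (tuple_path t i)) (index_iota 1 j)).
    by left; exists i => //; rewrite Dj.
  right; split=> // i ij; have := small i; rewrite mem_index_iota ij => /(_ isT).
  by rewrite /D' -leNgt.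
- by lra.
Unshelve. all: by end_near. Qed.

End deviations.

Section no_crossing_without_big_jump.
Context {R : realType} (F : probability R R) (p M : R) (be : nat) (x1 : R).
Hypothesis H : heavy_tail F p M be x1.
Variable C0 : R.
Hypothesis C0_gt0 : 0 < C0.
Local Notation muN N := (indep_law N (fun=> F)).

Lemma prD_ge (a : R) : x1 <= a -> prD F (fun x => a <= x) = tail F a.
Proof.
move=> x1a; rewrite /prD (_ : [set x | _] = `[a, +oo[%classic) ?(ht_tailE H)//.
by apply/seteqP; split => x /=; rewrite in_itv/= andbT.
Qed.

Lemma prD_gt (a : R) : prD F (fun x => a < x) = tail F a.
Proof.
rewrite /prD /tail; congr (fine (F _)).
by apply/seteqP; split => x /=; rewrite in_itv/= andbT.
Qed.

Lemma prD_itv (a d : R) : a <= d ->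
  prD F (fun x => (a < x) && (x <= d)) = tail F a - tail F d.
Proof.
move=> ad; rewrite /prD /tail.
have -> : `]a, +oo[%classic = [set x | (a < x) && (x <= d)] `|` `]d, +oo[%classic.
  apply/seteqP; split => x /=; rewrite !in_itv/= !andbT.
    by move=> ax; case: (leP x d) => xd; [left; rewrite ax|right].
  by case=> [/andP[]//|]; exact: le_lt_trans.
have mD : measurable [set x : R | (a < x) && (x <= d)].
  apply: measurable_pred; apply: measurable_and.
    exact: measurable_fun_ltr.
  exact: measurable_fun_ler.
rewrite measureU//; last first.
  rewrite -subset0 => x /= [/andP[_ xd]]; rewrite in_itv/= andbT => dx.
  by rewrite leNgt dx in xd.
by rewrite fineD ?fin_num_measure// addrK.
Qed.

(** Bernoulli's inequality for [(1 - ep)^be], and [(1 - ep) (1 + ep) <= 1] for the second bound.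
    Combined with [potter_scale], moving a level by a relative [ep] changes the tail by a factor
    close to 1. *)
Lemma pow_near1 (dl : R) : 0 < dl -> exists2 ep : R, 0 < ep <= 2^-1 &
  (1 - ep) ^- be <= 1 + dl /\ 1 - dl <= (1 + ep) ^- be.
Proof.
move=> dl0; pose x := Num.min 2^-1 (dl / 2); pose ep := x / be.+1%:R.
have x0 : 0 < x by rewrite lt_min; apply/andP; split; lra.
have x2 : x <= 2^-1 by rewrite ge_min lexx.
have xd : x <= dl / 2 by rewrite ge_min lexx orbT.
have b0 : 0 < be.+1%:R :> R by rewrite ltr0n.
have ep0 : 0 < ep by rewrite divr_gt0.
have b1 : 1 <= be.+1%:R :> R by rewrite -[leLHS]/1%:R ler_nat.
have epx : ep <= x by rewrite ler_pdivrMr// ler_peMr// ltW.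
have bep : be%:R * ep <= x.
  rewrite /ep mulrCA ler_piMr ?(ltW x0)// ler_pdivrMr// mul1r ler_nat.
  exact: leqnSn.
have bern n : 1 - n%:R * ep <= (1 - ep) ^+ n.
  elim: n => [|n ih]; first by rewrite mul0r subr0 expr0.
  rewrite exprS; apply: le_trans (_ : (1 - ep) * (1 - n%:R * ep) <= _).
    have : 0 <= n%:R * ep * ep by rewrite !mulr_ge0// ?ler0n ltW.
    by rewrite -natr1; lra.
  by rewrite ler_wpM2l//; lra.
have e1 : 1 - x <= (1 - ep) ^+ be by apply: le_trans (bern be); lra.
exists ep; first by rewrite ep0; lra.
split.
  have d0 : 0 < (1 - ep) ^+ be by apply: lt_le_trans e1; lra.
  rewrite -[leLHS]mul1r ler_pdivrMr//.
  apply: (@le_trans _ _ ((1 + dl) * (1 - x))); last by rewrite ler_pM2l//; lra.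
  have : 0 <= (dl / 2 - x) by lra.
  have : 0 <= (dl / 2) * (2^-1 - x) by rewrite mulr_ge0//; lra.
  by nra.
have d0 : 0 < (1 + ep) ^+ be by rewrite exprn_gt0//; lra.
rewrite -[leRHS]mul1r ler_pdivlMr//.
have [d1|d1] := leP (1 - dl) 0.
  by apply: (@le_trans _ _ 0) => //; rewrite mulr_le0_ge0// ltW.
apply: (@le_trans _ _ ((1 - ep) ^+ be * (1 + ep) ^+ be)).
  by rewrite ler_pM2r//; lra.
rewrite -exprMn exprn_ile1//; first by nra.
by have := sqr_ge0 ep; rewrite expr2; lra.
Qed.

(* A path that crosses in the block without a jump [x_i > b + i mu] there either
   has no jump above [eta c], or two of them, or exactly one, say [x_j].  In the
   last case the other increments contribute at most [ep c], which forces [x_j]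
   into a window of relative length O(ep), unless [j <= m] and the walk is very
   low just before [j]. *)
Lemma crossing_cover (mu b ep eta c : R) (m N : nat) (x : nat -> R) :
  0 < mu -> 0 < c -> 0 < ep <= 2^-1 -> c = b + m%:R * mu ->
  (exists n, [/\ (m < n <= N)%N, b < walk x n - n%:R * mu,
     (forall j, (j <= m)%N -> walk x j - j%:R * mu <= b) &
     (forall i, (m < i <= N)%N -> x i <= b + i%:R * mu)]) ->
  [\/ (exists2 n, n \in index_iota 1 N.+1 &
        [/\ (1 <= 0 < N.+1)%N -> true,
        (forall i, (1 <= i < N.+1)%N -> i != 0%N -> x i < eta * c) &
        1 * c < \sum_(1 <= i < n.+1 | i != 0%N) x i]),
      (exists2 i, i \in index_iota 1 N.+1 & exists2 j, j \in index_iota 1 N.+1 &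
        (i != j) /\ (eta * c <= x i) && (eta * c <= x j)),
      (exists2 j, j \in index_iota 1 N.+1 & exists2 n, n \in index_iota 1 N.+1 &
        [/\ (1 <= j < N.+1)%N -> eta * c <= x j,
        (forall i, (1 <= i < N.+1)%N -> i != j -> x i < eta * c) &
        ep * c < \sum_(1 <= i < n.+1 | i != j) x i]) |
      [\/ (exists2 j, j \in index_iota m.+1 N.+1 &
            (b + j%:R * mu - ep * c < x j) && (x j <= b + j%:R * mu)),
          (exists2 j, j \in index_iota 1 m.+1 &
            ((1 - ep) * c < x j) && (x j <= (1 + ep) * c)) |
          (exists2 j, j \in index_iota 1 m.+1 &
            ((1 - ep) * c < x j) && (walk x j.-1 < - (ep * c)))]].
Proof.
move=> mu0 c0 /andP[ep0 ep2] cE [n [/andP[mn nN] cross before noA]].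
have n0 : (0 < n)%N by exact: leq_ltn_trans mn.
have nc : c + (n%:R - m%:R) * mu < walk x n by rewrite cE; lra.
have nm : 0 < (n%:R - m%:R) * mu.
  by rewrite mulr_gt0// subr_gt0 ltr_nat.
have [/hasP[j jN xj]|/hasPn nojump] :=
  boolP (has (fun i => eta * c <= x i) (index_iota 1 N.+1)); last first.
  (* Index 0 lies outside the range and stands for the absence of an exceptional increment. *)
  constructor 1; exists n; first by rewrite mem_index_iota n0 ltnS.
  split=> //.
    by move=> i iN _; rewrite ltNge; apply: nojump; rewrite mem_index_iota.
  rewrite (_ : \sum_(_ <= _ < _ | _) _ = walk x n); first by lra.
  rewrite /walk big_nat_cond [RHS]big_nat_cond; apply: eq_bigl => i.
  by case: i => [|i]; rewrite ?andbT ?andbF.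
have jN' : (1 <= j < N.+1)%N by rewrite mem_index_iota in jN.
have /andP[j1 jN1] := jN'.
have [/hasP[i iN /andP[ij xi]]|/hasPn onejump] :=
  boolP (has (fun i => (i != j) && (eta * c <= x i)) (index_iota 1 N.+1)).
  by constructor 2; exists i => //; exists j => //; split => //; rewrite xi xj.
have small i : (1 <= i < N.+1)%N -> i != j -> x i < eta * c.
  move=> iN ij; have := onejump i; rewrite mem_index_iota iN ij => /(_ isT).
  by rewrite /= -ltNge.
have [/hasP[n' n'N dev]|/hasPn nodev] :=
  boolP (has (fun n => ep * c < \sum_(1 <= i < n.+1 | i != j) x i) (index_iota 1 N.+1)).
  by constructor 3; exists j => //; exists n'.
have {}nodev n' : (1 <= n' < N.+1)%N -> \sum_(1 <= i < n'.+1 | i != j) x i <= ep * c.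
  by move=> n'N; rewrite leNgt; apply: nodev; rewrite mem_index_iota.
have epc : ep * c <= 2^-1 * c by rewrite ler_pM2r.
have nN' : (1 <= n < N.+1)%N by rewrite n0 ltnS.
(* A jump after time [n] would leave the walk at [n] at most [ep * c], short of the barrier. *)
have jn : (j <= n)%N.
  rewrite leqNgt; apply/negP => nj; have := nodev n nN'.
  rewrite (_ : \sum_(_ <= _ < _ | _) _ = walk x n); first by lra.
  rewrite /walk big_nat_cond [RHS]big_nat_cond; apply: eq_bigl => i.
  rewrite andbT; apply/andP/idP => [[]//|iN]; split=> //.
  by case/andP: iN => _ /leq_trans => /(_ _ nj) ij; rewrite ltn_eqF.
have walkn : walk x n = x j + \sum_(1 <= i < n.+1 | i != j) x i.
  by rewrite /walk (bigD1_seq j) ?mem_index_iota ?iota_uniq//= j1 ltnS.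
have xj1 : c + (n%:R - m%:R) * mu - ep * c < x j.
  by have := nodev n nN'; lra.
constructor 4.
have [mj|jm] := ltnP m j.
  constructor 1; exists j; first by rewrite mem_index_iota mj.
  rewrite noA ?mj//= andbT; apply: le_lt_trans xj1.
  have : j%:R * mu <= n%:R * mu by rewrite ler_pM2r// ler_nat.
  by rewrite cE; lra.
(* No passage at [j <= m] bounds the walk at [j] by [b + j mu <= c], so a jump above [(1 + ep) c]
   must start from below [- (ep * c)]. *)
have wj : walk x j.-1 + x j <= b + j%:R * mu.
  have := before j jm; rewrite (_ : walk x j = walk x j.-1 + x j); first by lra.
  by rewrite /walk prednK// big_nat_recr.
have jm' : j%:R * mu <= m%:R * mu by rewrite ler_pM2r// ler_nat.
have jin : j \in index_iota 1 m.+1 by rewrite mem_index_iota j1 ltnS.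
have low : (1 - ep) * c < x j by lra.
have [xle|xgt] := leP (x j) ((1 + ep) * c).
  by constructor 2; exists j => //; rewrite low xle.
constructor 3; exists j => //; rewrite low /=.
by rewrite cE in xgt *; lra.
Qed.

End no_crossing_without_big_jump.

(** * Crossing a block without a big jump in it is negligible *)

Section crossing_bound.
Context {R : realType} (F : probability R R) (p M : R) (be : nat) (x1 : R).
Hypothesis H : heavy_tail F p M be x1.
Variable C0 : R.
Hypothesis C0_gt0 : 0 < C0.
Local Notation muN N := (indep_law N (fun=> F)).

Let tail0 := ht_tail H.
Let x1_gt0 := ht_x1 H.

Lemma expR_ln_pow (h y : R) (n : nat) : 0 < h <= 1 -> n%:R <= y ->
  expR (y * ln h) <= h ^+ n.
Proof.
move=> /andP[h0 h1] ny.
rewrite -[leRHS](lnK (x := h ^+ n)) ?posrE ?exprn_gt0// ler_expR lnXn//.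
by rewrite -mulr_natl ler_wnM2r// ln_le0.
Qed.

Lemma pr_le_sum2 (N : nat) (s : seq nat) (E : nat -> nat -> set (N.-tuple R)) (u : R) :
  (forall i j, i \in s -> j \in s -> pr_le (muN N) (E i j) u) ->
  pr_le (muN N) [set t | exists2 i, i \in s & exists2 j, j \in s & E i j t]
    (((size s)%:R * (size s)%:R) * u).
Proof.
move=> h; apply: pr_leW (pr_le_seq (s := s)
    (E := fun i => [set t | exists2 j, j \in s & E i j t])
    (u := fun=> (size s)%:R * u) _) => //.
  by rewrite big_const_seq iter_addr_0 count_predT -[leLHS]mulr_natl mulrA.
move=> i is_; apply: pr_leW (pr_le_seq (s := s) (E := E i) (u := fun=> u) _) => //.
  by rewrite big_const_seq iter_addr_0 count_predT -[leLHS]mulr_natl.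
by move=> j js; exact: h.
Qed.

Lemma pr_le_sum1 (N : nat) (s : seq nat) (E : nat -> set (N.-tuple R)) (u : R) (K : nat) :
  0 <= u -> (size s <= K)%N ->
  (forall i, i \in s -> pr_le (muN N) (E i) u) ->
  pr_le (muN N) [set t | exists2 i, i \in s & E i t] (K%:R * u).
Proof.
move=> u0 sK h; apply: pr_leW (pr_le_seq (s := s) (E := E) (u := fun=> u) _) => //.
by rewrite big_const_seq iter_addr_0 count_predT -[leLHS]mulr_natl ler_wpM2r// ler_nat.
Qed.

(** A union bound over the six events of [crossing_cover]. The event with one jump and a deviation
    is summed over jump positions and times, [N^2] terms: the positions are paid for by the tail of
    the jump, the times by [J] of the powers of [h] in the deviation bound. *)
Lemma crossing_bound (dl : R) : 0 < dl -> \forall c \near +oo,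
  forall (N m : nat) (mu b : R), 0 < mu -> c = b + m%:R * mu -> 0 <= b ->
  (0 < N)%N -> (m <= N)%N -> N%:R <= C0 * c ->
  pr_le (muN N) [set t | exists n, [/\ (m < n <= N)%N,
     b < walk (tuple_path t) n - n%:R * mu,
     (forall j, (j <= m)%N -> walk (tuple_path t) j - j%:R * mu <= b) &
     (forall i, (m < i <= N)%N -> tuple_path t i <= b + i%:R * mu)]]
    (dl * (N%:R * tail F c)).
Proof.
move=> dl0.
have [J smallJ] := mass_pow_small H C0_gt0.
(* One share for each of the six events. *)
pose w := dl / 6.
have w0 : 0 < w by rewrite divr_gt0.
have w20 : 0 < w / 2 by rewrite divr_gt0.
have [ep /andP[ep0 ep2] [ep_lo ep_hi]] := pow_near1 be w20.
pose J1 := J.+1.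
have J10 : 0 < J1%:R :> R by rewrite ltr0n.
have J11 : 1 <= J1%:R :> R by rewrite -[leLHS]/1%:R ler_nat.
(* The deviation exponents become [ep / eta = J + 1] and [1 / eta >= J + 2]: after [J] powers of [h]
   have absorbed the sum over times, a small factor [h] is left to spare. *)
pose eta := ep / J1%:R.
have eta0 : 0 < eta by rewrite divr_gt0.
have etaep : eta <= ep by rewrite ler_pdivrMr// ler_peMr// ltW.
have eta01 : 0 < eta <= 1 by rewrite eta0; lra.
have [C Cpos upper] := upper_deviation H C0_gt0 eta01.
pose Ke := eta ^- be.
have Ke1 : 1 <= Ke.
  by rewrite invf_ge1 ?exprn_gt0// exprn_ile1// ?ltW//; lra.
have Ke0 : 0 < Ke by exact: lt_le_trans Ke1.
(* A common bound for [N * h ^+ J] and [h]; the denominator collects the constants of the first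
   three events. *)
pose d0 := Num.min 1 (w / (C * Ke + Ke ^+ 2)).
have den0 : 0 < C * Ke + Ke ^+ 2 by rewrite addr_gt0 ?mulr_gt0 ?exprn_gt0.
have d00 : 0 < d0 by rewrite lt_min ltr01 divr_gt0.
have d0w : (C * Ke + Ke ^+ 2) * d0 <= w.
  by rewrite -ler_pdivlMl// mulrC ge_min lexx orbT.
(* Division by [2 ^+ be] compensates [tail((1 - ep) c) <= 2^be tail(c)] in the sixth event. *)
have d1pos : 0 < w / (2 ^+ be) by rewrite divr_gt0 ?exprn_gt0.
have near_J := smallJ d0 d00.
have near_h := mass_small H C0 d00.
have near_low := lower_deviation H C0 ep0 d1pos.
have near_x1 : \forall c \near +oo, Num.max (x1 / eta) (x1 / 2^-1) <= c.
  by apply: nbhs_pinfty_ge; rewrite num_real.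
apply: filterS (filterI (filterI near_J near_h)
  (filterI (filterI near_low upper) near_x1)) => c.
case=> [[hJ hs] [[low up] cx1]] N m mu b mu0 cE b0 N0 mN Nc.
move: cx1; rewrite ge_max => /andP[cx1 cx2].
have x1eta : x1 <= eta * c by rewrite mulrC -ler_pdivrMr.
have x1h : x1 <= 2^-1 * c by rewrite mulrC -ler_pdivrMr.
have c0 : 0 < c by rewrite -(pmulr_rgt0 _ eta0) (lt_le_trans x1_gt0).
have {}hJ := hJ N Nc; have {}hs := hs N Nc.
have {}low := low N Nc; have {}up := up N N0 Nc.
set h := N%:R * tail F c.
have NR0 : 0 < N%:R :> R by rewrite ltr0n.
have h0 : 0 < h by rewrite mulr_gt0.
have h1 : h <= 1 by apply: le_trans hs _; rewrite ge_min lexx.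
have h01 : 0 < h <= 1 by rewrite h0.
have tail_eta : tail F (eta * c) <= Ke * tail F c.
  exact: (potter_scale x1_gt0 (ht_potter H) eta01 x1eta).
have ep1 : 0 < 1 - ep <= 1 by lra.
have tail_lo y : c <= y -> tail F ((1 - ep) * y) <= (1 + w / 2) * tail F y.
  move=> cy; have x1y : x1 <= (1 - ep) * y.
    apply: le_trans x1h _; apply: (@le_trans _ _ (2^-1 * y)).
      by rewrite ler_pM2l.
    by rewrite ler_pM2r; lra.
  apply: (le_trans (potter_scale x1_gt0 (ht_potter H) ep1 x1y)).
  by rewrite ler_pM2r.
have tail_hi : (1 - w / 2) * tail F c <= tail F ((1 + ep) * c).
  have a01 : 0 < (1 + ep)^-1 <= 1.
    by rewrite invr_gt0 invf_le1; lra.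
  have := potter_scale x1_gt0 (ht_potter H) (a := (1 + ep)^-1) (x := (1 + ep) * c) a01.
  rewrite mulKf; last by rewrite gt_eqF//; lra.
  rewrite exprVn invrK => /(_ _)/wrap[|tc]; first by lra.
  apply: (@le_trans _ _ ((1 + ep) ^- be * tail F c)); first by rewrite ler_pM2r.
  by rewrite ler_pdivrMl ?exprn_gt0//; lra.
have lnE1 : expR (1 / eta * ln h) <= h ^+ J.+2.
  apply: expR_ln_pow h01 _.
  rewrite mul1r /eta invf_div ler_pdivlMr//.
  have J2 : J.+2%:R = J1%:R + 1 :> R by rewrite -natr1.
  rewrite J2; apply: (@le_trans _ _ ((J1%:R + J1%:R) * 2^-1)); last by lra.
  by apply: ler_pM; lra.
have lnE2 : expR (ep / eta * ln h) <= h ^+ J1.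
  apply: expR_ln_pow h01 _.
  by rewrite /eta invf_div mulrCA mulfV ?mulr1// gt_eqF.
have U1 : pr_le (muN N) [set t | exists2 n, n \in index_iota 1 N.+1 &
        [/\ (1 <= 0 < N.+1)%N -> true,
        (forall i, (1 <= i < N.+1)%N -> i != 0%N -> tuple_path t i < eta * c) &
        1 * c < \sum_(1 <= i < n.+1 | i != 0%N) tuple_path t i]] (w * h).
  apply: pr_leW (pr_le_sum1 (s := index_iota 1 N.+1) (K := N)
    (E := fun n => [set t | [/\ (1 <= 0 < N.+1)%N -> true,
        (forall i, (1 <= i < N.+1)%N -> i != 0%N -> tuple_path t i < eta * c) &
        1 * c < \sum_(1 <= i < n.+1 | i != 0%N) tuple_path t i]])
    (u := C * h ^+ J.+2) _ _ _) => //.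
  - rewrite !exprS (_ : N%:R * _ = (C * h * (N%:R * h ^+ J)) * h); last by ring.
    rewrite ler_pM2r//; apply: le_trans d0w.
    apply: (@le_trans _ _ (C * h * d0)); first by rewrite ler_wpM2l// mulr_ge0// ltW.
    rewrite ler_pM2r//; apply: (@le_trans _ _ (C * Ke)).
      by rewrite ler_pM2l//; exact: le_trans Ke1.
    by rewrite lerDl exprn_ge0// ltW.
  - by rewrite mulr_ge0 ?exprn_ge0// ltW.
  - by rewrite size_iota subn1.
  - move=> n; rewrite mem_index_iota ltnS => /andP[n1 nN].
    apply: pr_leW (up 0%N n 1 (fun=> true) nN (measurable_cst _)) => //.
    by rewrite /= mulr1 ler_pM2l.
have U2 : pr_le (muN N) [set t | exists2 i, i \in index_iota 1 N.+1 &
        exists2 j, j \in index_iota 1 N.+1 &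
        (i != j) /\ (eta * c <= tuple_path t i) && (eta * c <= tuple_path t j)]
      (w * h).
  apply: pr_leW (pr_le_sum2 (s := index_iota 1 N.+1)
    (E := fun i j => [set t | (i != j) /\ (eta * c <= tuple_path t i) && (eta * c <= tuple_path t j)])
    (u := (Ke * tail F c) ^+ 2) _) => //.
  - rewrite size_iota subn1 /=.
    have -> : N%:R * N%:R * (Ke * tail F c) ^+ 2 = Ke ^+ 2 * h * h.
      have aux (n k t : R) : n * n * (k * t) ^+ 2 = k ^+ 2 * (n * t) * (n * t) by ring.
      exact: aux.
    rewrite ler_pM2r//; apply: le_trans d0w.
    apply: (@le_trans _ _ (Ke ^+ 2 * d0)); first by rewrite ler_pM2l ?exprn_gt0.
    by rewrite ler_pM2r// lerDr mulr_ge0// ltW.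
  - move=> i j; rewrite !mem_index_iota => iN jN.
    case: (eqVneq i j) => [->|ij].
      exists set0; split => //; first by move=> t /= [].
      by rewrite measure0 lee_fin sqr_ge0.
    apply: pr_leW (pr_le_pair F (i := i) (j := j) (D := fun x => eta * c <= x)
      (D' := fun x => eta * c <= x) _ _ iN jN ij).
    + by move=> t /= [].
    + by rewrite (prD_ge H)// expr2; apply: ler_pM; rewrite // ltW.
    + exact: measurable_fun_ler.
    + exact: measurable_fun_ler.
have U3 : pr_le (muN N) [set t | exists2 j, j \in index_iota 1 N.+1 &
        exists2 n, n \in index_iota 1 N.+1 &
        [/\ (1 <= j < N.+1)%N -> eta * c <= tuple_path t j,
        (forall i, (1 <= i < N.+1)%N -> i != j -> tuple_path t i < eta * c) &
        ep * c < \sum_(1 <= i < n.+1 | i != j) tuple_path t i]] (w * h).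
  apply: pr_leW (pr_le_sum2 (s := index_iota 1 N.+1)
    (E := fun j n => [set t | [/\ (1 <= j < N.+1)%N -> eta * c <= tuple_path t j,
        (forall i, (1 <= i < N.+1)%N -> i != j -> tuple_path t i < eta * c) &
        ep * c < \sum_(1 <= i < n.+1 | i != j) tuple_path t i]])
    (u := C * (Ke * tail F c) * h ^+ J1) _) => //.
  - rewrite size_iota subn1 /= /J1 exprS.
    have -> : N%:R * N%:R * (C * (Ke * tail F c) * (h * h ^+ J)) =
        (C * Ke * (N%:R * h ^+ J)) * h * h.
      have aux (n k t a q : R) : n * n * (a * (k * t) * (n * t * q)) =
        (a * k * (n * q)) * (n * t) * (n * t) by ring.
      exact: aux.
    rewrite ler_pM2r//; apply: (@le_trans _ _ (C * Ke * d0)).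
      rewrite -[leRHS]mulr1; apply: ler_pM => //.
      - by rewrite !mulr_ge0// ?exprn_ge0// ltW.
      - exact: ltW.
      - by rewrite ler_pM2l ?mulr_gt0.
    by apply: le_trans d0w; rewrite ler_pM2r// lerDl exprn_ge0// ltW.
  - move=> j n; rewrite !mem_index_iota ltnS => jN; rewrite ltnS => /andP[n1 nN].
    have me : measurable_fun setT (fun x : R => eta * c <= x) by exact: measurable_fun_ler.
    apply: pr_leW (up j n ep (fun x => eta * c <= x) nN me) => //.
    rewrite ltnS jN (prD_ge H)//; apply: ler_pM; rewrite ?expR_ge0//.
      by rewrite mulr_ge0// ltW.
    by rewrite ler_pM2l.
have U4 : pr_le (muN N) [set t | exists2 j, j \in index_iota m.+1 N.+1 &
    (b + j%:R * mu - ep * c < tuple_path t j) && (tuple_path t j <= b + j%:R * mu)] (w * h).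
  apply: pr_leW (pr_le_sum1 (s := index_iota m.+1 N.+1) (K := N)
    (E := fun j => [set t | (b + j%:R * mu - ep * c < tuple_path t j) && (tuple_path t j <= b + j%:R * mu)])
    (u := w * tail F c) _ _ _) => //.
  - by rewrite /h; lra.
  - by rewrite mulr_ge0// ltW.
  - by rewrite size_iota subSS leq_subr.
  - move=> j; rewrite mem_index_iota => /andP[mj jN].
    set y := b + j%:R * mu.
    have cy : c <= y by rewrite cE lerD2l ler_pM2r// ler_nat ltnW.
    have epc : 0 <= ep * c by rewrite mulr_ge0// ltW.
    have md : measurable_fun setT (fun x : R => (y - ep * c < x) && (x <= y)).
      apply: measurable_and; first exact: measurable_fun_ltr.
      exact: measurable_fun_ler.
    apply: pr_leW (pr_le_coord F md (N := N) (j := j) _) => //; last first.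
      by rewrite jN (leq_ltn_trans _ mj).
    rewrite prD_itv; last by lra.
    (* Since [c <= y], the window of width [ep * c] below [y] lies in [((1 - ep) y, y]], whose mass
       is at most [w / 2 * tail F y]. *)
    have l1 : tail F (y - ep * c) <= tail F ((1 - ep) * y).
      apply: tail_noninc.
      have : ep * c <= ep * y by rewrite ler_pM2l.
      by lra.
    have l2 := tail_lo y cy.
    have l3 : tail F y <= tail F c by exact: tail_noninc.
    have : w / 2 * tail F y <= w / 2 * tail F c by rewrite ler_pM2l.
    have := tail0 c; have : 0 <= w * tail F c by rewrite mulr_ge0// ltW.
    by lra.
have U5 : pr_le (muN N) [set t | exists2 j, j \in index_iota 1 m.+1 &
    ((1 - ep) * c < tuple_path t j) && (tuple_path t j <= (1 + ep) * c)] (w * h).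
  apply: pr_leW (pr_le_sum1 (s := index_iota 1 m.+1) (K := N)
    (E := fun j => [set t | ((1 - ep) * c < tuple_path t j) && (tuple_path t j <= (1 + ep) * c)])
    (u := w * tail F c) _ _ _) => //.
  - by rewrite /h; lra.
  - by rewrite mulr_ge0// ltW.
  - by rewrite size_iota subn1.
  - move=> j; rewrite mem_index_iota ltnS => /andP[j1 jm].
    have md : measurable_fun setT (fun x : R => ((1 - ep) * c < x) && (x <= (1 + ep) * c)).
      apply: measurable_and; first exact: measurable_fun_ltr.
      exact: measurable_fun_ler.
    apply: pr_leW (pr_le_coord F md (N := N) (j := j) _) => //; last first.
      by rewrite j1 ltnS (leq_trans jm).
    rewrite prD_itv; last by rewrite ler_pM2r//; lra.
    by have := tail_lo c (lexx _); lra.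
have U6 : pr_le (muN N) [set t | exists2 j, j \in index_iota 1 m.+1 &
    ((1 - ep) * c < tuple_path t j) && (walk (tuple_path t) j.-1 < - (ep * c))] (w * h).
  apply: pr_leW (pr_le_sum1 (s := index_iota 1 m.+1) (K := N)
    (E := fun j => [set t | ((1 - ep) * c < tuple_path t j) && (walk (tuple_path t) j.-1 < - (ep * c))])
    (u := w * tail F c) _ _ _) => //.
  - by rewrite /h; lra.
  - by rewrite mulr_ge0// ltW.
  - by rewrite size_iota subn1.
  - move=> j; rewrite mem_index_iota ltnS => /andP[j1 jm].
    have jN : (1 <= j < N.+1)%N by rewrite j1 ltnS (leq_trans jm).
    have md : measurable_fun setT (fun x : R => (1 - ep) * c < x) by exact: measurable_fun_ltr.
    apply: pr_leW (low j _ jN md) => //.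
    have a01 : 0 < (2^-1 : R) <= 1.
      by apply/andP; split; lra.
    have key : tail F ((1 - ep) * c) <= 2 ^+ be * tail F c.
      have := potter_scale x1_gt0 (ht_potter H) a01 x1h; rewrite exprVn invrK.
      apply: le_trans; apply: tail_noninc.
      by rewrite ler_pM2r//; lra.
    rewrite prD_gt; apply: le_trans (ler_wpM2l (ltW d1pos) key) _.
    by rewrite mulrA divfK// gt_eqF// exprn_gt0.
have := pr_leU (pr_leU U1 U2) (pr_leU (pr_leU U3 U4) (pr_leU U5 U6)).
apply: pr_leW; last by rewrite /w; lra.
have ep02 : 0 < ep <= 2^-1 by rewrite ep0.
move=> t /(crossing_cover eta mu0 c0 ep02 cE)[u1|u2|u3|[u4|u5|u6]].
- by left; left.
- by left; right.
- by right; left; left.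
- by right; left; right.
- by right; right; left.
- by right; right; right.
Qed.

End crossing_bound.

(** * The integrated tail and the lower bound on the hitting probability *)

Section integrated_tail.
Context {R : realType} (F : probability R R).
Local Notation leb := (@lebesgue_measure R).

(** Tonelli: both sides are the measure of the pairs with [a <= u < x]. The right-hand form reduces
    inequalities between integrated tails to pointwise ones. *)
Lemma integral_tail (a : R) :
  (\int[leb]_(u in `[a, +oo[%classic) (tail F u)%:E =
   \int[F]_x (Num.max (x - a) 0)%:E)%E.
Proof.
pose f (z : R * R) : \bar R := (((a <= z.1) && (z.1 < z.2))%R%:R : R)%:E.
have mf : measurable_fun setT f.
  apply/measurable_EFinP; apply: measurable_indicator; apply: measurable_and.
    exact: measurable_fun_ler.
  exact: measurable_fun_ltr.
have f0 z : (0 <= f z)%E by rewrite lee_fin.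
transitivity (\int[leb]_u \int[F]_x f (u, x))%E.
  rewrite integral_mkcond; apply: eq_integral => u _.
  rewrite patchE mem_setE in_itv/= andbT /f /=; case: (leP a u) => au /=; last first.
    by rewrite integral0.
  rewrite integral_bool; last exact: measurable_fun_ltr.
  rewrite /tail fineK ?fin_num_measure//; congr (F _).
  by apply/seteqP; split => x /=; rewrite in_itv/= andbT.
rewrite (fubini_tonelli (m1 := leb) (m2 := F) f)//.
apply: eq_integral => x _.
transitivity (\int[leb]_u (\1_(`[a, x[%classic) u : R)%:E)%E.
  by apply: eq_integral => u _; rewrite /f /= indicE mem_setE in_itv.
rewrite integral_indic//= setIT.
rewrite lebesgue_measure_itv/= lte_fin; case: ltP => ax.
  by rewrite -EFinD max_l// subr_ge0 ltW.
by rewrite max_r// subr_le0.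
Qed.

Variables (p M : R).
Hypothesis p12 : 1 < p <= 2.
Hypothesis F_moment : (\int[F]_x (`|x| `^ p)%:E <= M%:E)%E.

Local Notation G := (integrated_tail F).

Let mplus (a : R) : measurable_fun setT (fun x : R => (Num.max (x - a) 0)%:E).
Proof.
apply/measurable_EFinP; apply: measurable_maxr => //.
exact: measurable_funB.
Qed.

Let plus0 (a x : R) : (0 <= (Num.max (x - a) 0)%:E)%E.
Proof. by rewrite lee_fin le_max lexx orbT. Qed.

Lemma integral_plus_le (a : R) : 0 < a ->
  (\int[F]_x (Num.max (x - a) 0)%:E <= (M / a `^ (p - 1))%:E)%E.
Proof.
move=> a0; have /andP[p1 _] := p12.
have q0 : 0 < p - 1 by rewrite subr_gt0.
have aq : 0 < a `^ (p - 1) by rewrite powR_gt0.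
have mabs : measurable_fun setT (fun x : R => (`|x| `^ p)%:E).
  apply/measurable_EFinP.
  by apply: (measurableT_comp (f := fun x : R => x `^ p)).
rewrite EFinM lee_pdivlMr// muleC -ge0_integralZl//; last by rewrite lee_fin ltW.
apply: le_trans F_moment; apply: ge0_le_integral => //.
- by move=> x _; rewrite mule_ge0// lee_fin ltW.
- exact: emeasurable_funM.
- move=> x _; rewrite -EFinM lee_fin; have [xa|ax] := leP (x - a) 0.
    by rewrite mulr0 powR_ge0.
  have x0 : 0 < x by lra.
  have -> : `|x| `^ p = x * x `^ (p - 1).
    by rewrite gtr0_norm// mulr_powRB1 ?(ltW x0)// (lt_trans ltr01).
  rewrite mulrC; apply: ler_pM; rewrite ?powR_ge0//; [by lra|by lra|].
  by apply: ge0_ler_powR; rewrite ?nnegrE; lra.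
Qed.

(** The moment bound makes the integral finite, so that the real-valued integral does not fall back
    on its default value. *)
Lemma integrated_tailE (a : R) : 0 < a ->
  (G a)%:E = (\int[F]_x (Num.max (x - a) 0)%:E)%E.
Proof.
move=> a0; rewrite /integrated_tail /Rintegral integral_tail fineK//.
rewrite ge0_fin_numE; last by apply: integral_ge0.
exact: le_lt_trans (integral_plus_le a0) (ltry _).
Qed.

Lemma integrated_tail_ge0 (a : R) : 0 < a -> 0 <= G a.
Proof. by move=> a0; rewrite -lee_fin integrated_tailE// integral_ge0. Qed.

Lemma integrated_tail_le (a : R) : 0 < a -> G a <= M / a `^ (p - 1).
Proof. by move=> a0; rewrite -lee_fin integrated_tailE// integral_plus_le. Qed.

Lemma integrated_tail_diff (a d : R) : 0 < a -> a <= d ->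
  (d - a) * tail F d <= G a - G d <= (d - a) * tail F a.
Proof.
move=> a0 ad; have d0 : 0 < d by exact: lt_le_trans ad.
have da0 : 0 <= d - a by rewrite subr_ge0.
have tE (y : R) : (((d - a) * tail F y)%:E =
    \int[F]_x ((d - a) * (y < x)%R%:R)%:E)%E.
  under eq_integral do rewrite EFinM.
  rewrite ge0_integralZl//.
  - rewrite integral_bool ?EFinM; last exact: measurable_fun_ltr.
    rewrite /tail fineK ?fin_num_measure//; congr (_ * F _)%E.
    by apply/seteqP; split => x /=; rewrite in_itv/= andbT.
  - by apply/measurable_EFinP; apply: measurable_indicator; exact: measurable_fun_ltr.
have mt (y : R) : measurable_fun setT (fun x : R => ((d - a) * (y < x)%R%:R)%:E).
  apply/measurable_EFinP; apply: measurable_funM => //.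
  by apply: measurable_indicator; exact: measurable_fun_ltr.
have t0 (y x : R) : (0 <= ((d - a) * (y < x)%R%:R)%:E)%E.
  by rewrite lee_fin mulr_ge0.
rewrite lerBrDr lerBlDr -!lee_fin !EFinD !integrated_tailE// !tE.
rewrite -!ge0_integralD//; apply/andP; split; apply: ge0_le_integral => //.
- by move=> x _; rewrite adde_ge0.
- exact: emeasurable_funD.
- move=> x _; rewrite -EFinD lee_fin; case: (ltP d x) => dx /=.
    by rewrite mulr1 !max_l; lra.
  by rewrite mulr0 add0r [leLHS]max_r ?le_max ?lexx ?orbT//; lra.
- exact: emeasurable_funD.
- move=> x _; rewrite -EFinD lee_fin; case: (ltP a x) => ax /=.
    rewrite mulr1 max_l; last by lra.
    by case: (leP (x - d) 0); lra.
  by rewrite mulr0 add0r [leLHS]max_r ?le_max ?lexx ?orbT//; lra.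
Qed.

End integrated_tail.

(** * Lower bound on the hitting probability by a single big jump *)

Section lower_bound.
Context {R : realType} d (T : measurableType d) (P : probability T R).
Variables (X : nat -> {RV P >-> R}) (F : probability R R) (mu : R).
Hypothesis X_indep : mutually_independent X.
Hypothesis X_law : forall i (A : set R), measurable A ->
  distribution P (X i) A = F A.
Hypothesis mu_gt0 : 0 < mu.
Variables (p M : R) (be : nat) (x1 : R).
Hypothesis H : heavy_tail F p M be x1.

Local Notation G := (integrated_tail F).
Local Notation muN N := (indep_law N (fun=> F)).
Let tail0 := ht_tail H.
Let x1_gt0 := ht_x1 H.
Let Gdiff := integrated_tail_diff (ht_p H) (ht_moment H).

(** An explicit threshold lets one property be used at many levels at once, such as all
    [b + n mu]. *)
Lemma near_pinfty_ex (Q : R -> Prop) : (\forall c \near +oo, Q c) ->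
  exists2 c0, 0 < c0 & forall c, c0 <= c -> Q c.
Proof.
case=> c0 [_ h]; exists (`|c0| + 1); first by rewrite ltr_wpDl.
by move=> c hc; apply: h; apply: lt_le_trans hc; rewrite ltr_pwDr// ler_norm.
Qed.

(** Comparison of sum and integral. On a block it gives [qk <= pk * G b / mu], with the sharp
    constant that the leading term of the second moment needs. *)
Lemma sum_tail_le (b : R) (m n : nat) : 0 < b -> (m <= n)%N ->
  mu * \sum_(m.+1 <= i < n.+1) tail F (b + i%:R * mu) <=
  G (b + m%:R * mu) - G (b + n%:R * mu).
Proof.
move=> b0 mn; rewrite mulr_sumr big_add1 /= -[leRHS]opprB.
rewrite -(telescope_sumr (fun i => G (b + i%:R * mu)) mn) -sumrN.
apply: ler_sum_nat => i _; rewrite opprB.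
have xi : 0 < b + i%:R * mu by rewrite ltr_wpDr// mulr_ge0// ltW.
have xi1 : b + i%:R * mu <= b + i.+1%:R * mu by rewrite lerD2l ler_pM2r// ler_nat.
have /andP[+ _] := Gdiff xi xi1.
have -> : b + i.+1%:R * mu - (b + i%:R * mu) = mu by rewrite -natr1; ring.
by [].
Qed.

Lemma sum_tail_ge (b : R) (n : nat) : 0 < b ->
  G (b + mu) - G (b + n.+1%:R * mu) <=
  mu * \sum_(1 <= i < n.+1) tail F (b + i%:R * mu).
Proof.
move=> b0; rewrite mulr_sumr -[leLHS]opprB.
rewrite (_ : b + mu = b + 1%:R * mu); last by rewrite mul1r.
rewrite -(telescope_sumr (fun i => G (b + i%:R * mu)) (ltn0Sn n)) -sumrN.
apply: ler_sum_nat => i _; rewrite opprB.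
have xi : 0 < b + i%:R * mu by rewrite ltr_wpDr// mulr_ge0// ltW.
have xi1 : b + i%:R * mu <= b + i.+1%:R * mu by rewrite lerD2l ler_pM2r// ler_nat.
have /andP[_] := Gdiff xi xi1.
have -> : b + i.+1%:R * mu - (b + i%:R * mu) = mu by rewrite -natr1; ring.
by [].
Qed.

(** [G b] is at least the integral over [[b, 2 b]], hence at least [b tail(2 b)]. It makes
    [mu tail(b)] negligible against [G b]. *)
Lemma integrated_tail_ge_tail (b : R) : x1 <= b ->
  b * tail F b <= 2 ^+ be * G b.
Proof.
move=> x1b; have b0 : 0 < b by exact: lt_le_trans x1b.
have bb : b <= 2 * b by lra.
have /andP[g1 _] := Gdiff b0 bb.
have g2 : 0 <= G (2 * b).
  by apply: (integrated_tail_ge0 (ht_p H) (ht_moment H)); rewrite mulr_gt0.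
have := ht_potter H x1b bb; rewrite exprMn -mulrA mulrCA ler_pM2l ?exprn_gt0// => pt.
apply: (@le_trans _ _ (b * (2 ^+ be * tail F (2 * b)))); first by rewrite ler_pM2l.
rewrite mulrCA ler_pM2l ?exprn_gt0//.
by move: g1; rewrite (_ : 2 * b - b = b); [lra|ring].
Qed.

Lemma integrated_tail_gt0 (b : R) : x1 <= b -> 0 < G b.
Proof.
move=> x1b; rewrite -(pmulr_rgt0 _ (exprn_gt0 be (ltr0Sn R 1))).
apply: lt_le_trans (integrated_tail_ge_tail x1b).
by rewrite mulr_gt0// (lt_le_trans _ x1b).
Qed.

Lemma integrated_tail_small (e : R) : 0 < e -> \forall c \near +oo, G c <= e.
Proof.
move=> e0; have p1 : 0 < p - 1 by rewrite subr_gt0; case/andP: (ht_p H).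
apply: filterS (filterI (powR_large (M / e) p1) (nbhs_pinfty_gt (num_real 0))).
move=> c [hc c0].
apply: le_trans (integrated_tail_le (ht_p H) (ht_moment H) c0) _.
by rewrite ler_pdivrMr ?powR_gt0// mulrC -ler_pdivrMr.
Qed.

Lemma measurable_hit b : measurable [set w | tau mu b (X ^~ w) != None].
Proof.
rewrite (_ : [set w | _] = \bigcup_t [set w | tau mu b (X ^~ w) == Some t]).
  apply: bigcup_measurable => t _; apply: measurable_pred.
  by apply: measurable_tau_Some => i; exact: measurable_funP.
apply/seteqP; split => w /=; last by case=> t _ /= /eqP ->.
by case E : (tau _ _ _) => [t|//] _; exists t; rewrite //= E.
Qed.

Section single_jump.
Variables (b ep : R).
Hypotheses (b_gt0 : 0 < b) (ep_gt0 : 0 < ep).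
Let x_ (n : nat) := b + n%:R * mu.
Let a_ (n : nat) := (1 + ep) * x_ n.

(* The first increment above the slightly inflated level [a_], provided the walk
   is not too low just before: these events are disjoint in [n] and each of them
   forces the walk above the barrier. *)
Definition single_jump (n : nat) (x : nat -> R) : bool :=
  [&& a_ n < x n, - (ep * x_ n) <= walk x n.-1 &
      all (fun m => x m <= a_ m) (index_iota 1 n)].

Lemma measurable_single_jump d' (U : measurableType d') (x : U -> nat -> R) n :
  (forall i, measurable_fun setT (x ^~ i)) ->
  measurable_fun setT (fun u => single_jump n (x u)).
Proof.
move=> mx; apply: measurable_and; first exact: measurable_fun_ltr.
apply: measurable_and.
  by apply: measurable_fun_ler => //; exact: measurable_walk.
by apply: measurable_all => i; exact: measurable_fun_ler.
Qed.

Lemma path_of_tuple n w i : (1 <= i < n.+1)%N ->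
  tuple_path [tuple X j.+1 w | j < n] i = X i w.
Proof.
case: i => // i; rewrite ltnS /= => lin.
by have := @tuple_path_tnth R n [tuple X j.+1 w | j < n] i lin; rewrite tnth_mktuple.
Qed.

Lemma single_jump_prob n : (0 < n)%N ->
  P [set w | single_jump n (X ^~ w)] =
  muN n [set t | single_jump n (tuple_path t)].
Proof.
move=> n0; rewrite -(distribution_indep X_indep X_law); last first.
  apply: measurable_pred; apply: measurable_single_jump => i.
  exact: measurable_tuple_path.
congr (P _); apply/seteqP; split => w /=; rewrite /single_jump;
  rewrite path_of_tuple ?n0 ?ltnSn//;
  (rewrite (_ : all _ _ = all (fun m => X m w <= a_ m) (index_iota 1 n));
   last by apply: eq_in_all => i; rewrite mem_index_iota => /andP[i1 ilt];
   rewrite path_of_tuple// i1 ltnS ltnW//);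
  rewrite (_ : walk (tuple_path _) _ = walk (X ^~ w) n.-1)//;
  apply: (@eq_walk _ _ _ n.-1) => // i ile i0; rewrite path_of_tuple// i0/=;
  by rewrite ltnS (leq_trans ile)// leq_pred.
Qed.

Lemma single_jump_hit : (\sum_(n <oo) P [set w | single_jump n.+1 (X ^~ w)] <=
  P [set w | tau mu b (X ^~ w) != None])%E.
Proof.
rewrite (_ : (\sum_(n <oo) _ = P (\bigcup_n [set w | single_jump n.+1 (X ^~ w)]))%E);
  last first.
  rewrite measure_bigcup//.
  - by apply: eq_eseriesl => n; rewrite in_setT.
  - move=> n _; apply: measurable_pred; apply: measurable_single_jump => i.
    exact: measurable_funP.
  - move=> i j _ _ [w [/= /and3P[ai _ /allP hi] /and3P[aj _ /allP hj]]].
    apply/eqP; rewrite eqn_leq; apply/andP; split; rewrite leqNgt; apply/negP => ij.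
      have := hi j.+1; rewrite mem_index_iota /= ltnS ij => /(_ isT).
      by rewrite leNgt aj.
    have := hj i.+1; rewrite mem_index_iota /= ltnS ij => /(_ isT).
    by rewrite leNgt ai.
have mtau := measurable_hit b.
apply: le_measure; rewrite ?inE//.
  apply: bigcup_measurable => n _; apply: measurable_pred.
  by apply: measurable_single_jump => i; exact: measurable_funP.
move=> w [n _ /= /and3P[an wn _]].
have : b < walk (X ^~ w) n.+1 - n.+1%:R * mu.
  rewrite /walk big_nat_recr//= -/(walk (X ^~ w) n).
  by move: an wn; rewrite /a_ /x_ /=; lra.
by case/tau_exists => t ->.
Qed.

(** A jump above [a_ n] at time [n] fails to be a [single_jump] only if the walk before it is too
    low or an earlier increment exceeds its own level. Both depend on earlier increments only, so
    they remove fractions at most [w] and [S] of the probability of the jump. *)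
Lemma single_jump_ge (w S : R) n : (0 < n)%N ->
  (forall (j : nat) (D : R -> bool), (1 <= j < n.+1)%N -> measurable_fun setT D ->
  pr_le (muN n)
    [set t | D (tuple_path t j) && (walk (tuple_path t) j.-1 < - (ep * x_ n))]
    (w * prD F D)) ->
  \sum_(1 <= m < n) tail F (a_ m) <= S ->
  (((1 - w - S) * tail F (a_ n))%:E <= P [set w | single_jump n (X ^~ w)])%E.
Proof.
move=> n0 dev SS; rewrite single_jump_prob//.
set A := [set t | single_jump n (tuple_path t)].
have mA : measurable A.
  by apply: measurable_pred; apply: measurable_single_jump => i; exact: measurable_tuple_path.
have Afin : muN n A \is a fin_num by exact: fin_num_measure.
have nn : (1 <= n < n.+1)%N by rewrite n0 ltnSn.
have md (y : R) : measurable_fun setT (fun x : R => y < x) by exact: measurable_fun_ltr.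
have hA : pr_le (muN n) A (fine (muN n A)).
  by exists A; split => //; rewrite fineK.
have hdev := dev n (fun x => a_ n < x) nn (md _).
have hpair : pr_le (muN n) [set t | exists2 m, m \in index_iota 1 n &
    (a_ m < tuple_path t m) && (a_ n < tuple_path t n)]
    (\sum_(m <- index_iota 1 n) tail F (a_ m) * tail F (a_ n)).
  apply: (pr_le_seq (s := index_iota 1 n) (E := fun m => [set t |
    (a_ m < tuple_path t m) && (a_ n < tuple_path t n)])
    (u := fun m => tail F (a_ m) * tail F (a_ n))) => m.
  rewrite mem_index_iota => /andP[m1 mn].
  have mN : (1 <= m < n.+1)%N by rewrite m1 ltnS ltnW.
  have mneq : m != n by rewrite ltn_eqF.
  by have := pr_le_pair F (md (a_ m)) (md (a_ n)) mN nn mneq; rewrite !prD_gt.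
have := pr_leU hA (pr_leU hdev hpair).
set V := (X in pr_le _ X) => hV.
have : (muN n [set t | (a_ n < tuple_path t n)%R] <=
    (fine (muN n A) + (w * prD F (fun x => (a_ n < x)%R) +
     \sum_(m <- index_iota 1 n) tail F (a_ m) * tail F (a_ n)))%:E)%E.
  apply: pr_leP.
    apply: measurable_pred; apply: measurable_fun_ltr => //.
    exact: measurable_tuple_path.
  apply: pr_leW hV => // t /= an.
  case: (boolP (single_jump n (tuple_path t))) => [|/nandP[|/nandP[|]]]; first by left.
  - by rewrite an.
  - by rewrite -ltNge => wlt; right; left; rewrite /= an.
  - rewrite -has_predC => /hasP[m mn /=]; rewrite -ltNge => am.
    by right; right; exists m => //; rewrite am an.
have -> : muN n [set t | a_ n < tuple_path t n] = (tail F (a_ n))%:E.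
  rewrite -(distribution_indep X_indep X_law); last first.
    apply: measurable_pred; apply: measurable_fun_ltr => //.
    exact: measurable_tuple_path.
  rewrite /tail fineK ?fin_num_measure// -(X_law n)//.
  congr (P _); apply/seteqP; split => u /=; rewrite path_of_tuple//;
    by rewrite in_itv/= andbT.
rewrite lee_fin prD_gt -mulr_suml => le1.
rewrite -(fineK Afin) lee_fin.
have : (\sum_(1 <= m < n) tail F (a_ m)) * tail F (a_ n) <= S * tail F (a_ n).
  by rewrite ler_pM2r.
by lra.
Qed.

End single_jump.

Lemma hit_lower (dl : R) : 0 < dl < 1 -> \forall b \near +oo,
  (((1 - dl) * (G b / mu))%:E <= P [set w | tau mu b (X ^~ w) != None])%E.
Proof.
(* Five relative losses of [w]: two in [single_jump_ge], one in raising the level by the factor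
   [1 + ep], one in passing from [b] to [b + mu], one in cutting the series at [N]. *)
move=> /andP[dl0 dl1]; pose w := dl / 5.
have w0 : 0 < w by rewrite divr_gt0.
have [ep /andP[ep0 ep2] [_ ep_hi]] := pow_near1 be w0.
(* The ratio [mu^-1] is admissible because [n <= (b + n mu) / mu]. *)
have [c0 c00 dev] := near_pinfty_ex (lower_deviation H mu^-1 ep0 w0).
have [c1 c10 Gsmall] := near_pinfty_ex (integrated_tail_small (mulr_gt0 w0 mu_gt0)).
have thr : \forall b \near +oo,
    Num.max (Num.max c0 c1) (Num.max x1 (mu * 2 ^+ be / w)) <= b.
  by apply: nbhs_pinfty_ge; rewrite num_real.
apply: filterS thr => b; rewrite !ge_max => /andP[/andP[bc0 bc1] /andP[bx1 bmu]].
have b0 : 0 < b by exact: lt_le_trans bc0.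
have Gb0 := integrated_tail_gt0 bx1.
have hit0 := single_jump_hit b ep; apply: le_trans hit0.
pose x_ (n : nat) := b + n%:R * mu.
have bx n : b <= x_ n by rewrite lerDl mulr_ge0// ltW.
have x0 n : 0 < x_ n by exact: lt_le_trans (bx n).
have tail_a n : (1 - w) * tail F (x_ n) <= tail F ((1 + ep) * x_ n) <= tail F (x_ n).
  apply/andP; split; last first.
    by apply: tail_noninc; rewrite ler_peMl ?(ltW (x0 n))// lerDl ltW.
  have a01 : 0 < (1 + ep)^-1 <= 1.
    by rewrite invr_gt0 invf_le1; lra.
  have e0 : 1 + ep != 0 by rewrite gt_eqF//; lra.
  have xx : x1 <= (1 + ep)^-1 * ((1 + ep) * x_ n).
    by rewrite mulKf//; exact: le_trans bx1 (bx n).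
  have := potter_scale x1_gt0 (ht_potter H) a01 xx.
  rewrite mulKf// exprVn invrK => tc.
  apply: (@le_trans _ _ ((1 + ep) ^- be * tail F (x_ n))); first by rewrite ler_pM2r.
  by rewrite ler_pdivrMl ?exprn_gt0//; lra.
have each n : (((1 - w - w) * tail F ((1 + ep) * x_ n.+1))%R%:E <=
    P [set u | single_jump b ep n.+1 (X ^~ u)])%E.
  apply: single_jump_ge => //.
    move=> j D jn mD; apply: dev => //; first exact: le_trans bc0 (bx _).
    by rewrite ler_pdivlMl// mulrC lerDr ltW.
  apply: (@le_trans _ _ (\sum_(1 <= i < n.+1) tail F (b + i%:R * mu))).
    by apply: ler_sum => i _; case/andP: (tail_a i).
  rewrite -(ler_pM2l mu_gt0); apply: le_trans (sum_tail_le b0 (leq0n n)) _.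
  rewrite mul0r addr0 [leRHS]mulrC; apply: le_trans (Gsmall _ bc1).
  rewrite gerBl; apply: (integrated_tail_ge0 (ht_p H) (ht_moment H)).
  exact: x0.
have [N GN] : exists N : nat, G (x_ N.+1) <= w * G b.
  have [c2 c20 h] := near_pinfty_ex (integrated_tail_small (mulr_gt0 w0 Gb0)).
  exists (Num.bound (c2 / mu)); apply: h.
  have := archi_boundP (ltW (divr_gt0 c20 mu_gt0)).
  rewrite ltr_pdivrMr// => /ltW c2N; rewrite /x_ -natr1.
  by have m0 := mu_gt0; apply: le_trans c2N _; lra.
have Gmu : (1 - w) * G b <= G (b + mu).
  have bm : b <= b + mu by rewrite lerDl ltW.
  have /andP[_] := Gdiff b0 bm; rewrite addrAC subrr add0r => g1.
  have g2 := integrated_tail_ge_tail bx1.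
  have g3 : mu * tail F b <= w * G b.
    rewrite -(ler_pM2l b0) mulrCA; apply: (@le_trans _ _ (mu * (2 ^+ be * G b))).
      by rewrite ler_pM2l.
    rewrite mulrA [leRHS]mulrA ler_pM2r//.
    by rewrite -ler_pdivrMr.
  by lra.
apply: le_trans (nneseries_lim_ge N _) => //.
apply: (@le_trans _ _ (\sum_(0 <= n < N) ((1 - w - w) * tail F ((1 + ep) * x_ n.+1))%:E)%E); last first.
  by apply: lee_sum => n _; exact: each.
rewrite sumEFin lee_fin -mulr_sumr.
have s1 := sum_tail_ge N b0.
rewrite big_add1/= in s1.
have s2 : (1 - w) * \sum_(0 <= n < N) tail F (x_ n.+1) <=
    \sum_(0 <= n < N) tail F ((1 + ep) * x_ n.+1).
  by rewrite mulr_sumr; apply: ler_sum => n _; case/andP: (tail_a n.+1).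
set S1 := \sum_(_ <= _ < _) tail F (x_ _) in s2.
set S2 := \sum_(_ <= _ < _) _ in s2 *.
have w5 : w * 5 = dl by rewrite /w divfK.
have s3 : (1 - w - w) * (G b / mu) <= S1.
  rewrite mulrA ler_pdivrMr// mulrC [leRHS]mulrC.
  apply: le_trans s1; rewrite -/(x_ N.+1) mulrC; lra.
have w1 : w < 1 / 5 by lra.
apply: (@le_trans _ _ ((1 - w - w) * ((1 - w) * ((1 - w - w) * (G b / mu))))); last first.
  apply: (@le_trans _ _ ((1 - w - w) * ((1 - w) * S1))).
    by rewrite ler_pM2l ?ler_pM2l//; lra.
  by rewrite ler_pM2l//; lra.
have g0 : 0 <= G b / mu by rewrite divr_ge0// ltW.
rewrite !mulrA ler_wpM2r ?invr_ge0 ?(ltW mu_gt0)// ler_wpM2r// ?(ltW Gb0)//.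
have ww : 0 <= w * w by rewrite mulr_ge0// ltW.
have www : w * w * w <= w * w * (1 / 5) by rewrite ler_wpM2l// ltW.
by nra.
Qed.

End lower_bound.

(** * Regular variation of the tail *)

Section regularly_varying_tail.
Context {R : realType} (F : probability R R) (alpha : R) (L : R -> R).
Hypothesis L_slow : slowly_varying L.
Hypothesis F_tail : forall x : R, 0 < x -> tail F x = x `^ (- alpha) * L x.
Hypothesis L_C1 : exists2 t0 : R, 0 < t0 & forall x : R, t0 <= x ->
  derivable L x 1 /\ {for x, continuous (derive1 L)}.
Hypothesis L_deriv : forall e : R, 0 < e ->
  \forall x \near +oo, `|derive1 L x| <= e * `|L x / x|.

(** If [L x] were 0, the ratio [L (2 x) / L x] would be 0 by the convention for division, against
    its limit 1; the sign comes from the tail. *)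
Lemma slowly_varying_gt0 : \forall x \near +oo, 0 < L x.
Proof.
have h2 : \forall x \near +oo, 1 / 2 < L (2 * x) / L x.
  by apply: (cvgr_gt (1 : R) (L_slow _)) => //; lra.
have hpos : \forall x \near +oo, (0 : R) < x by exact: nbhs_pinfty_gt.
apply: filterS (filterI h2 hpos) => x [hx x0].
have Lne : L x != 0 by apply/eqP => L0; move: hx; rewrite L0 invr0 mulr0; lra.
rewrite lt_neqAle eq_sym Lne/=.
have : 0 <= tail F x by rewrite /tail fine_ge0.
by rewrite F_tail// pmulr_rge0// powR_gt0.
Qed.

Lemma regularly_varying_tail_gt0 x : 0 < tail F x.
Proof.
have [c0 c00 hc] := near_pinfty_ex slowly_varying_gt0.
apply: lt_le_trans (tail_noninc F (y := Num.max x c0) _); last by rewrite le_max lexx.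
have m0 : 0 < Num.max x c0 by rewrite lt_max c00 orbT.
rewrite F_tail// mulr_gt0 ?powR_gt0//; apply: hc.
by rewrite le_max lexx orbT.
Qed.

(** The derivative of [u^a L(u)] is [u^(a - 1) (a L(u) + u L'(u))]. For [a = e] and [a = - e], the
    bound [|u L'(u)| <= e L(u)] gives it the weak sign of [a], and the mean value theorem
    concludes. *)
Lemma powR_mul_slowly_varying (e : R) : 0 < e ->
  exists2 c0, 0 < c0 & forall x y, c0 <= x -> x <= y ->
    x `^ e * L x <= y `^ e * L y /\
    y `^ (- e) * L y <= x `^ (- e) * L x.
Proof.
move=> e0; have [t0 t00 hC1] := L_C1.
have [c0 c00 hc] := near_pinfty_ex (filterI slowly_varying_gt0 (L_deriv e0)).
exists (Num.max t0 c0); first by rewrite lt_max t00.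
move=> x y; rewrite ge_max => /andP[tx cx]; rewrite le_eqVlt => /predU1P[->//|xy].
have mvt a : exists2 c, x < c & y `^ a * L y - x `^ a * L x =
    c `^ (a - 1) * (a * L c + c * derive1 L c) * (y - x).
  have dg c : x <= c -> is_derive c 1 (fun u => u `^ a * L u)
      (c `^ (a - 1) * (a * L c + c * derive1 L c)).
    move=> xc; have cp : 0 < c by rewrite (lt_le_trans t00)// (le_trans tx).
    have [dL _] := hC1 c (le_trans tx xc).
    have hL : is_derive c 1 L (derive1 L c).
      by rewrite derive1E; exact/derivableP.
    have hp := is_derive1_powR a cp.
    apply: is_derive_eq (is_deriveM hp hL) _.
    have ca : c `^ a = c `^ (a - 1) * c.
      have := @powRD R c (a - 1) 1; rewrite subrK (gt_eqF cp) implybT => ->//.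
      by rewrite powRr1// ltW.
    by rewrite /GRing.scale/= ca; ring.
  have [||c] := MVT xy (f := fun u => u `^ a * L u) (df := fun c =>
      c `^ (a - 1) * (a * L c + c * derive1 L c)).
  - by move=> c; rewrite in_itv/= => /andP[/ltW xc _]; exact: dg.
  - apply: derivable_within_continuous => c; rewrite in_itv/= => /andP[xc _].
    by have [] := dg c xc.
  by rewrite in_itv/= => /andP[xc _] ->; exists c.
have sgn c : x < c -> 0 < c /\ `|c * derive1 L c| <= e * L c.
  move=> xc; have cp : 0 < c by rewrite (lt_le_trans t00)// (le_trans tx)// ltW.
  split=> //; have [L0 hd] := hc c (le_trans cx (ltW xc)).
  rewrite normrM (gtr0_norm cp) mulrC -ler_pdivlMr// -mulrA.
  by rewrite (gtr0_norm (_ : 0 < L c / c)) in hd => //; exact: divr_gt0.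
split.
  have [c xc E] := mvt e; rewrite -subr_ge0 E.
  have [cp /ler_normlP[h1 h2]] := sgn c xc.
  by apply: mulr_ge0; [apply: mulr_ge0; [exact: powR_ge0|lra]|lra].
have [c xc E] := mvt (- e); rewrite -subr_le0 E.
have [cp /ler_normlP[h1 h2]] := sgn c xc.
rewrite mulr_le0_ge0//; last by lra.
by rewrite mulr_ge0_le0 ?powR_ge0//; lra.
Qed.

Lemma tail_potter (be : nat) : alpha < be%:R ->
  exists2 c0, 0 < c0 & forall x y, c0 <= x -> x <= y ->
    x ^+ be * tail F x <= y ^+ be * tail F y.
Proof.
move=> abe; have [|c0 c00 hc] := @powR_mul_slowly_varying (be%:R - alpha).
  by rewrite subr_gt0.
exists c0 => // x y cx xy.
have E z : 0 < z -> z ^+ be * tail F z = z `^ (be%:R - alpha) * L z.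
  move=> z0; rewrite F_tail// mulrA -powR_mulrn ?ltW// -powRD//.
  by rewrite (gt_eqF z0) implybT.
have x0 := lt_le_trans c00 cx; rewrite !E//; last exact: lt_le_trans xy.
by case: (hc x y cx xy).
Qed.

Lemma tail_powR_le (q : R) : q < alpha ->
  exists2 K, 0 <= K & \forall x \near +oo, tail F x <= K * x `^ (- q).
Proof.
move=> qa; have [|c0 c00 hc] := @powR_mul_slowly_varying (alpha - q).
  by rewrite subr_gt0.
exists (`|c0 `^ (- (alpha - q)) * L c0|); first exact: normr_ge0.
near=> x; have cx : c0 <= x by [].
have x0 := lt_le_trans c00 cx.
rewrite F_tail// (_ : - alpha = - q + - (alpha - q)); last by ring.
rewrite powRD; last by rewrite (gt_eqF x0) implybT.
rewrite -mulrA mulrC ler_wpM2r ?powR_ge0//.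
have [_ h] := hc c0 x (lexx _) cx.
exact: le_trans (ler_norm _).
Unshelve. all: by end_near. Qed.

End regularly_varying_tail.

(** * Moments and absence of atoms from the behaviour of the tails *)

Section moments_from_tails.
Context {R : realType} (F : probability R R).

(** The closed half-line has mass at most [tail((1 - ep) c) <= (1 - ep)^-be tail(c)], and [ep] is
    arbitrarily small. The factor 2 in [2 * x1 <= c] keeps [(1 - ep) c] beyond [x1]. *)
Lemma tail_noatom (be : nat) (x1 : R) : 0 < x1 -> (forall x, 0 < tail F x) ->
  (forall x y, x1 <= x -> x <= y -> x ^+ be * tail F x <= y ^+ be * tail F y) ->
  forall c, 2 * x1 <= c -> F `[c, +oo[%classic = (tail F c)%:E.
Proof.
move=> x10 tg pot c xc; have c0 : 0 < c by lra.
have fc : F `[c, +oo[%classic \is a fin_num by exact: fin_num_measure.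
rewrite -(fineK fc); congr EFin; apply/eqP; rewrite eq_le; apply/andP; split; last first.
  by rewrite /tail fine_le ?fin_num_measure// le_measure ?inE//;
    apply: subset_itvr; rewrite bnd_simp.
apply/ler_addgt0Pr => dl dl0.
have [ep /andP[ep0 ep2] [he _]] := pow_near1 be (divr_gt0 dl0 (tg c)).
have step : fine (F `[c, +oo[%classic) <= tail F ((1 - ep) * c).
  rewrite /tail fine_le ?fin_num_measure// le_measure ?inE//.
  by apply: subset_itvr; rewrite bnd_simp; nra.
apply: (le_trans step).
have a01 : 0 < 1 - ep <= 1 by apply/andP; split; lra.
apply: le_trans (potter_scale x10 pot a01 _) _; first by nra.
apply: le_trans (ler_wpM2r (ltW (tg c)) he) _.
by rewrite mulrDl mul1r divfK// gt_eqF.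
Qed.

Lemma dyadic_scale (x0 y : R) : 0 < x0 -> x0 <= y ->
  exists n, x0 * 2 ^+ n <= y /\ y < x0 * 2 ^+ n.+1.
Proof.
move=> x00 xy.
have ex : exists n, y < x0 * 2 ^+ n.
  exists (Num.truncn (y / x0)).+1; rewrite mulrC -ltr_pdivrMr//.
  apply: lt_le_trans (truncnS_gt _) _.
  by rewrite -natrX ler_nat ltnW// ltn_expl.
case: (ex_minnP ex) => -[|n]; first by rewrite mulr1 ltNge xy.
move=> hn hmin; exists n; split=> //; rewrite leNgt; apply/negP => h.
by have := hmin _ h; rewrite ltnn.
Qed.

(** Dyadic shells: [|y|^p] is at most [x0^p] plus the sum of [s_(n+1)^p 1(s_n <= |y|)], whose terms
    have means bounded by a geometric sequence of ratio [2^(p - q) < 1]. *)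
Lemma moment_lt_tail_exponent (p q K x0 : R) : 0 < p -> p < q -> 0 <= K -> 0 < x0 ->
  (forall x, x0 <= x -> (F [set y | (x <= `|y|)%R] <= (K * x `^ (- q))%:E)%E) ->
  exists M, (\int[F]_x (`|x| `^ p)%:E <= M%:E)%E.
Proof.
move=> p0 pq K0 x00 hF.
pose s n := x0 * 2 ^+ n.
have s0 n : 0 < s n by rewrite mulr_gt0// exprn_gt0.
pose I n (y : R) : R := (s n <= `|y|)%R%:R.
have mI n : measurable_fun setT (I n).
  by apply: measurable_indicator; exact: measurable_fun_ler.
pose f n (y : R) := ((s n.+1) `^ p * I n y)%:E.
have f0 n y : (0 <= f n y)%E by rewrite lee_fin mulr_ge0 ?powR_ge0// ler0n.
have mf n : measurable_fun setT (f n).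
  by apply/measurable_EFinP; exact: measurable_funM.
pose rho : R := 2 `^ (p - q).
have rho0 : 0 < rho by rewrite powR_gt0.
have rho1 : rho < 1.
  have l2 : 0 < ln (2 : R) by rewrite ln_gt0// ltr1n.
  rewrite /rho /powR ifF; last by apply/eqP; lra.
  by rewrite expR_lt1 nmulr_rlt0// subr_lt0.
pose A := 2 `^ p * (x0 `^ (p - q)) * K.
have A0 : 0 <= A by rewrite !mulr_ge0 ?powR_ge0.
have If n : (\int[F]_y f n y <= (A * rho ^+ n)%:E)%E.
  under eq_integral do rewrite /f EFinM.
  rewrite ge0_integralZl//; last 3 first.
    by apply/measurable_EFinP; exact: mI.
    by move=> x _; rewrite lee_fin ler0n.
    by rewrite lee_fin powR_ge0.
  rewrite integral_bool; last exact: measurable_fun_ler.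
  have sn : x0 <= s n by rewrite ler_peMr ?(ltW x00)// exprn_ege1//; lra.
  apply: le_trans (lee_wpmul2l _ (hF _ sn)) _; first by rewrite lee_fin powR_ge0.
  rewrite -EFinM lee_fin le_eqVlt; apply/orP; left; apply/eqP.
  have -> : s n.+1 = 2 * s n by rewrite /s exprS; ring.
  rewrite powRM ?(ltW (s0 _))//.
  have -> : rho ^+ n = (2 ^+ n) `^ (p - q).
    rewrite -(powR_mulrn n (ltW rho0)) -(powR_mulrn n (ler0n R 2)) /rho -!powRrM.
    by congr (_ `^ _); exact: mulrC.
  have E : s n `^ p * s n `^ (- q) = x0 `^ (p - q) * (2 ^+ n) `^ (p - q).
    rewrite -powRD; last by rewrite (gt_eqF (s0 n)) implybT.
    by rewrite /s powRM ?(ltW x00)// exprn_ge0.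
  rewrite /A; transitivity (2 `^ p * (s n `^ p * s n `^ (- q)) * K); first by ring.
  by rewrite E; ring.
have sumf : (\sum_(n <oo) \int[F]_y f n y <= (A / (1 - rho))%:E)%E.
  apply: lime_le; first by apply: is_cvg_nneseries => n _ _; exact: integral_ge0.
  apply: nearW => n; apply: le_trans (lee_sum _ (fun i _ => If i)) _.
  rewrite sumEFin lee_fin.
  have := @geometric_seriesE R A rho; rewrite lt_eqF// => /(_ isT)/(congr1 (@^~ n)).
  rewrite /series/= => ->; rewrite ler_pM2r ?invr_gt0 ?subr_gt0//.
  by rewrite ler_piMr// gerBl exprn_ge0// ltW.
exists (x0 `^ p + A / (1 - rho)).
have pt y : ((`|y| `^ p)%:E <= (x0 `^ p)%:E + \sum_(n <oo) f n y)%E.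
  have S0 : (0 <= \sum_(n <oo) f n y)%E by apply: nneseries_ge0.
  have [yx|xy] := leP `|y| x0.
    rewrite -[leLHS]adde0 leeD// lee_fin ge0_ler_powR ?nnegrE ?(ltW p0)//.
    exact: ltW.
  have [n [h1 h2]] := dyadic_scale x00 (ltW xy).
  rewrite -[leLHS]add0e leeD// ?lee_fin ?powR_ge0//.
  apply: le_trans (nneseries_lim_ge n.+1 (fun i _ _ => f0 i y)).
  rewrite big_nat_recr//= -[leLHS]add0e leeD//; first by apply: sume_ge0.
  rewrite /f /I h1 mulr1 lee_fin ge0_ler_powR ?nnegrE ?(ltW p0)//.
    exact: ltW.
  exact: ltW.
have mS : measurable_fun setT (fun y => \sum_(n <oo) f n y)%E.
  by apply: (ge0_emeasurable_sum (P := xpredT)).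
have S0 y : [set: R] y -> (0 <= \sum_(n <oo) f n y)%E.
  by move=> yT; apply: nneseries_ge0.
have mabs : measurable_fun setT (fun x : R => (`|x| `^ p)%:E).
  apply/measurable_EFinP.
  by apply: (measurableT_comp (f := fun x : R => x `^ p)).
apply: (@le_trans _ _ (\int[F]_y ((x0 `^ p)%:E + \sum_(n <oo) f n y))%E).
  by apply: ge0_le_integral => //; exact: emeasurable_funD.
rewrite ge0_integralD//; last by move=> x _; rewrite lee_fin powR_ge0.
rewrite integral_cst// [X in (_ * X)%E](_ : _ = 1%E); last exact: probability_setT.
by rewrite mule1 EFinD leeD2l// integral_nneseries.
Qed.

End moments_from_tails.

(** * From the assumptions on the increments to [heavy_tail] *)

Section heavy_tail_from_assumptions.
Context {R : realType} d (T : measurableType d) (P : probability T R).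
Variables (X : nat -> {RV P >-> R}) (F : probability R R) (alpha : R) (L : R -> R).
Hypothesis X_law : forall i (A : set R), measurable A -> distribution P (X i) A = F A.
Hypothesis X_mean : ('E_P[X 0%N] = 0)%E.
Hypothesis alpha_gt1 : 1 < alpha.
Hypothesis L_slow : slowly_varying L.
Hypothesis F_tail : forall x : R, 0 < x -> tail F x = x `^ (- alpha) * L x.
Hypothesis F_left : ('V_P[X 0%N] = +oo)%E ->
  (limf_esup (fun x : R => F `]-oo, (- x)%R[%classic / F `]x, +oo[%classic) (pinfty_nbhs R)
   < +oo)%E.
Hypothesis L_C1 : exists2 t0 : R, 0 < t0 & forall x : R, t0 <= x ->
  derivable L x 1 /\ {for x, continuous (derive1 L)}.
Hypothesis L_deriv : forall e : R, 0 < e ->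
  \forall x \near +oo, `|derive1 L x| <= e * `|L x / x|.

Lemma ge0_integral_law (f : R -> \bar R) : measurable_fun setT f ->
  (forall x, 0 <= f x)%E -> (\int[F]_x f x = \int[P]_w f (X 0%N w))%E.
Proof.
move=> mf f0; rewrite -(ge0_integral_distribution (X 0%N) mf f0).
by apply: eq_measure_integral => A mA _; exact/esym/X_law.
Qed.

Lemma mean_integrable :
  P.-integrable setT (EFin \o X 0%N) /\ (\int[P]_w (X 0%N w)%:E = 0)%E.
Proof.
have E0 : (\int[P]_w (X 0%N w)%:E = 0)%E by rewrite -X_mean unlock.
split=> //; apply/integrableP; split; first exact/measurable_EFinP.
by rewrite integral_fin_num_abs// E0.
Qed.

Lemma law_integrable : F.-integrable setT EFin /\ (\int[F]_x x%:E = 0)%E.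
Proof.
have [/integrableP[_ iX] E0] := mean_integrable.
have iF : F.-integrable setT EFin.
  apply/integrableP; split; first exact/measurable_EFinP.
  rewrite (ge0_integral_law (f := fun x => `|x%:E|%E))//.
  by apply: measurableT_comp => //; exact/measurable_EFinP.
split=> //; rewrite -{}E0.
rewrite -(integral_distribution (X := X 0%N) (f := EFin))//; last by case: mean_integrable.
by apply: eq_measure_integral => A mA _; exact/esym/X_law.
Qed.

Lemma second_moment_fin : ('V_P[X 0%N] < +oo)%E ->
  (\int[F]_x (x ^+ 2)%:E < +oo)%E.
Proof.
rewrite /variance unlock X_mean/= unlock => V.
rewrite ge0_integral_law//; last 2 first.
- by apply/measurable_EFinP; exact: measurable_funX.
- by move=> x; rewrite lee_fin sqr_ge0.
apply: le_lt_trans V; rewrite le_eqVlt; apply/orP; left; apply/eqP.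
apply: eq_integral => w _; congr EFin; rewrite /= expr2.
rewrite -[X 0%N w in LHS]subr0; exact: erefl.
Qed.

Lemma left_tail_le : ('V_P[X 0%N] = +oo)%E ->
  exists2 K, 0 <= K & \forall x \near +oo,
    (F `]-oo, (- x)%R[%classic <= (K * tail F x)%:E)%E.
Proof.
move=> /F_left; rewrite /limf_esup => /ereal_inf_lt[_ [V Voo <-] hs].
have [K0 K00 hK] : exists2 K : R, 0 <= K & (ereal_sup ((fun x : R =>
    F `]-oo, (- x)%R[%classic / F `]x, +oo[%classic)%E @` V) <= K%:E)%E.
  move: hs; case: (ereal_sup _) => [s _|//|_].
    by exists (Num.max s 0); rewrite ?lee_fin ?le_max ?lexx ?orbT.
  by exists 0 => //; rewrite leNye.
exists K0 => //; apply: filterS Voo => x Vx.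
have tg := regularly_varying_tail_gt0 L_slow F_tail x.
have Fx : F `]x, +oo[%classic = (tail F x)%:E by rewrite /tail fineK// fin_num_measure.
have : (F `]-oo, (- x)%R[%classic / F `]x, +oo[%classic <= K0%:E)%E.
  by apply: le_trans hK; apply: ereal_sup_ubound; exists x.
by rewrite Fx inver gt_eqF// lee_pdivrMr// EFinM.
Qed.

(** A finite variance gives the moment of order [p <= 2] directly. Otherwise the left tail is
    dominated by the right one, which is [O(x^(- q))] for some [q] between [p] and [alpha]. *)
Lemma exists_moment : exists p M, 1 < p <= 2 /\ (\int[F]_x (`|x| `^ p)%:E <= M%:E)%E.
Proof.
pose p := Num.min 2 ((1 + alpha) / 2).
have a1 := alpha_gt1.
have p2 : p <= 2 by rewrite ge_min lexx.
have pa : p <= (1 + alpha) / 2 by rewrite ge_min lexx orbT.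
have p1 : 1 < p by rewrite lt_min; apply/andP; split; lra.
exists p.
suff [M hM] : exists M, (\int[F]_x (`|x| `^ p)%:E <= M%:E)%E.
  by exists M; rewrite p1 p2.
have mabs : measurable_fun setT (fun x : R => (`|x| `^ p)%:E).
  apply/measurable_EFinP.
  by apply: (measurableT_comp (f := fun x : R => x `^ p)).
have [V|V] := eqVneq ('V_P[X 0%N]) +oo%E; last first.
  have /second_moment_fin s2 : ('V_P[X 0%N] < +oo)%E by rewrite ltey.
  have m2 : measurable_fun setT (fun x : R => (x ^+ 2)%:E).
    by apply/measurable_EFinP; exact: measurable_funX.
  have s0 x : [set: R] x -> (0 <= (x ^+ 2)%:E)%E by rewrite lee_fin sqr_ge0.
  have fs : (\int[F]_x (x ^+ 2)%:E)%E \is a fin_num.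
    by rewrite ge0_fin_numE// integral_ge0.
  exists (1 + fine (\int[F]_x (x ^+ 2)%:E)).
  apply: (@le_trans _ _ (\int[F]_x (1%:E + (x ^+ 2)%:E))%E).
    apply: ge0_le_integral => //.
    - exact: emeasurable_funD.
    - move=> x _; rewrite -EFinD lee_fin -(real_normK (num_real x)).
      have n0 := normr_ge0 x.
      have [h|h] := leP `|x| 1.
        apply: (@le_trans _ _ (1 `^ p)); last by rewrite powR1 lerDl sqr_ge0.
        by rewrite ge0_ler_powR ?nnegrE//; lra.
      rewrite -powR_mulrn//; apply: (@le_trans _ _ (`|x| `^ 2)); last by rewrite lerDr.
      by rewrite ler_powR// ltW.
  rewrite ge0_integralD//.
  rewrite integral_cst// [X in (_ * X)%E](_ : _ = 1%E); last exact: probability_setT.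
  by rewrite mule1 EFinD fineK.
have [Kl Kl0 hl] := left_tail_le V.
pose q := (p + alpha) / 2.
have pq : p < q by rewrite /q; lra.
have qa : q < alpha by rewrite /q; lra.
have [Kr Kr0 hr] := tail_powR_le L_slow F_tail L_C1 L_deriv qa.
have [x0 x00 hx0] := near_pinfty_ex (filterI hl hr).
have K0 : 0 <= (Kl + 1) * Kr * 2^-1 `^ (- q).
  by rewrite !mulr_ge0 ?powR_ge0 ?addr_ge0.
have x2 : 0 < 2 * x0 by rewrite mulr_gt0.
have p0 : 0 < p by lra.
apply: (moment_lt_tail_exponent p0 pq K0 x2) => x xx.
have xp : 0 < x by lra.
have xh : x0 <= 2^-1 * x by lra.
have [h1 h2] := hx0 _ xh.
(* Halving the level passes from weak to strict inequalities, the form of the two tail bounds. *)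
have sub : [set y | (x <= `|y|)%R] `<=`
    `]-oo, (- (2^-1 * x))%R[%classic `|` `](2^-1 * x)%R, +oo[%classic.
  move=> y /=; rewrite !in_itv/= andbT ler_normr => /orP[] h; [right|left]; lra.
have mset : measurable [set y : R | (x <= `|y|)%R].
  by apply: (measurable_pred (p := fun y : R => (x <= `|y|)%R)); exact: measurable_fun_ler.
apply: le_trans (le_measure _ _ _ sub) _; rewrite ?inE//; first exact: measurableU.
apply: le_trans (measureU2 _ _ _) _ => //.
have Fx : F `](2^-1 * x), +oo[%classic = (tail F (2^-1 * x))%:E.
  by rewrite /tail fineK// fin_num_measure.
have Fle : (F `](2^-1 * x)%R, +oo[%classic <= (tail F (2^-1 * x))%:E)%E by rewrite Fx.
apply: le_trans (leeD h1 Fle) _; rewrite -EFinD lee_fin.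
have -> : Kl * tail F (2^-1 * x) + tail F (2^-1 * x) = (Kl + 1) * tail F (2^-1 * x) by ring.
have -> : (Kl + 1) * Kr * 2^-1 `^ (- q) * x `^ (- q) = (Kl + 1) * (Kr * (2^-1 * x) `^ (- q)).
  by rewrite powRM ?invr_ge0 ?(ltW xp)//; ring.
by rewrite ler_wpM2l// addr_ge0.
Qed.

Lemma exists_heavy_tail : exists p M be x1, heavy_tail F p M be x1.
Proof.
have [p [M [p12 hM]]] := exists_moment.
have [iF mF] := law_integrable.
have tg := regularly_varying_tail_gt0 L_slow F_tail.
have [be hbe] : exists be : nat, alpha < be%:R.
  by exists (Num.truncn alpha).+1; exact: truncnS_gt.
have [c0 c00 pot] := tail_potter L_slow F_tail L_C1 L_deriv hbe.
exists p, M, be, (2 * c0); split=> //.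
- by rewrite mulr_gt0.
- exact: tail_noatom pot.
- by move=> x y cx xy; apply: pot => //; lra.
Qed.

End heavy_tail_from_assumptions.

(** * Bounds on the strata and the relative error *)

Section strata_bounds.
Context {R : realType} (F : probability R R) (mu : R) (r : nat).
Hypotheses (mu_gt0 : 0 < mu) (r_gt1 : (1 < r)%N).
Variables (p M : R) (be : nat) (x1 : R).
Hypothesis H : heavy_tail F p M be x1.

Local Notation G := (integrated_tail F).
Local Notation C0 := (r%:R / mu + r%:R).

Lemma nk_doubling k : (0 < k)%N -> ((nk r k.-1) * 2 <= nk r k)%N.
Proof.
case: k => [//|[|k]] _; first by rewrite mul0n.
by rewrite /nk /= [in leqRHS]expnS mulnC leq_mul2r r_gt1 orbT.
Qed.

(** [n_k <= r n_(k-1) + r], the last [r] accounting for [k = 1]; the two terms are absorbed through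
    [n_(k-1) mu] and through [b >= 1]. *)
Lemma nk_le_level b k : 1 <= b -> (0 < k)%N ->
  (nk r k)%:R <= C0 * level mu r b k.-1.
Proof.
move=> b1 k0; have mu0 := mu_gt0.
have hN : (nk r k)%:R <= r%:R * (nk r k.-1)%:R + r%:R :> R.
  rewrite -natrM -natrD ler_nat; case: k {k0} => [|[|k]] //=.
    by rewrite expn1 leq_addl.
  by rewrite -expnS leq_addr.
apply: le_trans hN _; rewrite /level; set n := (nk r k.-1)%:R : R.
have n0 : 0 <= n by rewrite ler0n.
have r0 : 0 <= r%:R :> R by rewrite ler0n.
have -> : C0 * (b + n * mu) = r%:R * n + r%:R * b + (r%:R / mu * b + r%:R * (n * mu)).
  by field; rewrite gt_eqF.
rewrite -[leLHS]addr0; apply: lerD; last first.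
  by rewrite addr_ge0// !mulr_ge0 ?invr_ge0//; lra.
by rewrite lerD2l ler_peMr.
Qed.

Lemma level_le b k j : (k <= j)%N -> level mu r b k <= level mu r b j.
Proof.
by move=> kj; rewrite lerD2l ler_wpM2r ?(ltW mu_gt0)// ler_nat leq_nk.
Qed.

Lemma level0 b : level mu r b 0 = b.
Proof. by rewrite /level /= mul0r addr0. Qed.

(* The constant comes from the block having length at least [nk r k / 2] and the
   levels at its two ends having ratio at most [1 + C0 * mu]. *)
Lemma mass_le_stratum b k : 1 <= b -> x1 <= b -> (0 < k)%N ->
  (nk r k)%:R * tail F (level mu r b k.-1) <=
  2 / mu * (1 + C0 * mu) ^+ be * (G (level mu r b k.-1) - G (level mu r b k)).
Proof.
move=> b1 xb k0; set c := level mu r b k.-1; set e := level mu r b k.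
have mu0 := mu_gt0.
have cb : b <= c by rewrite -[leLHS]level0; exact: level_le.
have c0 : 0 < c by lra.
have ce : c <= e by apply: level_le; exact: leq_pred.
have /andP[hG _] := integrated_tail_diff (ht_p H) (ht_moment H) c0 ce.
have N2 : (nk r k)%:R <= 2 * ((nk r k)%:R - (nk r k.-1)%:R) :> R.
  have : ((nk r k.-1) * 2)%:R <= (nk r k)%:R :> R by rewrite ler_nat nk_doubling.
  by rewrite natrM; lra.
have ec : e - c = ((nk r k)%:R - (nk r k.-1)%:R) * mu.
  by rewrite /e /c /level; ring.
have K1 : 0 <= 1 + C0 * mu.
  by rewrite addr_ge0// mulr_ge0 ?addr_ge0 ?divr_ge0// ltW.
have eK : e <= (1 + C0 * mu) * c.
  have hN := nk_le_level b1 k0; have n0 : 0 <= (nk r k.-1)%:R * mu by rewrite mulr_ge0// ltW.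
  have -> : (1 + C0 * mu) * c = c + (C0 * c) * mu by ring.
  apply: (@le_trans _ _ (c + (nk r k)%:R * mu)).
    by rewrite lerD2r /c /level lerDl.
  by rewrite lerD2l ler_wpM2r// ltW.
have tce : tail F c <= (1 + C0 * mu) ^+ be * tail F e.
  rewrite -(ler_pM2l (exprn_gt0 be c0)).
  apply: le_trans (ht_potter H (le_trans xb cb) ce) _.
  rewrite mulrA [c ^+ be * _]mulrC -exprMn ler_wpM2r ?(ltW (ht_tail H _))//.
  by rewrite lerXn2r ?nnegrE ?mulr_ge0 ?(ltW c0)//; lra.
have te := ht_tail H e; have tc := ht_tail H c.
set K := (1 + C0 * mu) ^+ be in tce *.
have K0 : 0 <= K by rewrite exprn_ge0.
apply: (@le_trans _ _ (2 / mu * K * ((e - c) * tail F e))); last first.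
  by rewrite ler_wpM2l// mulr_ge0// divr_ge0// ltW.
rewrite ec (_ : 2 / mu * K * _ = 2 * ((nk r k)%:R - (nk r k.-1)%:R) * (K * tail F e)); last first.
  by field; rewrite gt_eqF.
by apply: ler_pM => //; exact: ltW.
Qed.

Lemma pk_scale b k : x1 <= b -> (0 < k)%N ->
  pk F mu r b k * G b = G (level mu r b k.-1) - G (level mu r b k).
Proof.
move=> xb; case: k => // k _; rewrite /pk divfK//.
by rewrite gt_eqF// (integrated_tail_gt0 H).
Qed.

Lemma heavy_pk_gt0 b k : 0 < b -> x1 <= b -> (0 < k)%N -> 0 < pk F mu r b k.
Proof.
move=> b0 xb k0; have Gb := integrated_tail_gt0 H xb.
rewrite -(pmulr_lgt0 _ Gb) pk_scale//.
have cb : b <= level mu r b k.-1 by rewrite -[leLHS]level0; exact: level_le.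
have ce : level mu r b k.-1 <= level mu r b k by apply: level_le; exact: leq_pred.
have /andP[hG _] := integrated_tail_diff (ht_p H) (ht_moment H) (lt_le_trans b0 cb) ce.
apply: lt_le_trans hG; rewrite mulr_gt0 ?(ht_tail H)// subr_gt0 ltrD2l ltr_pM2r//.
by rewrite ltr_nat; have := nk_ltn r_gt1 k.-1; rewrite prednK.
Qed.

(** The partial sums telescope to [1 - G(level n) / G(b)], and [G] vanishes at infinity. *)
Lemma heavy_pk_sum b : 0 < b -> x1 <= b -> (\sum_(k <oo) (pk F mu r b k)%:E = 1)%E.
Proof.
move=> b0 xb; have Gb := integrated_tail_gt0 H xb; have mu0 := mu_gt0.
have part n : \sum_(0 <= k < n.+1) pk F mu r b k = 1 - G (level mu r b n) / G b.
  elim: n => [|n IHn].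
    by rewrite big_nat1 /= level0 divff ?subrr// gt_eqF.
  rewrite big_nat_recr//= IHn; field; by rewrite gt_eqF.
apply: cvg_lim => //; rewrite -(cvg_shiftn 1).
rewrite (_ : (fun n => _) = EFin \o (fun n => 1 - G (level mu r b n) / G b)); last first.
  by apply/funext => n; rewrite addn1 sumEFin part.
apply: cvg_EFin; first exact: nearW.
apply/cvgrPdist_le => e e0.
have [c0 c00 hc] := near_pinfty_ex (integrated_tail_small H (mulr_gt0 e0 Gb)).
near=> n; rewrite /= opprB addrC subrK.
have lc : c0 <= level mu r b n.
  apply: (@le_trans _ _ (n%:R * mu)).
    rewrite -ler_pdivrMr//; near: n; exact: nbhs_infty_ger.
  apply: (@le_trans _ _ ((nk r n)%:R * mu)); last by rewrite lerDr ltW.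
  rewrite ler_wpM2r ?(ltW mu0)// ler_nat.
  by case: (n) => // m; rewrite ltnW// ltn_expl.
have l0 := lt_le_trans c00 lc.
rewrite ger0_norm; last first.
  by rewrite divr_ge0 ?(ltW Gb)// (integrated_tail_ge0 (ht_p H) (ht_moment H)).
by rewrite ler_pdivrMr// hc.
Unshelve. all: by end_near. Qed.

End strata_bounds.

Section estimator_bounds.
Context {R : realType} (F : probability R R) (mu b : R) (r : nat).
Hypotheses (mu_gt0 : 0 < mu) (r_gt1 : (1 < r)%N).

Lemma indicator_ratio_le (q : R) (c : nat) (e : bool) : 0 <= q -> (e -> (0 < c)%N) ->
  q / c%:R * e%:R <= q.
Proof.
case: e => q0 hc; last by rewrite mulr0.
by rewrite mulr1 ler_piMr// invf_le1 ?ler1n ?ltr0n hc.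
Qed.

Lemma Zk1_le_qk k x : Zk1 F mu r b k x <= qk F mu r b k.
Proof.
apply: indicator_ratio_le.
  by apply: sumr_ge0 => i _; rewrite /tail fine_ge0.
case/andP => _ /hasP[i ib hi]; rewrite -has_count; apply/hasP.
by exists i => //; exact: ltW.
Qed.

Lemma Zk3_le_mass k x :
  Zk3 F mu r b k x <= (nk r k)%:R * tail F (level mu r b k.-1).
Proof.
apply: indicator_ratio_le; first by rewrite mulr_ge0// /tail fine_ge0.
case/and3P => _ _; rewrite -has_predC => /hasP[i ib hi]; rewrite -has_count.
by apply/hasP; exists i => //; move: hi => /=; rewrite -leNgt.
Qed.

(** At passage in the block the walk is at least [level k.-1], and [theta * level k.-1 = - ln h] for
    the mass [h], so the exponential of [- theta * walk] is at most [h]. The factor with [Lambda] is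
    at most [expR C] because [t <= nk r k]. *)
Lemma Zk2_le_mass (C : R) k x : (0 < k)%N -> 0 <= C ->
  0 < (nk r k)%:R * tail F (level mu r b k.-1) -> 0 < level mu r b k.-1 ->
  0 < theta F mu r b k ->
  Lambda F mu r b k (theta F mu r b k) <= C / (nk r k)%:R ->
  Zk2 F mu r b k x <= expR C * ((nk r k)%:R * tail F (level mu r b k.-1)).
Proof.
move=> k0 C0; set h := (X in expR C * X); set c := level _ _ _ _ => h0 c0 th0 hL.
rewrite /Zk2; set th := theta F mu r b k in th0 hL *; set La := Lambda _ _ _ _ _ _ in hL *.
case: (boolP (tau_in_block _ _ _ _ _)) => [|_]; last first.
  by rewrite mulr0 mulr_ge0 ?expR_ge0// ltW.
rewrite /tau_in_block; case E : tau => [t|//] /= tk.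
apply: le_trans (_ : _ <= expR (- th * walk x t + t%:R * La)) _.
  by rewrite ler_piMr ?expR_ge0// lern1 leq_b1.
have /andP[nt tN] : (nk r k.-1 < t <= nk r k)%N by rewrite -mem_block.
rewrite -[h]lnK ?posrE// -expRD ler_expR.
have thc : th * c = - ln h by rewrite /th /theta -/c -/h divfK// gt_eqF.
have wc : c <= walk x t.
  have := tau_gt E; have : (nk r k.-1)%:R * mu <= t%:R * mu.
    by rewrite ler_wpM2r ?(ltW mu_gt0)// ler_nat ltnW.
  by rewrite /c /level; lra.
have tL : t%:R * La <= C.
  have N0 : 0 < (nk r k)%:R :> R by rewrite ltr0n (leq_ltn_trans _ (leq_trans nt tN)).
  apply: le_trans (ler_wpM2l (ler0n _ _) hL) _.
  by rewrite mulrCA ler_piMr// ler_pdivrMr// mul1r ler_nat.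
have := ler_wpM2l (ltW th0) wc; lra.
Qed.

Lemma integral_left_ray (c th : R) :
  (\int[F]_(x in `]-oo, c[) (expR (th * x))%:E =
   \int[F]_x (expR (th * x) * (x < c)%R%:R)%:E)%E.
Proof.
rewrite integral_mkcond; apply: eq_integral => x _.
by rewrite patchE mem_setE in_itv/=; case: ifP => _; rewrite ?mulr1 ?mulr0.
Qed.

(** A vanishing integral of a positive function would make the ray null. *)
Lemma integral_left_ray_gt0 (c th : R) : (F `[c, +oo[%classic < 1)%E ->
  (0 < \int[F]_(x in `]-oo, c[) (expR (th * x))%:E)%E.
Proof.
move=> Fc; have mf : measurable_fun `]-oo, c[%classic (fun x : R => (expR (th * x))%:E).
  apply: measurable_funTS; apply/measurable_EFinP.
  by apply: measurableT_comp => //; exact: measurable_funM.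
rewrite lt_neqAle integral_ge0 ?andbT; last by move=> x _; rewrite lee_fin expR_ge0.
apply/eqP => I0.
have : (\int[F]_(x in `]-oo, c[) `|(expR (th * x))%:E| = 0)%E.
  by rewrite [RHS]I0; apply: eq_integral => x _; rewrite /= ger0_norm ?expR_ge0.
move=> /(ae_eq_integral_abs F (measurable_itv _) mf).
move=> [N [mN FN sub]].
have : (F `]-oo, c[%classic <= F N)%E.
  rewrite le_measure ?inE// => x xc; apply: sub => /= /(_ xc) /eqP.
  by rewrite eqe gt_eqF// expR_gt0.
rewrite FN; have -> : F `]-oo, c[%classic = (1 - F `[c, +oo[%classic)%E.
  rewrite -probability_setC//; congr (F _).
  by rewrite setCitvr.
by rewrite leNgt sube_gt0 Fc.
Qed.

Lemma hit_noA_le k (u : R) :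
  pr_le (indep_law (nk r k) (fun=> F))
    [set t | exists n, [/\ (nk r k.-1 < n <= nk r k)%N,
       b < walk (tuple_path t) n - n%:R * mu,
       (forall j, (j <= nk r k.-1)%N -> walk (tuple_path t) j - j%:R * mu <= b) &
       (forall i, (nk r k.-1 < i <= nk r k)%N -> tuple_path t i <= b + i%:R * mu)]] u ->
  (hit_noA F mu b r k <= u%:E)%E.
Proof.
move=> hu; apply: pr_leP; last first.
  apply: pr_leW (lexx u) hu => t /= /andP[].
  rewrite /tau_in_block; case E : tau => [n|//]; rewrite mem_block => nb nA.
  exists n; split=> //; first exact: tau_gt.
    move=> j jn; apply: (tau_before E); apply: leq_ltn_trans jn _.
    by case/andP: nb.
  move=> i ib; rewrite leNgt; apply: contra nA => hi; apply/hasP; exists i => //.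
  by rewrite mem_block.
have mt i : measurable_fun setT (fun t : (nk r k).-tuple R => tuple_path t i).
  exact: measurable_tuple_path.
apply: measurable_pred; apply: measurable_and.
  exact: measurable_tau_in_block.
by apply: measurable_neg; exact: measurable_event_A.
Qed.

Lemma hit_noA0 : hit_noA F mu b r 0 = 0%E.
Proof.
rewrite /hit_noA [X in indep_law _ _ X](_ : _ = set0) ?measure0//.
by rewrite -subset0 => t /=; rewrite tau_in_block0.
Qed.

End estimator_bounds.

(** * The second moment of the estimator *)

Section second_moment.
Context {R : realType} (F : probability R R) (mu : R) (r : nat).
Hypotheses (mu_gt0 : 0 < mu) (r_gt1 : (1 < r)%N).
Variables (p M : R) (be : nat) (x1 : R).
Hypothesis H : heavy_tail F p M be x1.

Local Notation G := (integrated_tail F).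

(** [D0] is chosen before [dl], which makes the last term [o(G b ^ 2)]. Its factor [mu^-1 + E]
    collects the bounds on [Zk1] and [Zk23], and [Ch] compares the mass of a stratum with its
    weight; the weights sum to 1. *)
Lemma second_moment_asymptotics : exists2 D0, 0 <= D0 &
  forall dl, 0 < dl -> \forall b \near +oo,
    ('E_(Q F mu r b)[Z F mu r b] = \sum_(k <oo) hit_block F mu b r k)%E /\
    (forall s, 0 <= Z F mu r b s) /\ measurable_fun setT (Z F mu r b) /\
    (\int[Q F mu r b]_s (Z F mu r b s ^+ 2)%:E <=
     (G b / mu)%:E * (\sum_(k <oo) hit_block F mu b r k) +
     (dl * (D0 * G b ^+ 2))%:E)%E.
Proof.
have mu0 := mu_gt0; have r1 := r_gt1.
pose C0 : R := r%:R / mu + r%:R.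
have C0_gt0 : 0 < C0.
  have r0 : 0 < r%:R :> R by rewrite ltr0n ltnW.
  by rewrite addr_gt0// divr_gt0.
have eta1 : 0 < (1 : R) <= 1 by rewrite ltr01 lexx.
have [C C_ge0 hC] := chernoff_uniform H C0_gt0 eta1.
pose Ch := 2 / mu * (1 + C0 * mu) ^+ be.
have Ch0 : 0 <= Ch.
  rewrite mulr_ge0//; first by rewrite divr_ge0// ltW.
  by rewrite exprn_ge0// addr_ge0// mulr_ge0// ltW.
pose E := (expR C + 1) * Ch.
have E0 : 0 <= E by rewrite mulr_ge0// addr_ge0// expR_ge0.
exists ((mu^-1 + E) * Ch); first by rewrite mulr_ge0// addr_ge0// invr_ge0 ltW.
move=> dl dl0.
have [c2 c20 hc] := near_pinfty_ex (filterI hC (crossing_bound H C0_gt0 dl0)).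
have x10 := ht_x1 H.
near=> b.
have b1 : 1 <= b by [].
have xb : x1 <= b by [].
have cb : c2 <= b by [].
have b0 : 0 < b by lra.
have Gb := integrated_tail_gt0 H xb.
have lev k : b <= level mu r b k.-1 by exact: level_ge.
have lev0 k : 0 < level mu r b k.-1 by exact: lt_le_trans (lev k).
have N0 k : (0 < k)%N -> (0 < nk r k)%N by exact: nk_gt0.
have NC k : (0 < k)%N -> (nk r k)%:R <= C0 * level mu r b k.-1 by exact: nk_le_level.
have h0 k : (0 < k)%N -> 0 < (nk r k)%:R * tail F (level mu r b k.-1).
  by move=> k0; rewrite mulr_gt0 ?(ht_tail H)// ltr0n N0.
have thE k : theta F mu r b k = tilt F 1 (level mu r b k.-1) (nk r k).
  by rewrite /theta /tilt mul1r.
have hk k : (0 < k)%N -> (nk r k)%:R * tail F (level mu r b k.-1) <= Ch * (pk F mu r b k * G b).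
  by move=> k0; rewrite (pk_scale mu r H)//; exact: mass_le_stratum H _ _ _ _ _.
have chern k : (0 < k)%N -> [/\ 0 < theta F mu r b k,
    (nk r k)%:R * tail F (level mu r b k.-1) < 1 &
    (\int[F]_(x in `]-oo, level mu r b k.-1[) (expR (theta F mu r b k * x))%:E <=
     (1 + C / (nk r k)%:R)%:E)%E].
  move=> k0; have [hch _] := hc _ (le_trans cb (lev k)).
  have := hch _ (N0 k k0) (NC k k0).
  by rewrite mul1r -thE integral_left_ray.
have tE c : b <= c -> F `[c, +oo[%classic = (tail F c)%:E.
  by move=> bc; apply: (ht_tailE H); exact: le_trans bc.
have mgf_gt0 k : (0 < k)%N ->
    (0 < \int[F]_(x in `]-oo, level mu r b k.-1[) (expR (theta F mu r b k * x))%:E)%E.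
  move=> k0; apply: integral_left_ray_gt0; rewrite tE// lte_fin.
  have [_ h _] := chern k k0; apply: le_lt_trans h.
  by rewrite ler_peMl ?(ltW (ht_tail H _))// ler1n N0.
have mgf_fin k : (0 < k)%N ->
    (\int[F]_(x in `]-oo, level mu r b k.-1[) (expR (theta F mu r b k * x))%:E < +oo)%E.
  by move=> k0; have [_ _ h] := chern k k0; exact: le_lt_trans h (ltry _).
have pk0 k : (0 < k)%N -> 0 < pk F mu r b k by exact: (heavy_pk_gt0 mu_gt0 r_gt1 H).
have pk1 : (\sum_(k <oo) (pk F mu r b k)%:E = 1)%E by exact: (heavy_pk_sum mu_gt0 r_gt1 H).
split; first exact: (expectation_Z mu_gt0 r_gt1 tE (ht_tail H) mgf_gt0 mgf_fin pk0 pk1).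
split; first exact: Z_ge0 (ht_tail H) pk0.
split; first exact: measurable_Z.
have m0 : 0 <= G b / mu by rewrite divr_ge0 ?(ltW Gb)// ltW.
have D0 : 0 <= E * G b by rewrite mulr_ge0// ltW.
have Z1 k : (0 < k)%N -> forall x, Zk1 F mu r b k x <= pk F mu r b k * (G b / mu).
  move=> k0 x; apply: le_trans (Zk1_le_qk _ _ _ _ _ _) _.
  rewrite mulrA ler_pdivlMr// mulrC (pk_scale mu r H)//.
  apply: (sum_tail_le mu_gt0 H b0).
  by rewrite leq_nk// leq_pred.
have Z23 k : (0 < k)%N -> forall t : @sample R r k, Zk23 F mu b t <= pk F mu r b k * (E * G b).
  move=> k0 t; have [th0 _ hI] := chern k k0.
  set h := (nk r k)%:R * tail F (level mu r b k.-1).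
  have hL : Lambda F mu r b k (theta F mu r b k) <= C / (nk r k)%:R.
    have fI : (\int[F]_(x in `]-oo, level mu r b k.-1[) (expR (theta F mu r b k * x))%:E)%E
        \is a fin_num by rewrite ge0_fin_numE ?mgf_fin// ltW// mgf_gt0.
    rewrite /Lambda /Rintegral; apply: le_trans (_ : ln (1 + C / (nk r k)%:R) <= _).
      rewrite ler_ln ?posrE.
      - by rewrite -lee_fin fineK.
      - by rewrite -lte_fin fineK// mgf_gt0.
      - by rewrite ltr_pwDl// divr_ge0.
    by apply: le_ln1Dx; rewrite (lt_le_trans (ltrN10 _))// divr_ge0.
  have h2 := Zk2_le_mass mu_gt0 (splice mu b (tuple_path t.1.2.1) (tuple_path t.1.2.2))
    k0 C_ge0 (h0 k k0) (lev0 k) th0 hL.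
  have h3 := Zk3_le_mass F mu b r k (tuple_path t.2).
  apply: le_trans (lerD h2 h3) _; rewrite -/h -[X in _ + X <= _]mul1r -mulrDl.
  have -> : pk F mu r b k * (E * G b) = (expR C + 1) * (Ch * (pk F mu r b k * G b)).
    by rewrite /E; ring.
  by rewrite ler_wpM2l ?hk// addr_ge0// expR_ge0.
apply: le_trans (second_moment_Z mu_gt0 r_gt1 tE (ht_tail H) mgf_gt0 mgf_fin pk0 pk1
  m0 D0 Z1 Z23) _.
rewrite leeD2l//.
have noA k : (hit_noA F mu b r k <= (dl * (Ch * G b))%:E * (pk F mu r b k)%:E)%E.
  case: k => [|k]; first by rewrite hit_noA0 mule0.
  have [_ hcr] := hc _ (le_trans cb (lev k.+1)).
  have nN : (nk r k.+1.-1 <= nk r k.+1)%N by rewrite leq_nk.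
  have := hcr (nk r k.+1) (nk r k.+1.-1) mu b mu_gt0 erefl (ltW b0) (N0 k.+1 isT) nN (NC k.+1 isT).
  move=> /hit_noA_le hA; apply: le_trans hA _; rewrite -EFinM lee_fin -mulrA ler_wpM2l ?(ltW dl0)//.
  apply: le_trans (hk k.+1 isT) _; rewrite le_eqVlt; apply/orP; left; apply/eqP; ring.
have sum_noA : (\sum_(k <oo) hit_noA F mu b r k <= (dl * (Ch * G b))%:E)%E.
  apply: le_trans (_ : _ <= \sum_(k <oo) (dl * (Ch * G b))%:E * (pk F mu r b k)%:E)%E _.
    by apply: lee_nneseries => // k _ _; exact: measure_ge0.
  rewrite nneseriesZl ?pk1 ?mule1// => k _.
  by rewrite lee_fin; case: k => [//|k]; exact/ltW/pk0.
apply: le_trans (lee_wpmul2l _ sum_noA) _; first by rewrite lee_fin addr_ge0.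
rewrite -EFinM lee_fin le_eqVlt; apply/orP; left; apply/eqP; ring.
Unshelve. all: by end_near. Qed.

End second_moment.

(** Integrates [(Z - h)^2 + 2 h Z = Z^2 + h^2]: all terms are nonnegative, so [Z] need not be known
    to be square-integrable. *)
Lemma variance_le_second_moment d (T : measurableType d) (R : realType)
    (P : probability T R) (Z : T -> R) (h : R) :
  measurable_fun setT Z -> (forall t, 0 <= Z t) -> ('E_P[Z] = h%:E)%E ->
  ('V_P[Z] + (h ^+ 2)%:E <= \int[P]_t (Z t ^+ 2)%:E)%E.
Proof.
move=> mZ Z0 EZ.
have h0 : 0 <= h by rewrite -lee_fin -EZ; exact: expectation_ge0.
have IZ : (\int[P]_t (Z t)%:E = h%:E)%E by rewrite -EZ unlock.
have VE : ('V_P[Z] = \int[P]_t ((Z t - h) ^+ 2)%:E)%E.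
  rewrite /variance unlock EZ/= unlock.
  by apply: eq_integral => t _; rewrite expr2.
have mZh : measurable_fun setT (fun t => ((Z t - h) ^+ 2)%:E).
  apply/measurable_EFinP; apply: (measurable_funX 2).
  exact: measurable_funB.
have mZ2 : measurable_fun setT (fun t => (Z t ^+ 2)%:E).
  by apply/measurable_EFinP; exact: measurable_funX.
have mZ1 : measurable_fun setT (fun t => (Z t)%:E) by exact/measurable_EFinP.
have E2 : (\int[P]_t (((Z t - h) ^+ 2)%:E + (2 * h)%:E * (Z t)%:E) =
    \int[P]_t ((Z t ^+ 2)%:E + (h ^+ 2)%:E))%E.
  by apply: eq_integral => t _; rewrite -EFinM -!EFinD; congr EFin; ring.
have p1 t : [set: T] t -> (0 <= ((Z t - h) ^+ 2)%:E)%E by rewrite lee_fin sqr_ge0.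
have p2 t : [set: T] t -> (0 <= (Z t ^+ 2)%:E)%E by rewrite lee_fin sqr_ge0.
have p3 t : [set: T] t -> (0 <= (Z t)%:E)%E by rewrite lee_fin.
have h2 : 0 <= 2 * h by rewrite mulr_ge0.
have p4 t : [set: T] t -> (0 <= (2 * h)%:E * (Z t)%:E)%E by rewrite mule_ge0 ?lee_fin.
have p5 t : [set: T] t -> (0 <= (h ^+ 2)%:E)%E by rewrite lee_fin sqr_ge0.
have m4 : measurable_fun setT (fun t => (2 * h)%:E * (Z t)%:E)%E.
  exact: emeasurable_funM.
move: E2; rewrite ge0_integralD// ge0_integralD// ge0_integralZl//.
rewrite integral_cst// [X in _ = (_ + _ * X)%E](_ : _ = 1%E); last exact: probability_setT.
rewrite mule1 -VE IZ -EFinM => E2.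
suff : ('V_P[Z] + (h ^+ 2)%:E + (h ^+ 2)%:E <=
    \int[P]_t (Z t ^+ 2)%:E + (h ^+ 2)%:E)%E by rewrite leeD2rE.
rewrite -E2 -addeA -EFinD.
by rewrite leeD2l// lee_fin; lra.
Qed.

Lemma limf_esup_eq0 (R : realType) (f : R -> \bar R) : (forall x, 0 <= f x)%E ->
  (forall e, 0 < e -> \forall x \near +oo, (f x <= e%:E)%E) ->
  limf_esup f (pinfty_nbhs R) = 0%E.
Proof.
move=> f0 fe; apply/eqP; rewrite eq_le; apply/andP; split.
  apply/lee_addgt0Pr => e e0; rewrite add0e.
  apply: (@le_trans _ _ (ereal_sup (f @` [set x | (f x <= e%:E)%E]))).
    by apply: ereal_inf_lbound; exists [set x | (f x <= e%:E)%E] => //; exact: fe.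
  by apply: ge_ereal_sup => _ [x hx <-].
apply: le_ereal_inf_tmp => _ [V Voo <-].
have [x Vx] := filter_ex Voo.
by apply: le_trans (f0 x) _; apply: ereal_sup_ubound; exists x.
Qed.

Theorem theorem2 (R : realType) (d : measure_display) (T : measurableType d)
    (P : probability T R) (X : nat -> {RV P >-> R}) (F : probability R R)
    (mu : R) (r : nat) (alpha : R) (L : R -> R)
    (X_indep : mutually_independent X)
    (X_law : forall i (A : set R), measurable A -> distribution P (X i) A = F A)
    (X_mean : ('E_P[X 0%N] = 0)%E)
    (mu_gt0 : 0 < mu) (r_gt1 : (1 < r)%N)
    (alpha_gt1 : 1 < alpha)
    (L_slow : slowly_varying L)
    (F_tail : forall x : R, 0 < x -> tail F x = x `^ (- alpha) * L x)
    (F_left : ('V_P[X 0%N] = +oo)%E ->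
      (limf_esup (fun x : R => F `]-oo, (- x)%R[%classic / F `]x, +oo[%classic) (pinfty_nbhs R)
       < +oo)%E)
    (L_C1 : exists2 t0 : R, 0 < t0 & forall x : R, t0 <= x ->
      derivable L x 1 /\ {for x, continuous (derive1 L)})
    (L_deriv : forall e : R, 0 < e ->
      \forall x \near +oo, `|derive1 L x| <= e * `|L x / x|) :
  let hit (b : R) : \bar R := P [set w | tau mu b (X ^~ w) != None] in
  (\forall b \near +oo, ('E_(Q F mu r b)[Z F mu r b] = hit b)%E) /\
  limf_esup (fun b : R => 'V_(Q F mu r b)[Z F mu r b] / hit b ^+ 2)%E
            (pinfty_nbhs R) = 0%E.
Proof.
move=> hit.
have [p [M [be [x1 H]]]] := exists_heavy_tail X_law X_mean alpha_gt1 L_slow F_tail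
  F_left L_C1 L_deriv.
have [D0 D0_ge0 hQ] := second_moment_asymptotics mu_gt0 r_gt1 H.
have hitE b : 0 <= b -> hit b = (\sum_(k <oo) hit_block F mu b r k)%E.
  by move=> b0; exact: hit_series.
have pos : \forall b \near +oo, (0 : R) <= b by exact: nbhs_pinfty_ge.
split.
  by apply: filterS (filterI pos (hQ _ ltr01)) => b [b0 [-> _]]; rewrite hitE.
apply: limf_esup_eq0 => [b|e e0].
  by rewrite mule_ge0 ?variance_ge0// inve_ge0 expe_ge0.
(* The 2 comes from the leading term, [(G / mu) h - h^2 <= 2 dl h^2]; the rest from [G <= 2 h mu] in
   the error term. *)
pose K := 2 + 4 * (D0 * mu ^+ 2).
have K0 : 0 < K by rewrite ltr_pwDl// mulr_ge0// mulr_ge0// sqr_ge0.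
pose dl := Num.min 2^-1 (e / K).
have dl0 : 0 < dl by rewrite lt_min invr_gt0 ltr0n divr_gt0.
have dl2 : dl <= 2^-1 by rewrite ge_min lexx.
have dlK : dl * K <= e by rewrite -ler_pdivlMr// ge_min lexx orbT.
have dl1 : 0 < dl < 1 by rewrite dl0; lra.
have low := hit_lower X_indep X_law mu_gt0 H dl1.
have big : \forall b \near +oo, x1 <= b by apply: nbhs_pinfty_ge; exact: num_real.
apply: filterS (filterI (filterI pos big) (filterI low (hQ _ dl0))).
move=> b [[b0 xb] [hlow [EZ [Z0 [mZ EZ2]]]]].
have Gb := integrated_tail_gt0 H xb; set G := integrated_tail F b in Gb hlow EZ2.
rewrite -(hitE _ b0) in EZ EZ2; rewrite -/(hit b) in hlow.
have hfin : hit b \is a fin_num.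
  by apply: fin_num_measure; exact: measurable_hit.
rewrite -(fineK hfin) in EZ EZ2 hlow *; set h := fine (hit b) in EZ EZ2 hlow *.
rewrite lee_fin in hlow.
(* [(1 + 2 dl) (1 - dl) >= 1] because [dl <= 1 / 2]. *)
have Gh : G <= (1 + 2 * dl) * (h * mu).
  have : (1 - dl) * G <= h * mu by rewrite -ler_pdivrMr// -mulrA.
  have d0 : 0 <= 1 + 2 * dl by lra.
  move=> /(ler_wpM2l d0); apply: le_trans.
  rewrite mulrA ler_peMl ?(ltW Gb)//; nra.
have h0 : 0 < h.
  by apply: lt_le_trans hlow; rewrite mulr_gt0 ?divr_gt0//; lra.
have V := le_trans (variance_le_second_moment mZ Z0 EZ) EZ2.
have V0 : (0 <= 'V_(Q F mu r b)[Z F mu r b])%E by exact: variance_ge0.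
(* The bound on the second moment is finite, which excludes an infinite variance. *)
move: V V0; case: ('V_(Q F mu r b)[Z F mu r b])%E => [v||//]; last by rewrite -EFinM -EFinD.
rewrite -EFinM -!EFinD !lee_fin => V v0.
rewrite -EFin_expe inver gt_eqF ?exprn_gt0// -EFinM lee_fin ler_pdivrMr ?exprn_gt0//.
apply: le_trans (ler_wpM2r (sqr_ge0 h) dlK).
have m1 : G / mu * h <= (1 + 2 * dl) * h ^+ 2.
  by rewrite expr2 mulrA ler_wpM2r ?(ltW h0)// ler_pdivrMr// -mulrA.
have G2 : G ^+ 2 <= 4 * mu ^+ 2 * h ^+ 2.
  have G1 : G <= 2 * (h * mu).
    apply: le_trans Gh _; rewrite ler_wpM2r ?mulr_ge0 ?(ltW h0) ?(ltW mu_gt0)//; lra.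
  have -> : 4 * mu ^+ 2 * h ^+ 2 = (2 * (h * mu)) ^+ 2 by ring.
  by rewrite lerXn2r ?nnegrE ?(ltW Gb) ?mulr_ge0 ?(ltW h0) ?(ltW mu_gt0).
have G3 : dl * (D0 * G ^+ 2) <= dl * (D0 * (4 * mu ^+ 2 * h ^+ 2)).
  by rewrite ler_wpM2l ?(ltW dl0)// ler_wpM2l.
have -> : dl * K * h ^+ 2 = 2 * dl * h ^+ 2 + dl * (D0 * (4 * mu ^+ 2 * h ^+ 2)).
  by rewrite /K; ring.
lra.
Qed.
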